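(* The limit $\lim_{d\to\infty} m(P_d)$ exists and $$\lim_{d\to\infty} m(P_d)=\frac{9}{2\pi^2}\zeta(3),$$ where $\zeta$ is the Riemann zeta function.
   Context: For $d\geq 1$ let $P_d(x,y)=\sum_{i,j\geq 0,\ i+j\leq d} x^i y^j\in\mathbb{C}[x,y]$. The (logarithmic) Mahler measure of $P\in\mathbb{C}[x,y]$ is $m(P)=\frac{1}{(2\pi)^2}\int_0^{2\pi}\int_0^{2\pi}\log|P(e^{i\theta_1},e^{i\theta_2})|\,d\theta_1\,d\theta_2$. *)

(* Defs.v *)
From mathcomp Require Import all_boot all_order all_algebra.
From mathcomp Require Import all_classical all_reals all_analysis.
From mathcomp Require Import complex.

Set Implicit Arguments.
Unset Strict Implicit.
Unset Printing Implicit Defensive.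

Import Order.TTheory GRing.Theory Num.Theory numFieldNormedType.Exports.
Local Open Scope classical_set_scope.
Local Open Scope ring_scope.

(* e^{it} *)
Definition expi (R : realType) (t : R) : R[i] := Complex (cos t) (sin t).

(* The ring C[x, y] is {poly {poly R[i]}}, as in polyXY: x is 'X, y is 'Y,
   and u.[a, b] is the value of u at x = a, y = b.

   The logarithm is lne, so that log 0 = -oo; the zero set of a nonzero u on
   the torus is negligible. The integrand is bounded above, hence the Lebesgue
   integrals are well defined in \bar R (no +oo - oo). *)
Definition mahler_measure (R : realType) (u : {poly {poly R[i]}}) : \bar R :=
  (((2 * pi) ^+ 2)^-1%:E *
   \int[lebesgue_measure]_(t2 in `[0%R, (2 * pi)%R])
     \int[lebesgue_measure]_(t1 in `[0%R, (2 * pi)%R])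
       lne (ComplexField.Normc.normc u.[expi t1, expi t2]%R)%:E)%E.

Definition P_ (R : realType) (d : nat) : {poly {poly R[i]}} :=
  \sum_(i < d.+1) \sum_(j < d.+1 | (i + j <= d)%N) 'X ^+ i * 'Y ^+ j.

(* Riemann's zeta function on the half-line s > 1, as its Dirichlet series
   (riemannR s n = 1 / (n+1)^s); the value is meaningless for s <= 1. *)
Definition zeta (R : realType) (s : R) : R := limn (series (riemannR s)).

(* Main.v *)
(** Write [x = e^{2is}], [y = e^{2ip}], [N = d + 2] and [r = N p]. Then
    [P_d(x,y) (y-1)(x-y)(x-1) = (y-1) x^N + (1-y^N) x + (y^N-y)], and the three
    linear factors have Mahler measure [0]. For fixed [y] the right-hand side is
    [A + B x], where [A] depends on [x] only through [x^N = e^{2iq}]; averaging its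
    logarithm over the [N] values of [x] with the same [x^N] gives
    [log |A^N - (-B)^N e^{2iq}| / N], which is [log (max |A| |B|) = Jf p q r] up to
    [O(1/N)]. As [d] grows, [N p] becomes independent of [p], so [m(P_d)] tends to
    the mean of [Jf p q r] over [p, q, r] in [[0, pi]].

    Since [|B| = 2 |sin r|] and [|A|^2 = 4 sin^2 r + 16 kap p q r], the excess
    [2 (Jf - log |B|)] vanishes off the two squares [[0, r]^2] and [[r, pi]^2],
    where it is the logarithm of [1 + 4 kap / sin^2 r]. An integration by parts
    turns its integral over [[0, r]^2] into that of
    [2 (r - 2t) t cot t] over [[0, r]]; integrating over [r] leaves the integral of
    [t cot t (pi - t)(pi - 3t)] over [[0, pi]]. Expanding [cot] by the Dirichlet
    kernel, with the Riemann-Lebesgue lemma for the remainder, this is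
    [9 pi / 2 * zeta 3]. *)
Require Import Defs.
From mathcomp Require Import all_boot all_order all_algebra.
From mathcomp Require Import all_classical all_reals all_analysis.
From mathcomp Require Import measurable_realfun complex ring lra.

Set Implicit Arguments.
Unset Strict Implicit.
Unset Printing Implicit Defensive.

Import Order.TTheory GRing.Theory Num.Theory numFieldNormedType.Exports.
Local Open Scope classical_set_scope.
Local Open Scope ring_scope.

(** Every integrand is a logarithm with singularities, so neither integrability nor a sign comes for
    free. Subtracting it from the logarithm of an upper bound ([ln 2], [ln 6], [ln 5]) gives a
    nonnegative function, for which Tonelli, averaging and changes of variable hold before
    integrability is known. Identities between logarithms fail where a sine vanishes, since
    [ln 0 = 0]; these points form countable sets, hence the many almost-everywhere arguments. The
    danger in averaging over the [N] values of [x] is cancellation between [A^N] and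
    [(-B)^N e^{2iq}] when [|A|] is close to [|B|]. It stays under control because [|A|^2 - |B|^2] is
    a product of four sines: the loss is a sum of functions [ell] of mean 0, plus bounded terms,
    divided by [N]. The constant: each of the two squares contributes [9 pi / 2 * zeta 3]. The
    excess is twice a logarithm and the mean over [p] carries [1 / pi], which leaves
    [9 / 2 * zeta 3]; the normalisation [1 / pi^2] of the half-angle torus gives the rest. *)

Section integral_tools.
Context {R : realType}.
Local Notation mu := (@lebesgue_measure R).
Implicit Types (f g : R -> R) (D : set R).

(** * Change of variable and periodicity for Lebesgue integrals *)

Lemma measurable_invr : measurable_fun [set: R] (fun x : R => x^-1).
Proof.
(* The inverse becomes a composite of measurable total functions; at [0] the factor [x] reproduces
   the convention [0^-1 = 0]. *)
have -> : (fun x : R => x^-1) = (fun x => x * expR (- ln (x ^+ 2))).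
  apply/funext => x; have [->|x0] := eqVneq x 0; first by rewrite invr0 mul0r.
  rewrite -lnV ?posrE ?exprn_even_gt0// lnK ?posrE ?invr_gt0 ?exprn_even_gt0//.
  by rewrite expr2 invfM mulVKf.
apply: measurable_funM => //; apply: measurableT_comp; first exact: measurable_expR.
apply: measurableT_comp => //; apply: measurableT_comp; first exact: measurable_ln.
exact: exprn_measurable.
Qed.

(** Lebesgue measure is determined by its values on the intervals []a, b]]. Their preimages are
    intervals of length [(b - a) / |s|], closed on the other side when [s < 0], hence the two
    cases. *)
Lemma pushforward_affine (s c : R) (A : set R) : s != 0 -> measurable A ->
  (mu A = `|s|%:E * mu ((fun x => s * x + c)%R @^-1` A))%E.
Proof.
move=> s0 mA.
have mphi : measurable_fun [set: measurableTypeR R]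
    (fun x => s * x + c : measurableTypeR R).
  by apply: measurable_funD => //; exact: measurable_funM.
pose m := mscale (NngNum (normr_ge0 s)) (pushforward mu
  (fun x : measurableTypeR R => s * x + c : measurableTypeR R)).
pose mm : {measure set (measurableTypeR R) -> \bar R} := m mphi.
suff : mu A = mm A by [].
apply: lebesgue_measure_unique => // _ [[a b]] _ <-.
rewrite lebesgue_measure_itv/= lte_fin.
rewrite (_ : mm _ = `|s|%:E * mu ((fun x => s * x + c)%R @^-1` `]a, b]))%E//.
have [s_gt0|s_lt0] := ltP 0 s.
  rewrite (_ : _ @^-1` _ = `](a - c) / s, (b - c) / s]%classic); last first.
    apply/seteqP; split=> x /=; rewrite !in_itv/= ltr_pdivrMr// ler_pdivlMr//;
      by rewrite ltrBlDr lerBrDr mulrC.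
  rewrite lebesgue_measure_itv/= lte_fin ltr_pM2r ?invr_gt0// ltrD2r.
  case: ifPn => _; last by rewrite mule0.
  by rewrite gtr0_norm// -!EFinD -EFinM; congr EFin; field.
have {s_lt0} s_lt0 : s < 0 by rewrite lt_neqAle s0.
rewrite (_ : _ @^-1` _ = `[(b - c) / s, (a - c) / s[%classic); last first.
  apply/seteqP; split=> x /=; rewrite !in_itv/= ltr_ndivlMr// ler_ndivrMr//;
    by rewrite ltrBlDr lerBrDr mulrC andbC.
rewrite lebesgue_measure_itv/= lte_fin ltr_nM2r ?invr_lt0// ltrD2r.
case: ifPn => _; last by rewrite mule0.
by rewrite ltr0_norm// -!EFinD -EFinM; congr EFin; field.
Qed.

Lemma ge0_integral_affine (s c : R) D (f : R -> \bar R) : s != 0 ->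
  measurable D -> measurable_fun [set: R] f -> (forall x, 0 <= f x)%E ->
  (\int[mu]_(x in D) f x =
   `|s|%:E * \int[mu]_(x in (fun x => s * x + c)%R @^-1` D) f (s * x + c)%R)%E.
Proof.
move=> s0 mD mf f0.
have mphi : measurable_fun [set: measurableTypeR R]
    (fun x => s * x + c : measurableTypeR R).
  by apply: measurable_funD => //; exact: measurable_funM.
pose m := mscale (NngNum (normr_ge0 s)) (pushforward mu
  (fun x : measurableTypeR R => s * x + c : measurableTypeR R)).
transitivity (\int[m mphi]_(x in D) f x)%E.
  by apply: eq_measure_integral => A mA _; exact: pushforward_affine.
rewrite ge0_integral_mscale//=; last exact: measurable_funS mf.
by rewrite ge0_integral_pushforward//; exact: measurable_funS mf.
Qed.

Lemma ge0_integral_affine_itv (s c a b : R) (f : R -> \bar R) : 0 < s ->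
  measurable_fun [set: R] f -> (forall x, 0 <= f x)%E ->
  (\int[mu]_(x in `[(s * a + c)%R, (s * b + c)%R]) f x =
   s%:E * \int[mu]_(x in `[a, b]) f (s * x + c)%R)%E.
Proof.
move=> s0 mf f0; rewrite (@ge0_integral_affine s c)// ?gt_eqF// gtr0_norm//.
congr (_ * _)%E; congr (integral _ _ _).
by apply/seteqP; split=> x /=; rewrite !in_itv/= !lerD2r !ler_pM2l.
Qed.

Lemma ge0_integral_reflect (c a b : R) (f : R -> \bar R) :
  measurable_fun [set: R] f -> (forall x, 0 <= f x)%E ->
  (\int[mu]_(x in `[(c - b)%R, (c - a)%R]) f x =
   \int[mu]_(x in `[a, b]) f (c - x)%R)%E.
Proof.
move=> mf f0; rewrite (@ge0_integral_affine (-1) c)// ?oppr_eq0 ?oner_eq0//.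
rewrite normrN1 mul1e.
under [RHS]eq_integral do rewrite addrC -mulN1r.
congr (integral _ _ _).
by apply/seteqP; split=> x /=; rewrite !in_itv/= mulN1r (addrC _ c) !lerD2l !lerN2 andbC.
Qed.

Lemma ge0_integral_itv_cat (a b c : R) (f : R -> \bar R) :
  a <= b -> b <= c -> measurable_fun [set: R] f -> (forall x, 0 <= f x)%E ->
  (\int[mu]_(x in `[a, c]) f x =
   \int[mu]_(x in `[a, b]) f x + \int[mu]_(x in `[b, c]) f x)%E.
Proof.
move=> ab bc mf f0.
rewrite -(@integral_itv_obnd_cbnd _ b (BRight c)); last exact: measurable_funS mf.
rewrite -ge0_integral_setU//.
- by rewrite -itv_bndbnd_setU.
- exact: measurable_funS mf.
- apply/disj_setPS => x /= []; rewrite !in_itv/= => /andP[_ xb] /andP[bx _].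
  by move: (lt_le_trans bx xb); rewrite ltxx.
Qed.

(* One period is cut into [N] pieces, each rescaled back to [[0, L]]. *)
Lemma ge0_integral_split (N : nat) (L : R) (f : R -> \bar R) : (0 < N)%N ->
  0 <= L ->
  measurable_fun [set: R] f -> (forall x, 0 <= f x)%E ->
  (\int[mu]_(x in `[0%R, L]) f x =
   \int[mu]_(x in `[0%R, L])
     (N%:R^-1%:E * \sum_(k < N) f ((x + L * k%:R) / N%:R)%R))%E.
Proof.
move=> N0 L0 mf f0.
have N0' : (0 : R) < N%:R by rewrite ltr0n.
have mfk (k : nat) : measurable_fun [set: R] (fun x => f ((x + L * k%:R) / N%:R)).
  apply: measurableT_comp => //; apply: measurable_funM => //.
  exact: measurable_funD.
rewrite ge0_integralZl//=; last 2 first.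
- by apply: emeasurable_sum => k; exact: measurable_funS (mfk k).
- by move=> x _; apply: sume_ge0.
rewrite ge0_integral_sum//; last by move=> k; exact: measurable_funS (mfk k).
have key (n : nat) : (\int[mu]_(x in `[0%R, (L * n%:R / N%:R)%R]) f x =
    N%:R^-1%:E * \sum_(k < n) \int[mu]_(x in `[0%R, L])
      f ((x + L * k%:R) / N%:R)%R)%E.
  elim: n => [|n IHn].
    rewrite big_ord0 mule0 mulr0 mul0r set_itv1; exact: integral_set1.
  rewrite (@ge0_integral_itv_cat _ (L * n%:R / N%:R))//; last 2 first.
  - by rewrite !mulr_ge0// invr_ge0 ltW.
  - by rewrite ler_pM2r ?invr_gt0// ler_wpM2l// ler_nat.
  rewrite IHn big_ord_recr/= ge0_muleDr//; last 2 first.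
  - by apply: sume_ge0 => k _; exact: integral_ge0.
  - exact: integral_ge0.
  congr (_ + _)%E.
  under [in RHS]eq_integral do rewrite mulrDl (mulrC _ N%:R^-1).
  rewrite -ge0_integral_affine_itv ?invr_gt0//.
  congr (integral _ _ _); apply/seteqP; split=> x /=; rewrite !in_itv/= mulr0 add0r;
  by rewrite -natr1 mulrDr mulr1 mulrDl (addrC (_ * _ / _)) (mulrC L _^-1) (mulrC _^-1 L).
by rewrite -key mulfK// gt_eqF.
Qed.

Lemma ge0_integral_periodic (L c : R) (f : R -> \bar R) : 0 < L ->
  measurable_fun [set: R] f -> (forall x, 0 <= f x)%E ->
  (forall x, f (x + L) = f x) ->
  (\int[mu]_(x in `[0%R, L]) f (x + c)%R = \int[mu]_(x in `[0%R, L]) f x)%E.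
Proof.
move=> L0 mf f0 pf.
have pfN (n : nat) x : f (x + L * n%:R) = f x.
  elim: n => [|n IHn]; first by rewrite mulr0 addr0.
  by rewrite -natr1 mulrDr mulr1 addrA pf.
have pfZ (z : int) x : f (x + L * z%:~R) = f x.
  case: z => n; first exact: pfN.
  by rewrite NegzE mulrNz -(pfN n.+1 (_ + _)) mulrN pmulrn subrK.
(* [b] is a multiple of [L] in [[c, c + L]]. Moving [[c, b]] by one period turns [[c, c + L]] into
   [[b, b + L]], a translate of [[0, L]] by a whole number of periods. *)
pose m : int := Num.ceil (c / L).
pose b := L * m%:~R.
have cb : c <= b by rewrite /b mulrC -ler_pdivrMr// /m ceil_ge.
have bc : b <= c + L.
  have : m%:~R < c / L + 1 by rewrite -ltrBlDr; have := ceilB1_lt (c / L); rewrite intrB.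
  move=> /ltW; rewrite -(ler_pM2l L0) -/b => /le_trans; apply.
  by rewrite mulrDr mulr1 mulrCA divff ?mulr1// gt_eqF.
have sh a1 b1 t : (\int[mu]_(x in `[(a1 + t)%R, (b1 + t)%R]) f x =
    \int[mu]_(x in `[a1, b1]) f (x + t)%R)%E.
  have := @ge0_integral_affine_itv 1 t a1 b1 f ltr01 mf f0.
  by rewrite mul1e !mul1r => ->; apply: eq_integral => x _; rewrite !mul1r.
rewrite -sh add0r (addrC L).
rewrite (ge0_integral_itv_cat cb bc)//.
have -> : (\int[mu]_(x in `[c, b]) f x = \int[mu]_(x in `[(c + L)%R, (b + L)%R]) f x)%E.
  by rewrite sh; apply: eq_integral => x _; rewrite pf.
rewrite addeC -ge0_integral_itv_cat//; last by rewrite lerD2r.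
rewrite -[X in `[X, _]%R]add0r (addrC b) sh.
by apply: eq_integral => x _; rewrite pfZ.
Qed.

End integral_tools.

(** * Fubini on rectangles, almost-everywhere comparison, averages over a subdivided period *)

Section real_integral_tools.
Context {R : realType}.
Local Notation mu := (@lebesgue_measure R).
Implicit Types (f g : R -> R) (D : set R).

Lemma EFin_Rintegral D f : measurable D -> mu.-integrable D (EFin \o f) ->
  (\int[mu]_(x in D) (f x)%:E)%E = (\int[mu]_(x in D) f x)%:E.
Proof. by move=> mD intf; rewrite fineK//; exact: integrable_fin_num. Qed.

(** Extension by zero moves an iterated integral over a rectangle to the whole plane, where Fubini
    and Tonelli apply to a single function of the pair. *)
Lemma iterated_patchl (D1 D2 : set R) (f : R -> R -> \bar R) :
  (\int[mu]_(x in D1) \int[mu]_(y in D2) f x y =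
   \int[mu]_x \int[mu]_y ((fun z => f z.1 z.2) \_ (D1 `*` D2)) (x, y))%E.
Proof.
rewrite [LHS]integral_mkcond; apply: eq_integral => x _.
rewrite patchE; case: ifPn => [|/negP]; rewrite inE => D1x.
  rewrite integral_mkcond; apply: eq_integral => y _.
  by rewrite !patchE in_setX/= (mem_set D1x).
by rewrite integral0_eq// => y _; rewrite patchE in_setX/= memNset.
Qed.

Lemma iterated_patchr (D1 D2 : set R) (f : R -> R -> \bar R) :
  (\int[mu]_(y in D2) \int[mu]_(x in D1) f x y =
   \int[mu]_y \int[mu]_x ((fun z => f z.1 z.2) \_ (D1 `*` D2)) (x, y))%E.
Proof.
rewrite [LHS]integral_mkcond; apply: eq_integral => y _.
rewrite patchE; case: ifPn => [|/negP]; rewrite inE => D2y.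
  rewrite integral_mkcond; apply: eq_integral => x _.
  by rewrite !patchE in_setX/= [y \in D2]mem_set// andbT.
by rewrite integral0_eq// => x _; rewrite patchE in_setX/= [y \in D2]memNset// andbF.
Qed.

Lemma ge0_fubini_set (D1 D2 : set R) (f : R -> R -> \bar R) :
  measurable D1 -> measurable D2 ->
  measurable_fun [set: R * R] (fun z => f z.1 z.2) ->
  (forall x y, D1 x -> D2 y -> 0 <= f x y)%E ->
  (\int[mu]_(x in D1) \int[mu]_(y in D2) f x y =
   \int[mu]_(y in D2) \int[mu]_(x in D1) f x y)%E.
Proof.
move=> mD1 mD2 mf f0; rewrite [LHS]iterated_patchl [RHS]iterated_patchr.
set g := patch _ _ _; apply: (@fubini_tonelli _ _ _ _ _ mu mu g).
  apply/(measurable_restrictT _ _).1; first exact: measurableX.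
  exact: measurable_funS mf.
move=> z; rewrite /g patchE; case: ifPn => //; rewrite inE => -[? ?].
exact: f0.
Qed.

Lemma fubini_set (D1 D2 : set R) (f : R -> R -> \bar R) :
  measurable D1 -> measurable D2 ->
  measurable_fun [set: R * R] (fun z => f z.1 z.2) ->
  (\int[mu]_(x in D1) \int[mu]_(y in D2) `|f x y| < +oo)%E ->
  (\int[mu]_(x in D1) \int[mu]_(y in D2) f x y =
   \int[mu]_(y in D2) \int[mu]_(x in D1) f x y)%E.
Proof.
move=> mD1 mD2 mf foo; rewrite [LHS]iterated_patchl [RHS]iterated_patchr.
set g := patch _ _ _.
have mg : measurable_fun setT g.
  apply/(measurable_restrictT _ _).1; first exact: measurableX.
  exact: measurable_funS mf.
apply: (@Fubini _ _ _ _ _ mu mu g); apply/integrable12ltyP => //.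
move: foo; rewrite iterated_patchl.
set a := (X in (X < _)%E); set b := (X in _ -> (X < _)%E); suff -> : a = b by []; rewrite /a /b.
apply: eq_integral => x _; apply: eq_integral => y _.
by rewrite /g !patchE; case: ifPn => //; rewrite abse0.
Qed.

Lemma measurable_ge0_integral d (T : measurableType d) (D2 : set R) (f : T -> R -> \bar R) :
  measurable D2 -> measurable_fun [set: T * R] (fun z => f z.1 z.2) ->
  (forall x y, D2 y -> 0 <= f x y)%E ->
  measurable_fun [set: T] (fun x => \int[mu]_(y in D2) f x y)%E.
Proof.
move=> mD2 mf f0.
pose g : T * R -> \bar R := (fun z => f z.1 z.2) \_ (setT `*` D2).
have mg : measurable_fun setT g.
  apply/(measurable_restrictT _ _).1; first exact: measurableX.
  exact: measurable_funS mf.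
have g0 z : (0 <= g z)%E.
  by rewrite /g patchE; case: ifPn => //; rewrite inE => -[_ ?]; exact: f0.
have := measurable_fun_fubini_tonelli_F (m2 := mu) g mg g0.
rewrite (_ : fubini_F _ _ = fun x => \int[mu]_(y in D2) f x y)%E//.
apply/funext => x; rewrite /fubini_F [RHS]integral_mkcond; apply: eq_integral => y _.
by rewrite /g !patchE in_setX/= in_setT.
Qed.

Lemma aeS (P Q : R -> Prop) : (forall x, P x -> Q x) ->
  {ae mu, forall x, P x} -> {ae mu, forall x, Q x}.
Proof.
move=> PQ [Z [mZ Z0 sub]]; exists Z; split => // x /= nQ; apply: sub => /= Px.
exact/nQ/PQ.
Qed.

Lemma aeI (P Q : R -> Prop) : {ae mu, forall x, P x} -> {ae mu, forall x, Q x} ->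
  {ae mu, forall x, P x /\ Q x}.
Proof.
move=> [Z [mZ Z0 sub]] [Z' [mZ' Z0' sub']]; exists (Z `|` Z'); split.
- exact: measurableU.
- by apply/eqP; rewrite null_set_setU.
- move=> x /= /not_andP[nP|nQ]; [left|right]; [exact: sub|exact: sub'].
Qed.

Lemma ae_le_integrable D (f g : R -> \bar R) : measurable D -> measurable_fun D f ->
  mu.-integrable D g -> {ae mu, forall x, D x -> (`|f x| <= `|g x|)%E} ->
  mu.-integrable D f.
Proof.
move=> mD mf /integrableP[mg intg] fg; apply/integrableP; split => //.
apply: le_lt_trans intg; apply: ae_ge0_le_integral => //; exact: measurableT_comp.
Qed.

Lemma ae_le_Rintegral D f g : measurable D ->
  mu.-integrable D (EFin \o f) -> mu.-integrable D (EFin \o g) ->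
  {ae mu, forall x, D x -> f x <= g x} ->
  \int[mu]_(x in D) f x <= \int[mu]_(x in D) g x.
Proof.
move=> mD intf intg [Z [mZ Z0 sub]].
rewrite /Rintegral !(@negligible_integral _ _ _ mu D Z)//.
have mDZ : measurable (D `\` Z) by exact: measurableD.
have intf' : mu.-integrable (D `\` Z) (EFin \o f) by apply: integrableS intf.
have intg' : mu.-integrable (D `\` Z) (EFin \o g) by apply: integrableS intg.
rewrite fine_le//; [exact: integrable_fin_num intf'|exact: integrable_fin_num intg'|].
apply: le_integral => // x /[!inE] -[Dx Zx]; rewrite lee_fin.
by apply: contrapT => fgx; apply: Zx; apply: sub => /(_ Dx).
Qed.

Lemma integrable_bounded (a b M : R) f : measurable_fun [set: R] f ->
  {in `[a, b], forall x, `|f x| <= M} -> mu.-integrable `[a, b] (EFin \o f).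
Proof.
move=> mf fM; apply: measurable_bounded_integrable => //.
- by apply: compact_finite_measure; exact: segment_compact.
- exact: measurable_funS mf.
- exists M; split; first exact: num_real.
  by move=> t Mt x /= /fM/le_trans; apply; exact: ltW.
Qed.

Lemma integrableDR D f g : measurable D -> mu.-integrable D (EFin \o f) ->
  mu.-integrable D (EFin \o g) -> mu.-integrable D (EFin \o (fun x => f x + g x)).
Proof.
move=> mD intf intg; have := @integrableD _ _ _ mu D mD _ _ intf intg.
by apply: eq_integrable => // x _; rewrite /= EFinD.
Qed.

Lemma integrableZR D k f : measurable D -> mu.-integrable D (EFin \o f) ->
  mu.-integrable D (EFin \o (fun x => k * f x)).
Proof.
move=> mD intf; have := @integrableZl _ _ _ mu D mD k _ intf.
by apply: eq_integrable => // x _; rewrite /= EFinM.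
Qed.

Lemma integrableBR D f g : measurable D -> mu.-integrable D (EFin \o f) ->
  mu.-integrable D (EFin \o g) -> mu.-integrable D (EFin \o (fun x => f x - g x)).
Proof.
move=> mD intf intg; have := @integrableB _ _ _ mu D mD _ _ intf intg.
by apply: eq_integrable => // x _; rewrite /= EFinB.
Qed.

Lemma integrable_cstR (a b k : R) : mu.-integrable `[a, b] (EFin \o (fun=> k)).
Proof. by apply: (@integrable_bounded _ _ `|k|) => // x _. Qed.

Lemma Rintegral_cstR (a b k : R) : a <= b -> \int[mu]_(x in `[a, b]) k = k * (b - a).
Proof.
move=> ab; rewrite Rintegral_cst//= lebesgue_measure_itv/= lte_fin.
by case: ltgtP ab => // -> _; rewrite subrr.
Qed.

(** The sample points are the solutions [y] of [N y = x] modulo [L]; this averaging operator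
    preserves the integral over a period. *)
Definition mean (N : nat) (L : R) f x := N%:R^-1 * \sum_(k < N) f ((x + L * k%:R) / N%:R).

Lemma measurable_mean N L f : measurable_fun [set: R] f ->
  measurable_fun [set: R] (mean N L f).
Proof.
move=> mf; apply: measurable_funM => //; apply: measurable_sum => k.
apply: measurableT_comp => //; apply: measurable_funM => //.
exact: measurable_funD.
Qed.

Lemma mean_ge0 N L f x : (forall x, 0 <= f x) -> 0 <= mean N L f x.
Proof. by move=> f0; rewrite mulr_ge0 ?invr_ge0// sumr_ge0. Qed.

Lemma ge0_integral_mean N L f : (0 < N)%N -> 0 <= L ->
  measurable_fun [set: R] f -> (forall x, 0 <= f x) ->
  (\int[mu]_(x in `[0%R, L]) (f x)%:E = \int[mu]_(x in `[0%R, L]) (mean N L f x)%:E)%E.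
Proof.
move=> N0 L0 mf f0.
rewrite (@ge0_integral_split R N L (EFin \o f))//; last exact/measurable_EFinP.
by apply: eq_integral => x _; rewrite /mean EFinM sumEFin.
Qed.

Lemma ge0_integrableP D f : measurable_fun D f -> (forall x, 0 <= f x) ->
  (\int[mu]_(x in D) (f x)%:E < +oo)%E <-> mu.-integrable D (EFin \o f).
Proof.
move=> mf f0; have E : (\int[mu]_(x in D) (f x)%:E = \int[mu]_(x in D) `|(f x)%:E|)%E.
  by apply: eq_integral => x _; rewrite gee0_abs// lee_fin.
split=> [foo|/integrableP[_]]; last by rewrite E.
by apply/integrableP; split; [exact/measurable_EFinP|rewrite -E].
Qed.

Lemma Rintegral_mean N L f : (0 < N)%N -> 0 <= L ->
  measurable_fun [set: R] f -> (forall x, 0 <= f x) ->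
  mu.-integrable `[0, L] (EFin \o f) ->
  mu.-integrable `[0, L] (EFin \o mean N L f) /\
  \int[mu]_(x in `[0, L]) f x = \int[mu]_(x in `[0, L]) mean N L f x.
Proof.
move=> N0 L0 mf f0 intf; split; last by rewrite /Rintegral (@ge0_integral_mean N).
apply/ge0_integrableP.
- by apply: measurable_funTS; exact: measurable_mean.
- by move=> x; exact: mean_ge0.
rewrite -ge0_integral_mean//; apply/ge0_integrableP => //.
exact: measurable_funTS.
Qed.

End real_integral_tools.

(** * The logarithm of the sine: integrability and vanishing mean *)

Section log_sine.
Context {R : realType}.
Local Notation mu := (@lebesgue_measure R).

(** This is [log |1 - e^{2ix}|], the contribution of a linear factor on the circle, except that its
    value is [ln 0 = 0] instead of [-oo] at the multiples of [pi]. *)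
Definition ell (x : R) : R := ln (2 * `|sin x|).

Lemma measurable_sin : measurable_fun [set: R] (@sin R).
Proof. by apply: continuous_measurable_fun; exact: continuous_sin. Qed.

Lemma measurable_cos : measurable_fun [set: R] (@cos R).
Proof. by apply: continuous_measurable_fun; exact: continuous_cos. Qed.

Lemma measurable_ell : measurable_fun [set: R] ell.
Proof.
apply: measurableT_comp; first exact: measurable_ln.
apply: measurable_funM => //; apply: measurableT_comp => //.
exact: measurable_sin.
Qed.

Lemma ellDpi x : ell (x + pi) = ell x.
Proof. by rewrite /ell sinDpi normrN. Qed.

Lemma ell_le x : ell x <= ln 2.
Proof.
rewrite /ell; have [->|s0] := eqVneq (sin x) 0.
  by rewrite normr0 mulr0 ln0// ln_ge0// ler1n.
by rewrite ler_ln ?posrE ?mulr_gt0 ?normr_gt0// ger_pMr// sin_max.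
Qed.

(** Subtracting the multiple of [pi] given by the floor leaves a point of [[0, pi[], where the sine
    is positive except at [0]. *)
Lemma sin_eq0P (x : R) : sin x = 0 -> exists k : int, x = pi * k%:~R.
Proof.
move=> sx0; exists (Num.floor (x / pi)); set k := Num.floor _.
have p0 := pi_gt0 R.
have kx : pi * k%:~R <= x by rewrite mulrC -ler_pdivlMr// /k floor_le.
have xk : x < pi * k%:~R + pi.
  have : x / pi < k%:~R + 1 by have := floorD1_gt (x / pi); rewrite intrD.
  by rewrite ltr_pdivrMr// mulrDl mul1r (mulrC _ pi).
have sN (n : nat) (y : R) : sin y = 0 -> sin (y + pi * n%:R) = 0 /\ sin (y - pi * n%:R) = 0.
  elim: n => [|n IHn] y0; first by rewrite mulr0 subr0 addr0.
  rewrite -natr1 mulrDr mulr1 opprD addrA [y + (- _ - _)]addrA sinDpi.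
  have [-> h] := IHn y0; rewrite oppr0; split => //.
  by rewrite -[LHS]opprK -sinDpi subrK h oppr0.
have s0 : sin (x - pi * k%:~R) = 0.
  case: k {kx xk} => n; first exact: (sN n x sx0).2.
  rewrite NegzE mulrNz mulrN opprK; exact: (sN n.+1 x sx0).1.
apply/eqP; rewrite -subr_eq0; apply: contraT => xk0.
have : 0 < sin (x - pi * k%:~R).
  by apply: sin_gt0_pi; rewrite lt_neqAle eq_sym xk0/= subr_ge0 kx/= ltrBlDl.
by rewrite s0 ltxx.
Qed.

Lemma ae_sin_neq0 (s c : R) : s != 0 -> {ae mu, forall x : R, sin (s * x + c) != 0}.
Proof.
move=> s0; pose A : set R := [set (pi * k%:~R - c) / s | k in [set: int]].
have cA : countable A by apply: card_le_trans (card_image_le _ _) (countableP _).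
have mA : measurable A.
  exact: countable_measurable.
exists A; split => //; first exact: countable_lebesgue_measure0.
move=> x /= /negP; rewrite negbK => /eqP /sin_eq0P[k kE].
by exists k => //; rewrite -kE addrK mulrC mulKf.
Qed.

Let h (x : R) : R := ln 2 - ell x.

Let h_ge0 x : 0 <= h x. Proof. by rewrite subr_ge0 ell_le. Qed.

Let measurable_h : measurable_fun [set: R] h.
Proof. by apply: measurable_funB => //; exact: measurable_ell. Qed.

(** The duplication formula [sin x = 2 sin (x/2) cos (x/2)], with [cos (x/2) = sin ((x + pi)/2)].
    The two arguments on the left are exactly the sample points of [mean 2 pi]. *)
Let h_double x : sin x != 0 -> h (x / 2) + h ((x + pi) / 2) = h x + ln 2.
Proof.
have xE : x = x / 2 + x / 2 by field.
rewrite {1}xE sinD (mulrC (cos _)) -mulr2n mulrn_eq0/= => sc0.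
have [s0 c0] : sin (x / 2) != 0 /\ cos (x / 2) != 0.
  by move: sc0; rewrite mulf_eq0 negb_or => /andP[].
rewrite /h /ell [(x + pi) / 2]mulrDl sinDpihalf {3}xE sinD (mulrC (cos _)) -mulr2n normrMn normrM.
rewrite -[_ * _ *+ 2]mulr_natl ![ln (2 * _)]lnM ?posrE ?mulr_gt0 ?normr_gt0//.
by rewrite [ln (`|sin _| * _)]lnM ?posrE ?normr_gt0//; ring.
Qed.

Let h_min x : h (x / 2) <= ln 2 \/ h ((x + pi) / 2) <= ln 2.
Proof.
rewrite /h /ell [(x + pi) / 2]mulrDl sinDpihalf !lerBlDr -!lerBlDl subrr.
have cs := cos2Dsin2 (x / 2).
have [s1|s1] := lerP 1 (2 * `|sin (x / 2)|); first by left; exact: ln_ge0.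
right; apply: ln_ge0; rewrite -(@expr_ge1 _ 2) ?mulr_ge0//.
rewrite exprMn real_normK ?num_real//.
have : (2 * `|sin (x / 2)|) ^+ 2 < 1 by rewrite expr_lt1// mulr_ge0.
rewrite exprMn real_normK ?num_real// => s2; nra.
Qed.

(** Integrating the duplication formula gives [I <= (I + pi ln 2) / 2], which bounds [I] only if [I]
    is already finite. Truncating at [M] makes it finite, with a bound independent of [M]; monotone
    convergence then yields integrability of [h]. *)
Let integral_h_min (M : nat) :
  (\int[mu]_(x in `[0%R, pi]) (Num.min (h x) M%:R)%:E <= (pi * ln 2)%:E)%E.
Proof.
set hM := fun x => Num.min (h x) M%:R.
have mhM : measurable_fun [set: R] hM by exact: measurable_minr.
have hM0 x : 0 <= hM x by rewrite le_min h_ge0/=.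
have ihM : mu.-integrable `[0, pi] (EFin \o hM).
  apply: (@integrable_bounded _ _ _ M%:R) => // x _.
  by rewrite ger0_norm//= ge_min lexx orbT.
have icst : mu.-integrable `[0, pi] (EFin \o (fun x : R => ln 2)).
  by apply: (@integrable_bounded _ _ _ `|ln 2|) => // x _.
rewrite EFin_Rintegral// lee_fin; set I := Rintegral _ _ _.
have [ia IE] := @Rintegral_mean R 2 _ _ isT (pi_ge0 R) mhM hM0 ihM.
suff : I <= 2^-1 * (I + pi * ln 2) by lra.
rewrite {1}/I IE.
have -> : 2^-1 * (I + pi * ln 2) = \int[mu]_(x in `[0, pi]) (2^-1 * (hM x + ln 2)).
  rewrite RintegralZl//; last exact: integrableDR.
  by rewrite RintegralD// Rintegral_cstR ?pi_ge0// subr0 (mulrC pi).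
apply: le_Rintegral => //; first by apply/integrableZR/integrableDR.
move=> x _; rewrite /mean ler_pM2l ?invr_gt0// !big_ord_recl big_ord0 /= mulr0 !addr0 mulr1.
have ln2 : 0 <= ln 2 :> R by rewrite ln_ge0// ler1n.
have h2 : h (x / 2) + h ((x + pi) / 2) <= h x + ln 2.
  have [s0|/h_double ->//] := eqVneq (sin x) 0.
  have hx : h x = ln 2 by rewrite /h /ell s0 normr0 mulr0 [ln 0]ln0// subr0.
  move: s0; have xE : x = x / 2 + x / 2 by field.
  rewrite {1}xE sinD (mulrC (cos _)) -mulr2n => /eqP; rewrite mulrn_eq0/= mulf_eq0.
  rewrite hx {1 2}/h /ell [(x + pi) / 2]mulrDl sinDpihalf.
  have cs := cos2Dsin2 (x / 2).
  case/orP => /eqP z0; rewrite z0 normr0 mulr0 [ln 0]ln0// subr0 lerD ?gerBl// ?lerBlDl ?lerDr ?ln_ge0//.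
    have /eqP : cos (x / 2) ^+ 2 = 1 by move: cs; rewrite z0; lra.
    by rewrite sqrf_eq1 => /orP[]/eqP->; rewrite ?normrN normr1 mulr1 ler1n.
  have /eqP : sin (x / 2) ^+ 2 = 1 by move: cs; rewrite z0; lra.
  by rewrite sqrf_eq1 => /orP[]/eqP->; rewrite ?normrN normr1 mulr1 ler1n.
(* By [h_min] one of the two terms is at most [ln 2], and the other is at most [M]; so the sum is
   bounded by [M + ln 2] as well as by [h x + ln 2]. *)
rewrite /hM /Num.min; have := h_ge0 (x / 2); have := h_ge0 ((x + pi) / 2).
by have [] := h_min x; do 3 case: ifP; lra.
Qed.

Let integrable_h : mu.-integrable `[0, pi] (EFin \o h).
Proof.
apply/ge0_integrableP => //; first exact: measurable_funTS.
apply: (@le_lt_trans _ _ (pi * ln 2)%:E); last exact: ltry.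
have mh n : measurable_fun `[0, pi] (fun x => (Num.min (h x) n%:R)%:E).
  by apply/measurable_EFinP/measurable_funTS; exact: measurable_minr.
have /cvg_lim<- // : (\int[mu]_(x in `[0%R, pi]) (Num.min (h x) n%:R)%:E)%E @[n --> \oo]
    --> (\int[mu]_(x in `[0%R, pi]) (h x)%:E)%E.
  have -> : (\int[mu]_(x in `[0%R, pi]) (h x)%:E = \int[mu]_(x in `[0%R, pi])
      (limn (fun n => (Num.min (h x) n%:R)%:E)))%E.
    apply: eq_integral => x _; apply/esym/cvg_lim => //.
    apply: cvg_near_cst; exists (Num.truncn (h x)).+1 => // n /= hn.
    congr EFin; apply: min_l; apply: le_trans (ltW (truncnS_gt _)) _.
    by rewrite ler_nat.
  apply: cvg_monotone_convergence => //.
  - by move=> n x _; rewrite lee_fin le_min h_ge0/=.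
  - move=> x _ m n mn; rewrite lee_fin le_min ge_min lexx/= ge_min ler_nat mn.
    by rewrite orbT.
apply: lime_le; last by apply: nearW => n; exact: integral_h_min.
apply: ereal_nondecreasing_is_cvgn => m n mn; apply: ge0_le_integral => //; last 3 first.
- exact: mh.
- exact: mh.
- by move=> x _; rewrite lee_fin le_min ge_min lexx/= ge_min ler_nat mn orbT.
by move=> x _; rewrite lee_fin le_min h_ge0/=.
Qed.

(** Once [I] is finite, the duplication formula gives the equation [I = (I + pi ln 2) / 2]. *)
Let Rintegral_h : \int[mu]_(x in `[0, pi]) h x = pi * ln 2.
Proof.
have [ia] := @Rintegral_mean R 2 _ _ isT (pi_ge0 R) measurable_h h_ge0 integrable_h.
set I := LHS => IE.
suff IE' : I = 2^-1 * (I + pi * ln 2) by move: IE'; rewrite /I; lra.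
have -> : 2^-1 * (I + pi * ln 2) = \int[mu]_(x in `[0, pi]) (2^-1 * (h x + ln 2)).
  have ic := integrable_cstR 0 pi (ln 2).
  rewrite RintegralZl//; last exact: integrableDR.
  by rewrite RintegralD// Rintegral_cstR ?pi_ge0// subr0 (mulrC pi).
rewrite IE /Rintegral; congr fine; apply: ae_eq_integral => //.
- by apply/measurable_EFinP/measurable_funTS; exact: measurable_mean.
- by apply/measurable_EFinP/measurable_funTS/measurable_funM => //; exact: measurable_funD.
have := @ae_sin_neq0 1 0 (oner_neq0 _); apply: aeS => x.
rewrite mul1r addr0 => s0 _; congr EFin.
by rewrite /mean !big_ord_recl big_ord0 /= mulr0 !addr0 mulr1 h_double.
Qed.

(** After cutting the period into [N] pieces, the arguments of [f] are [x + c + pi k], so the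
    average consists of [N] equal terms [f (x + c)]; the shift by [c] is then absorbed by
    periodicity. *)
Lemma ge0_integral_periodic_affine (N : nat) (c : R) (f : R -> R) : (0 < N)%N ->
  measurable_fun [set: R] f -> (forall x, 0 <= f x) -> (forall x, f (x + pi) = f x) ->
  (\int[mu]_(x in `[0%R, pi]) (f (N%:R * x + c))%:E =
   \int[mu]_(x in `[0%R, pi]) (f x)%:E)%E.
Proof.
move=> N0 mf f0 pf.
have pfN (n : nat) x : f (x + pi * n%:R) = f x.
  elim: n => [|n IHn]; first by rewrite mulr0 addr0.
  by rewrite -natr1 mulrDr mulr1 addrA pf.
rewrite -(@ge0_integral_periodic R pi c (EFin \o f))//; last 3 first.
- exact: pi_gt0.
- exact/measurable_EFinP.
- by move=> x /=; rewrite pf.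
rewrite (@ge0_integral_mean _ N)//; last 2 first.
- exact: pi_ge0.
- by apply: measurableT_comp => //; apply: measurable_funD => //; exact: measurable_funM.
apply: eq_integral => x _; congr EFin.
rewrite /mean (eq_bigr (fun=> f (x + c))) => [|k _].
  by rewrite sumr_const card_ord -[X in _ * X]mulr_natl mulKf// pnatr_eq0 -lt0n.
rewrite -[RHS](pfN k); congr f; rewrite mulrCA divff ?pnatr_eq0 -?lt0n// mulr1.
by rewrite addrAC.
Qed.

Lemma integrable_ell (N : nat) (c : R) : (0 < N)%N ->
  mu.-integrable `[0, pi] (EFin \o (fun x => ell (N%:R * x + c))).
Proof.
move=> N0; have mphi : measurable_fun [set: R] (fun x => N%:R * x + c).
  by apply: measurable_funD => //; exact: measurable_funM.
have : mu.-integrable `[0, pi] (EFin \o (fun x => h (N%:R * x + c))).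
  apply/ge0_integrableP => //; first by apply: measurable_funTS; exact: measurableT_comp.
  rewrite ge0_integral_periodic_affine//.
    by apply/ge0_integrableP => //; exact: measurable_funTS.
  by move=> x; rewrite /h ellDpi.
move=> /(integrableBR _ (integrable_cstR 0 pi (ln 2)))-/(_ (measurable_itv _)).
by apply: eq_integrable => // x _; congr EFin; rewrite /h opprB addrC subrK.
Qed.

Lemma Rintegral_ell (N : nat) (c : R) : (0 < N)%N ->
  \int[mu]_(x in `[0, pi]) ell (N%:R * x + c) = 0.
Proof.
move=> N0; have mphi : measurable_fun [set: R] (fun x => N%:R * x + c).
  by apply: measurable_funD => //; exact: measurable_funM.
have ie := integrable_ell c N0; have ic := integrable_cstR 0 pi (ln 2).
have : \int[mu]_(x in `[0, pi]) h (N%:R * x + c) = pi * ln 2.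
  rewrite -Rintegral_h /Rintegral ge0_integral_periodic_affine//.
  by move=> x; rewrite /h ellDpi.
rewrite /h RintegralB// Rintegral_cstR ?pi_ge0// subr0.
by move=> /eqP; rewrite mulrC subr_eq addrC -subr_eq subrr => /eqP.
Qed.

End log_sine.

Ltac meas := repeat first
  [ assumption | exact: measurable_sin | exact: measurable_cos | exact: measurable_ln
  | exact: measurable_ell
  | exact: measurable_fst | exact: measurable_snd | exact: measurable_id
  | exact: measurable_cst
  | apply: measurable_funM | apply: measurable_funD | apply: measurable_funB
  | apply: measurable_funN | apply: measurable_funX | apply: measurable_maxr
  | apply: (measurableT_comp measurable_sin)
  | apply: (measurableT_comp measurable_cos)
  | apply: (measurableT_comp (@measurable_ln _))
  | apply: (measurableT_comp measurable_ell)
  | apply: (measurableT_comp measurable_invr)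
  | apply: (measurableT_comp (@normr_measurable _ setT)) ].

(** Evaluate [X^N - 1 = prod (X - w^k)] at [X = - A / (B z)] and multiply by [(- B z)^N]. *)
Lemma prod_linear_primitive (F : fieldType) (N : nat) (A B z w : F) :
  B != 0 -> z != 0 -> N.-primitive_root w ->
  \prod_(k < N) (A + B * (z * w ^+ k)) = A ^+ N - (- B) ^+ N * z ^+ N.
Proof.
move=> B0 z0 wN; have /(congr1 (horner^~ (- A / (B * z)))) := factor_Xn_sub_1 wN.
rewrite /= horner_prod big_mkord => E.
transitivity (\prod_(k < N) (- (B * z)) * \prod_(k < N) (- A / (B * z) - w ^+ k)).
  rewrite -big_split/=; apply: eq_bigr => k _; field.
  by rewrite z0 B0.
have -> : \prod_(k < N) (- A / (B * z) - w ^+ k) = (- A / (B * z)) ^+ N - 1.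
  transitivity ('X^N - 1).[- A / (B * z)]; last by rewrite !hornerE.
  by rewrite -E; apply: eq_bigr => k _; rewrite !hornerE.
rewrite prodr_const card_ord mulrBr mulr1 -exprMn; congr (_ - _).
  by congr (_ ^+ _); field; rewrite z0 B0.
by rewrite -mulNr exprMn.
Qed.

(** * The polynomial on the torus and its average over roots of unity *)

Section circle.
Context {R : realType}.
Local Notation normc := (@ComplexField.Normc.normc R).
Implicit Types (x y z : R[i]).

Lemma normcE2 (a b : R) : normc (Complex a b) ^+ 2 = a ^+ 2 + b ^+ 2.
Proof. by rewrite /= sqr_sqrtr// addr_ge0// sqr_ge0. Qed.

Lemma normc_ge0 z : 0 <= normc z.
Proof. by case: z => a b; exact: sqrtr_ge0. Qed.

Lemma normc_gt0 z : (0 < normc z) = (z != 0).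
Proof.
rewrite lt_neqAle normc_ge0 andbT eq_sym; congr (~~ _).
apply/eqP/eqP => [/ComplexField.Normc.eq0_normc//|->]; exact: ComplexField.Normc.normc0.
Qed.

Lemma normc_eq0 z : (normc z == 0) = (z == 0).
Proof. by apply: negb_inj; rewrite -normc_gt0 lt_neqAle normc_ge0 andbT eq_sym. Qed.

Lemma normcX z n : normc (z ^+ n) = normc z ^+ n.
Proof.
elim: n => [|n IHn]; first by rewrite !expr0 ComplexField.Normc.normc1.
by rewrite !exprS ComplexField.Normc.normcM IHn.
Qed.

Lemma normc_prod (I : Type) (r : seq I) (F : I -> R[i]) :
  normc (\prod_(i <- r) F i) = \prod_(i <- r) normc (F i).
Proof.
elim/big_ind2 : _ => [|x1 x2 y1 y2 <- <-|//]; first exact: ComplexField.Normc.normc1.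
exact: ComplexField.Normc.normcM.
Qed.

Lemma expiD (a b : R) : expi (a + b) = expi a * expi b.
Proof. by rewrite /expi cosD sinD; congr Complex; rewrite ?(addrC (sin a * _)). Qed.

Lemma expi0 : expi (0 : R) = 1. Proof. by rewrite /expi cos0 sin0. Qed.

Lemma expiX (a : R) n : expi a ^+ n = expi (n%:R * a).
Proof.
elim: n => [|n IHn]; first by rewrite mul0r expi0.
by rewrite exprS IHn -expiD -nat1r mulrDl mul1r.
Qed.

Lemma normc_expi (a : R) : normc (expi a) = 1.
Proof. by rewrite /expi /= cos2Dsin2 sqrtr1. Qed.

Lemma expi_neq0 (a : R) : expi a != 0.
Proof. by rewrite -normc_gt0 normc_expi. Qed.

(** The reason for half-angle parameters: differences of points of the circle become sines times a
    unit, without square roots. *)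
Lemma expi2B1 (a : R) : expi (2 * a) - 1 = Complex 0 (2 * sin a) * expi a.
Proof.
have -> : 2 * a = a + a by ring.
rewrite expiD /expi; apply/eqP; rewrite eq_complex/= -!expr2 cos2sin2.
by apply/andP; split; apply/eqP; ring.
Qed.

Lemma normc_expi2B (a b : R) : normc (expi (2 * a) - expi (2 * b)) = 2 * `|sin (a - b)|.
Proof.
have -> : expi (2 * a) = expi (2 * (a - b)) * expi (2 * b).
  by rewrite -expiD -mulrDr subrK.
rewrite -{2}[expi (2 * b)]mul1r -mulrBl expi2B1 !ComplexField.Normc.normcM.
rewrite !normc_expi !mulr1 /= expr0n/= add0r sqrtr_sqr normrM ger0_norm//.
Qed.

Lemma expi2pi : expi (2 * pi : R) = 1.
Proof. by rewrite /expi mulr_natl cos2pi sin2pi. Qed.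

Lemma expi2Dpi (a : R) (k : nat) : expi (2 * (a + pi * k%:R)) = expi (2 * a).
Proof.
rewrite mulrDr expiD; have -> : 2 * (pi * k%:R) = k%:R * (2 * pi) :> R by ring.
by rewrite -[expi (k%:R * _)]expiX expi2pi expr1n mulr1.
Qed.

Lemma P_horner d x y : (P_ R d).[x, y] =
  \sum_(i < d.+1) \sum_(j < d.+1 | (i + j <= d)%N) x ^+ i * y ^+ j.
Proof.
rewrite /P_ !horner_sum; apply: eq_bigr => i _; rewrite !horner_sum.
by apply: eq_bigr => j _; rewrite !hornerE.
Qed.

(** For fixed [i], the factor [y - 1] sums the powers of [y] to [y^(d+1-i) - 1]. The two resulting
    sums over [i] are geometric and are cleared by [x - y] and [x - 1]. *)
Lemma P_factor d x y :
  (P_ R d).[x, y] * ((y - 1) * (x - y) * (x - 1)) =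
  (y - 1) * x ^+ d.+2 + (1 - y ^+ d.+2) * x + (y ^+ d.+2 - y).
Proof.
rewrite P_horner.
have inner (i : 'I_d.+1) : (\sum_(j < d.+1 | (i + j <= d)%N) x ^+ i * y ^+ j) * (y - 1)
    = x ^+ i * (y * y ^+ (d - i) - 1).
  rewrite -mulr_sumr -mulrA; congr (_ * _).
  rewrite mulrC -exprS subrX1; congr (_ * _).
  rewrite (big_ord_widen_cond d.+1 predT (fun j => y ^+ j)); last first.
    by rewrite ltnS leq_subr.
  apply: eq_bigl => j /=; rewrite ltnS leq_subRL//.
  by rewrite -ltnS ltn_ord.
have reas (S : R[i]) : S * ((y - 1) * (x - y) * (x - 1)) = S * (y - 1) * ((x - y) * (x - 1)).
  by ring.
rewrite reas mulr_suml.
under eq_bigr => i _ do rewrite inner mulrBr mulr1 mulrCA.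
rewrite sumrB -mulr_sumr.
have e1 : (\sum_(i < d.+1) x ^+ i * y ^+ (d - i)) * (x - y) = x ^+ d.+1 - y ^+ d.+1.
  rewrite mulrC subrXX; congr (_ * _); rewrite (reindex_inj rev_ord_inj)/=.
  apply: eq_bigr => i _; rewrite subSS subKn//.
  by rewrite -ltnS; exact: ltn_ord.
have e2 : (\sum_(i < d.+1) x ^+ i) * (x - 1) = x ^+ d.+1 - 1 by rewrite mulrC subrX1.
set S1 := \sum_(i < d.+1) _ in e1 *; set S2 := \sum_(i < d.+1) _ in e2 *.
transitivity (y * (S1 * (x - y)) * (x - 1) - S2 * (x - 1) * (x - y)); first by ring.
by rewrite e1 e2 !exprS; ring.
Qed.

(** This is what turns [|A|^2 - |B|^2] into a product of sines. *)
Lemma sin_cross (p q r : R) :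
  sin p * sin q - sin r * sin (p + q - r) = sin (p - r) * sin (q - r).
Proof. by rewrite !sinB sinD cosD; have := cos2sin2 r => /= h; ring: h. Qed.

Definition kap (p q r : R) := sin p * sin q * sin (p - r) * sin (q - r).

(** The number is [(e^{2ip} - 1)(e^{2iq} - 1) + (e^{2ir} - 1)]. Divided by the unit [e^{ir}] it
    becomes [- 4 sin p sin q e^{i(p+q-r)} + 2 i sin r]; expanding its squared modulus leaves the
    left-hand side of [sin_cross] times [16 sin p sin q]. *)
Lemma normc_A (p q r : R) :
  normc ((expi (2 * p) - 1) * expi (2 * q) + (expi (2 * r) - expi (2 * p))) ^+ 2 =
  4 * sin r ^+ 2 + 16 * kap p q r.
Proof.
have -> : (expi (2 * p) - 1) * expi (2 * q) + (expi (2 * r) - expi (2 * p)) =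
  (expi (2 * p) - 1) * (expi (2 * q) - 1) + (expi (2 * r) - 1) by ring.
rewrite !expi2B1.
have -> : Complex 0 (2 * sin p) * expi p * (Complex 0 (2 * sin q) * expi q) +
    Complex 0 (2 * sin r) * expi r =
  (Complex (- (4 * sin p * sin q)) 0 * expi (p + q - r) + Complex 0 (2 * sin r)) * expi r.
  rewrite [RHS]mulrDl; congr (_ + _).
  rewrite -[X in _ = X]mulrA -expiD subrK expiD mulrACA; congr (_ * _).
  by apply/eqP; rewrite eq_complex/=; apply/andP; split; apply/eqP; ring.
rewrite ComplexField.Normc.normcM normc_expi mulr1 /expi.
rewrite [X in normc X](_ : _ = Complex (- (4 * sin p * sin q) * cos (p + q - r))
  (- (4 * sin p * sin q) * sin (p + q - r) + 2 * sin r)); last first.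
  by apply/eqP; rewrite eq_complex/=; apply/andP; split; apply/eqP; ring.
rewrite normcE2 exprMn cos2sin2.
by rewrite /kap -[_ * _ * sin (p - r) * _]mulrA -sin_cross; ring.
Qed.

Lemma expi_prim (N : nat) : (0 < N)%N -> N.-primitive_root (expi (2 * (pi / N%:R)) : R[i]).
Proof.
move=> N0; have N0' : (N%:R : R) != 0 by rewrite pnatr_eq0 -lt0n.
apply/andP; split => //; apply/forallP => i; apply/eqP.
rewrite unity_rootE expiX (_ : _ * _ = 2 * (pi * i.+1%:R / N%:R)); last by field.
have [iN|iN] := eqVneq i.+1 N.
  by rewrite iN mulfK// expi2pi eqxx.
apply/negbTE; rewrite -subr_eq0 -normc_eq0 -expi0 -[X in _ - expi X](mulr0 2) normc_expi2B subr0.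
rewrite mulf_neq0 ?pnatr_eq0// normr_eq0 gt_eqF// sin_gt0_pi//.
have iN' : (i.+1 < N)%N by rewrite ltn_neqAle iN ltn_ord.
have p0 := pi_gt0 R.
rewrite divr_gt0 ?mulr_gt0 ?ltr0n//= ltr_pdivrMr ?ltr0n// ltr_pM2l//.
by rewrite ltr_nat.
Qed.

Lemma prod_linear_roots (N : nat) (s : R) (A B : R[i]) : (0 < N)%N -> B != 0 ->
  \prod_(k < N) (A + B * expi (2 * ((s + pi * k%:R) / N%:R))) =
  A ^+ N - (- B) ^+ N * expi (2 * s).
Proof.
move=> N0 B0; have N0' : (N%:R : R) != 0 by rewrite pnatr_eq0 -lt0n.
rewrite (_ : expi (2 * s) = expi (2 * (s / N%:R)) ^+ N); last first.
  by rewrite expiX; congr expi; field.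
rewrite -(prod_linear_primitive A B0 (expi_neq0 (2 * (s / N%:R))) (expi_prim N0)).
by apply: eq_bigr => k _; rewrite expiX -expiD; congr (_ + _ * expi _); field.
Qed.

Lemma normcB_le x y : normc (x - y) <= normc x + normc y.
Proof. by rewrite -[normc y]normcN; exact: le_normcD. Qed.

Lemma normcB_ge x y : `|normc x - normc y| <= normc (x - y).
Proof.
rewrite ler_norml; apply/andP; split.
  rewrite lerNl opprB lerBlDr -[normc (x - y)]normcN opprB.
  by rewrite -{1}[y](subrK x); exact: le_normcD.
by rewrite lerBlDr -{1}[x](subrK y); exact: le_normcD.
Qed.

(** For [b <= a], [a^N - b^N >= a^(N-1) (a - b)] because [b^(N-1) <= a^(N-1)], and
    [a (a - b) >= (a^2 - b^2) / 2]. Squares appear on the left because [normc_A] gives an explicit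
    [|A|^2]. *)
Lemma exp_diff_ge (a b : R) (N : nat) : 0 <= a -> 0 <= b -> (2 <= N)%N ->
  Num.max a b ^+ (N - 2) * (`|a ^+ 2 - b ^+ 2| / 2) <= `|a ^+ N - b ^+ N|.
Proof.
wlog ba : a b / b <= a.
  move=> wl a0 b0 N2; have [ba|ab] := orP (le_total b a); first exact: wl.
  by rewrite maxC distrC [`|a ^+ N - _|]distrC; exact: wl.
move=> a0 b0; case: N => [|[|n _]]//; rewrite max_l// !subSS subn0.
rewrite !ger0_norm ?subr_ge0 ?lerXn2r ?nnegrE//.
have h1 : b ^+ n.+1 <= a ^+ n.+1 by rewrite lerXn2r ?nnegrE.
have an : 0 <= a ^+ n by exact: exprn_ge0.
apply: (@le_trans _ _ (a ^+ n * (a * (a - b)))).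
  by rewrite ler_wpM2l//; nra.
rewrite [a ^+ n.+2]exprS [b ^+ n.+2]exprS mulrA -exprSr mulrC mulrBl lerD2l lerN2.
exact: ler_wpM2l.
Qed.

Lemma ln_prod (I : Type) (r : seq I) (F : I -> R) : (forall i, 0 < F i) ->
  \sum_(i <- r) ln (F i) = ln (\prod_(i <- r) F i).
Proof.
move=> F0; elim: r => [|i r IHr]; first by rewrite !big_nil ln1.
by rewrite !big_cons IHr lnM ?posrE// prodr_gt0.
Qed.

(* [log (max |A| |B|)], see [mean_log]. *)
Definition Jf (p q r : R) : R := ln (4 * sin r ^+ 2 + 16 * Num.max (kap p q r) 0) / 2.

(* The coefficient [A] as a function of [p] and of [q], where [x ^+ N = expi (2 * q)]. *)
Definition Fnum (N : nat) (p q : R) : R[i] :=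
  (expi (2 * p) - 1) * expi (2 * q) + (expi (2 * (N%:R * p)) - expi (2 * p)).

(* The product over [k] is [|A^N - (-B)^N e^{2iq}|], which lies between
   [max |A| |B| ^ (N - 2) * ||A|^2 - |B|^2| / 2] and [2 * max |A| |B| ^ N];
   the terms [ell _] come from [||A|^2 - |B|^2| = 16 |kap p q r|]. *)
Lemma mean_log (N : nat) (p q : R) : (2 <= N)%N ->
  let r := N%:R * p in
  let F k := normc (Fnum N p q + (1 - expi (2 * r)) * expi (2 * ((q + pi * k%:R) / N%:R))) in
  sin r != 0 -> kap p q r != 0 ->
  [/\ forall k : 'I_N, 0 < F k,
   N%:R^-1 * \sum_(k < N) ln (F k) <= Jf p q r + ln 2 / N%:R &
   Jf p q r + (ell p + ell q + ell (p - r) + ell (q - r) - 2 * Jf p q r - ln 2) / N%:R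
     <= N%:R^-1 * \sum_(k < N) ln (F k)].
Proof.
move=> N2 r F sr k0; have N0 : (0 < N)%N by exact: leq_trans N2.
have N0' : 0 < (N%:R : R) by rewrite ltr0n.
set A := Fnum N p q; set B := 1 - expi (2 * r).
set a := normc A; set b := normc B.
have a2 : a ^+ 2 = 4 * sin r ^+ 2 + 16 * kap p q r by exact: normc_A.
have bE : b = 2 * `|sin r|.
  rewrite /b /B -normcN opprB -expi0 -[X in _ - expi X](mulr0 2) normc_expi2B.
  by rewrite subr0.
have b2 : b ^+ 2 = 4 * sin r ^+ 2 by rewrite bE exprMn real_normK ?num_real//; ring.
have b0 : 0 < b by rewrite bE mulr_gt0// normr_gt0.
have a0 : 0 <= a by exact: normc_ge0.
have b0' := ltW b0.
have B0 : B != 0 by rewrite -normc_gt0.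
set m := Num.max a b; have m0 : 0 < m by rewrite lt_max b0 orbT.
(* The sign of [kap] tells which of [|A|], [|B|] is larger, so truncating [kap] at [0] computes the
   square of the maximum. *)
have JE : Jf p q r = ln m.
  suff m2 : m ^+ 2 = 4 * sin r ^+ 2 + 16 * Num.max (kap p q r) 0.
    by rewrite /Jf -m2 lnXn// mulr2n; field.
  rewrite /m; have [ab|ab] := orP (le_total a b).
    rewrite (max_r ab) b2 max_r ?mulr0 ?addr0//.
    have : a ^+ 2 <= b ^+ 2 by rewrite lerXn2r ?nnegrE.
    by rewrite a2 b2; lra.
  rewrite (max_l ab) a2 max_l//.
  have : b ^+ 2 <= a ^+ 2 by rewrite lerXn2r ?nnegrE.
  by rewrite a2 b2; lra.
have ab2 : `|a ^+ 2 - b ^+ 2| = 16 * `|kap p q r|.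
  by rewrite a2 b2 addrAC subrr add0r normrM ger0_norm.
have ab0 : 0 < `|a ^+ 2 - b ^+ 2| by rewrite ab2 mulr_gt0// normr_gt0.
have PE : \prod_(k < N) F k = normc (A ^+ N - (- B) ^+ N * expi (2 * q)).
  by rewrite -prod_linear_roots// normc_prod.
have PN : normc ((- B) ^+ N * expi (2 * q)) = b ^+ N.
  by rewrite ComplexField.Normc.normcM normc_expi mulr1 normcX normcN.
have Pge : m ^+ (N - 2) * (`|a ^+ 2 - b ^+ 2| / 2) <= \prod_(k < N) F k.
  rewrite PE; apply: le_trans (normcB_ge _ _); rewrite PN normcX.
  exact: exp_diff_ge (ltW b0) N2.
have Pge0 : 0 < m ^+ (N - 2) * (`|a ^+ 2 - b ^+ 2| / 2).
  by rewrite mulr_gt0 ?exprn_gt0// divr_gt0.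
have Ple : \prod_(k < N) F k <= 2 * m ^+ N.
  rewrite PE; apply: le_trans (normcB_le _ _) _; rewrite PN normcX -/a.
  by rewrite mulr_natl mulr2n lerD// lerXn2r ?nnegrE ?(ltW m0)// le_max lexx ?orbT.
have P0 : 0 < \prod_(k < N) F k by exact: lt_le_trans Pge.
(* The product is positive by the lower bound, so no factor vanishes. *)
have F0 (k : 'I_N) : 0 < F k.
  rewrite lt_neqAle normc_ge0 andbT; apply/eqP => Fk0.
  by move: P0; rewrite (bigD1 k)//= -Fk0 mul0r ltxx.
rewrite ln_prod// JE; split => //.
- rewrite ler_pdivrMl// mulrDr mulrCA divff ?gt_eqF// mulr1.
  apply: (@le_trans _ _ (ln (2 * m ^+ N))); first by rewrite ler_ln ?posrE ?mulr_gt0 ?exprn_gt0.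
  by rewrite lnM ?posrE ?exprn_gt0// lnXn// addrC mulr_natl.
- rewrite ler_pdivlMl// mulrDr mulrCA divff ?gt_eqF// mulr1.
  apply: (@le_trans _ _ (ln (m ^+ (N - 2) * (`|a ^+ 2 - b ^+ 2| / 2)))); last first.
    by rewrite ler_ln ?posrE.
  move: k0; rewrite /kap !mulf_eq0 !negb_or => /andP[/andP[/andP[sp sq] spr] sqr].
  rewrite lnM ?posrE ?exprn_gt0 ?divr_gt0// ln_div ?posrE// lnXn// ab2 /kap !normrM.
  (* The constant 16 is shared out as one 2 per sine, which makes four [ell] terms; [- 2 Jf] comes
     from the exponent [N - 2] and [- ln 2] from the division by 2. *)
  rewrite (_ : 16 * _ = (2 * `|sin p|) * (2 * `|sin q|) *
    (2 * `|sin (p - r)|) * (2 * `|sin (q - r)|)); last by ring.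
  rewrite ![ln (_ * (2 * _))]lnM ?posrE ?mulr_gt0 ?normr_gt0// -!/(ell _).
  by rewrite mulrnBr// -[ln m *+ N]mulr_natl mulr2n; lra.
Qed.

(** The three sines are half the moduli of the factors [y - 1], [x - y] and [x - 1] of
    [P_factor]. *)
Lemma Fnum_P (d : nat) (s p : R) :
  normc (Fnum d.+2 p (d.+2%:R * s) + (1 - expi (2 * (d.+2%:R * p))) * expi (2 * s)) =
  normc (P_ R d).[expi (2 * s), expi (2 * p)] *
  ((2 * `|sin p|) * (2 * `|sin (s - p)|) * (2 * `|sin s|)).
Proof.
rewrite -normc_expi2B -[in 2 * `|sin p|](subr0 p) -[in 2 * `|sin s|](subr0 s) -!normc_expi2B.
rewrite mulr0 expi0 -!ComplexField.Normc.normcM P_factor; congr normc.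
rewrite /Fnum !expiX !(mulrCA d.+2%:R).
by ring.
Qed.

Lemma Fnum_shift N p q (k : nat) : (0 < N)%N ->
  Fnum N p (N%:R * ((q + pi * k%:R) / N%:R)) = Fnum N p q.
Proof.
move=> N0; rewrite /Fnum (mulrC N%:R (_ / _)) divfK ?pnatr_eq0 -?lt0n//.
by rewrite expi2Dpi.
Qed.

End circle.

(** * The logarithmic integral of the polynomial, up to [O(1/N)] *)

Section mahler_inner.
Context {R : realType}.
Local Notation mu := (@lebesgue_measure R).
Local Notation normc := (@ComplexField.Normc.normc R).

Lemma integrable_ell_shift (c : R) :
  mu.-integrable `[0, pi] (EFin \o (fun x => ell (x + c))).
Proof.
rewrite (_ : (fun x => _) = fun x => ell (1%:R * x + c)); first exact: integrable_ell.
by apply/funext => x; rewrite mul1r.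
Qed.

Lemma Rintegral_ell_shift (c : R) : \int[mu]_(x in `[0, pi]) ell (x + c) = 0.
Proof.
by rewrite -[RHS](@Rintegral_ell R 1 c isT); apply: eq_Rintegral => x _; rewrite mul1r.
Qed.

Lemma measurable_section1 d (T : measurableType d) (f : R -> R -> T) (y : R) :
  measurable_fun [set: R * R] (fun z => f z.1 z.2) -> measurable_fun [set: R] (f ^~ y).
Proof.
move=> mf.
exact: (measurableT_comp mf (measurable_fun_pair (@measurable_id _ R setT) (measurable_cst y))).
Qed.

Lemma measurable_Jf d (T : measurableType d) (f g h : T -> R) :
  measurable_fun setT f -> measurable_fun setT g -> measurable_fun setT h ->
  measurable_fun setT (fun x => Jf (f x) (g x) (h x)).
Proof.
move=> mf mg mh; rewrite /Jf /kap; meas => //.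
Qed.

(** The argument of the logarithm is at most [4 + 16 = 20], below [5^2], and the division by 2 takes
    the square root. *)
Lemma Jf_le (p q r : R) : Jf p q r <= ln 5.
Proof.
have kap1 : kap p q r <= 1.
  apply: le_trans (ler_norm _) _; rewrite /kap !normrM.
  by do 3 (rewrite -[leRHS]mulr1 ler_pM ?mulr_ge0 ?sin_max//).
have s1 : sin r ^+ 2 <= 1 by rewrite -[sin r ^+ 2]real_normK ?num_real// expr_le1 ?sin_max.
have k0 : 0 <= Num.max (kap p q r) 0 <= 1 by rewrite le_max lexx orbT/= ge_max kap1 ler01.
have s0 := sqr_ge0 (sin r).
have [E|E] := eqVneq (4 * sin r ^+ 2 + 16 * Num.max (kap p q r) 0) 0.
  by rewrite /Jf E ln0// mul0r ln_ge0// ler1n.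
rewrite /Jf ler_pdivrMr//.
have -> : ln 5 * 2 = ln (5 ^+ 2) :> R by rewrite lnXn// mulr_natr.
rewrite ler_ln ?posrE//; [move/andP: k0; lra|].
by rewrite lt_neqAle eq_sym E/= addr_ge0// mulr_ge0//; case/andP: k0.
Qed.

(** In terms of moduli this is [|B| <= max |A| |B|]. The hypothesis excludes the default [ell r = 0]
    at [sin r = 0], where [Jf] may be negative. *)
Lemma ell_le_Jf (p q r : R) : sin r != 0 -> ell r <= Jf p q r.
Proof.
move=> sr; have sr2 : 0 < 4 * sin r ^+ 2 by rewrite mulr_gt0// exprn_even_gt0.
have -> : ell r = ln (4 * sin r ^+ 2) / 2.
  have -> : 4 * sin r ^+ 2 = (2 * `|sin r|) ^+ 2.
    by rewrite exprMn real_normK ?num_real//; ring.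
  by rewrite lnXn ?mulr_gt0 ?normr_gt0// mulr2n /ell; field.
have k0 : 0 <= Num.max (kap p q r) 0 by rewrite le_max lexx orbT.
rewrite ler_pM2r ?invr_gt0// ler_ln ?posrE//; first by lra.
by lra.
Qed.

Lemma normr_Jf_le (p q r : R) : sin r != 0 -> `|Jf p q r| <= `|ell r| + ln 5.
Proof.
move=> sr; have l5 : 0 <= ln 5 :> R by rewrite ln_ge0// ler1n.
have h1 := Jf_le p q r; have h2 := @ell_le_Jf p q r sr; have h3 := ler_norm (- ell r).
by rewrite ler_norml; rewrite normrN in h3; apply/andP; split; have := normr_ge0 (ell r); lra.
Qed.

Definition Pn d (s p : R) : R := normc (P_ R d).[expi (2 * s), expi (2 * p)].

Lemma complex_sum (I : Type) (r : seq I) (P : pred I) (f g : I -> R) :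
  \sum_(i <- r | P i) Complex (f i) (g i) =
  Complex (\sum_(i <- r | P i) f i) (\sum_(i <- r | P i) g i).
Proof. by elim/big_rec3 : _ => // i a b c _ ->. Qed.

(** The modulus is expanded into real and imaginary parts, which are finite sums of cosines and
    sines of linear forms. *)
Lemma measurable_Pn d : measurable_fun [set: R * R] (fun z => Pn d z.1 z.2).
Proof.
pose C (i j : nat) (z : R * R) := cos (i%:R * (2 * z.1) + j%:R * (2 * z.2)).
pose S (i j : nat) (z : R * R) := sin (i%:R * (2 * z.1) + j%:R * (2 * z.2)).
have -> : (fun z => Pn d z.1 z.2) = (fun z : R * R => Num.sqrt
   ((\sum_(i < d.+1) \sum_(j < d.+1) if (i + j <= d)%N then C i j z else 0) ^+ 2 +
    (\sum_(i < d.+1) \sum_(j < d.+1) if (i + j <= d)%N then S i j z else 0) ^+ 2)).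
  apply/funext => z; rewrite /Pn P_horner.
  under eq_bigr => i _.
    under eq_bigr => j _ do rewrite !expiX -expiD.
    rewrite complex_sum; over.
  rewrite complex_sum /=; congr (Num.sqrt (_ ^+ 2 + _ ^+ 2));
    by apply: eq_bigr => i _; rewrite big_mkcond.
apply: measurableT_comp; first by apply: continuous_measurable_fun; exact: sqrt_continuous.
apply: measurable_funD; apply: measurable_funX;
  apply: measurable_sum => i; apply: measurable_sum => j; case: (i + j <= d)%N => //.
- by rewrite /C; meas.
- by rewrite /S; meas.
Qed.

Lemma measurable_lnePn d : measurable_fun [set: R * R] (fun z => lne (Pn d z.1 z.2)%:E).
Proof.
rewrite (_ : (fun z => _) = (fun z : R * R => if Pn d z.1 z.2 <= 0 then -oo%E else
  (ln (Pn d z.1 z.2))%:E))//.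
have mP := measurable_Pn d.
apply: measurable_fun_if => //.
- exact: measurable_fun_ler.
- apply: measurable_funTS; apply/measurable_EFinP.
  by apply: measurableT_comp => //; exact: measurable_ln.
Qed.

Lemma Pn_Fabs d (s p : R) : let N := d.+2 in
  Pn d s p * ((2 * `|sin p|) * (2 * `|sin (s - p)|) * (2 * `|sin s|)) =
  normc (Fnum N p (N%:R * s) + (1 - expi (2 * (N%:R * p))) * expi (2 * s)).
Proof. by move=> N; rewrite Fnum_P. Qed.

Definition inner_J d (p : R) : R := \int[mu]_(q in `[0, pi]) Jf p q (d.+2%:R * p).

Lemma integrable_Jf (p r : R) : sin r != 0 ->
  mu.-integrable `[0, pi] (EFin \o (fun q => Jf p q r)).
Proof.
move=> sr; apply: (@integrable_bounded _ _ _ (`|ell r| + ln 5)).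
  exact: measurable_Jf.
by move=> q _; exact: normr_Jf_le.
Qed.

(** For almost all [s], [ln (Pn d s p) = ln (Fabs s) - ell p - ell (s - p) - ell s], and the last
    two terms have mean 0. The first is replaced by its average over the [N] points with the same
    [N s] modulo [pi], to which [mean_log] applies. In the error term [ell q] and [ell (q - r)]
    integrate to 0 over [q], while [ell p] and [ell (p - r)] are kept for the integration over
    [p]. *)
Lemma inner_bounds d (p : R) : let N := d.+2 in let r := N%:R * p in
  sin p != 0 -> sin r != 0 -> sin (p - r) != 0 ->
  exists I : R, [/\ (\int[mu]_(s in `[0%R, pi]) lne (Pn d s p)%:E = I%:E)%E,
    I <= inner_J d p - pi * ell p + pi * ln 2 / N%:R &
    inner_J d p - pi * ell p + pi * (ell p + ell (p - r) - (2 * ln 5 + ln 2)) / N%:R <= I].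
Proof.
move=> N r sp sr spr; have N0 : 0 < N%:R :> R by rewrite ltr0n.
have p0 := pi_ge0 R.
pose Fabs s := Pn d s p * ((2 * `|sin p|) * (2 * `|sin (s - p)|) * (2 * `|sin s|)).
have mFabs : measurable_fun setT Fabs.
  apply: measurable_funM; last by meas.
  exact: measurable_section1 (measurable_Pn d).
(* [|A| <= 2 + 2] and [|B| <= 2], hence the constant 6; [v] is nonnegative, as averaging
   requires. *)
pose v s := ln 6 - ln (Fabs s).
have mv : measurable_fun setT v by apply: measurable_funB => //; exact: measurableT_comp.
have Fabs_ge0 s : 0 <= Fabs s by rewrite !mulr_ge0// normc_ge0.
have Fabs_le s : Fabs s <= 6.
  rewrite /Fabs Pn_Fabs /Fnum; apply: le_trans (le_normcD _ _) _.
  have h1 a b : normc (expi (2 * a) - expi (2 * b)) <= 2.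
    by rewrite normc_expi2B ger_pMr// sin_max.
  have h0 a : normc (expi (2 * a) - 1) <= 2.
    by have := h1 a 0; rewrite mulr0 expi0.
  have : normc ((expi (2 * p) - 1) * expi (2 * (N%:R * s)) +
      (expi (2 * (N%:R * p)) - expi (2 * p))) <= 2 + 2.
    apply: le_trans (le_normcD _ _) _; rewrite ComplexField.Normc.normcM normc_expi mulr1.
    by rewrite lerD.
  have : normc ((1 - expi (2 * (N%:R * p))) * expi (2 * s)) <= 2.
    by rewrite ComplexField.Normc.normcM normc_expi mulr1 -normcN opprB.
  lra.
have v_ge0 s : 0 <= v s.
  rewrite subr_ge0; have [E|E] := eqVneq (Fabs s) 0.
    by rewrite E ln0// ln_ge0// ler1n.
  by rewrite ler_ln ?posrE// lt_neqAle eq_sym E Fabs_ge0.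
have meanE q : mean N pi v q = ln 6 - N%:R^-1 * \sum_(k < N)
    ln (normc (Fnum N p q + (1 - expi (2 * r)) * expi (2 * ((q + pi * k%:R) / N%:R)))).
  rewrite /mean /v sumrB mulrBr sumr_const card_ord -[ln 6 *+ N]mulr_natl mulKf ?gt_eqF//.
  congr (_ - _ * _); apply: eq_bigr => k _; congr ln.
  by rewrite /Fabs Pn_Fabs Fnum_shift.
have good : {ae mu, forall q : R, kap p q r != 0}.
  have := aeI (@ae_sin_neq0 R 1 0 (oner_neq0 _)) (@ae_sin_neq0 R 1 (- r) (oner_neq0 _)).
  by apply: aeS => q; rewrite !mul1r addr0 /kap => -[sq sqr]; rewrite !mulf_neq0.
pose lo q := ln 6 - ln 2 / N%:R - Jf p q r.
pose hi q := ln 6 - (ell p + ell (p - r) - ln 2) / N%:R - (1 - 2 / N%:R) * Jf p q r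
  - N%:R^-1 * (ell q + ell (q - r)).
have iJ := @integrable_Jf p r sr.
have ic k := @integrable_cstR R 0 pi k.
have iell' c := @integrable_ell_shift c.
have iell0 : mu.-integrable `[0, pi] (EFin \o ell).
  by rewrite (_ : ell = fun q => ell (q + 0))//; apply/funext => q; rewrite addr0.
have Iell c := @Rintegral_ell_shift c.
have Iell0 : \int[mu]_(q in `[0, pi]) ell q = 0.
  by rewrite -[RHS](Iell 0); apply: eq_Rintegral => q _; rewrite addr0.
have Ids c : \int[mu]_(q in `[0, pi]) (ell q + ell (q - c)) = 0.
  by rewrite RintegralD// Iell0 Iell addr0.
have ilo : mu.-integrable `[0, pi] (EFin \o lo) by exact: integrableBR.
have ihi : mu.-integrable `[0, pi] (EFin \o hi).
  apply: integrableBR => //; first by apply: integrableBR => //; exact: integrableZR.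
  by apply: integrableZR => //; exact: integrableDR.
have bnd : {ae mu, forall q, lo q <= mean N pi v q <= hi q}.
  move: good; apply: aeS => q kq.
  have [_ h1 h2] := @mean_log R N p q isT sr kq.
  by rewrite meanE; apply/andP; split; move: h1 h2; rewrite /lo /hi -/r; lra.
have mmean := @measurable_mean R N pi v mv.
have mean0 q : 0 <= mean N pi v q by exact: mean_ge0.
have imean : mu.-integrable `[0, pi] (EFin \o mean N pi v).
  apply: (ae_le_integrable _ _ ihi) => //; first exact/measurable_EFinP/measurable_funTS.
  move: bnd; apply: aeS => q /andP[_ h] _ /=.
  by rewrite lee_fin !ger0_norm//; exact: le_trans h.
(* Integrability of [v] itself is not visible directly. It is inherited from [mean N pi v], which
   has the same integral and is dominated by [hi]. *)
have iv : mu.-integrable `[0, pi] (EFin \o v).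
  apply/ge0_integrableP => //; first exact: measurable_funTS.
  rewrite (@ge0_integral_mean R N pi v)//.
  by apply/ge0_integrableP => //; exact: measurable_funTS.
have [_ Iv] := @Rintegral_mean R N pi v isT p0 mv v_ge0 iv.
have Ilo : \int[mu]_(q in `[0, pi]) lo q <= \int[mu]_(q in `[0, pi]) v q.
  by rewrite Iv; apply: ae_le_Rintegral => //; move: bnd; apply: aeS => q /andP[].
have Ihi : \int[mu]_(q in `[0, pi]) v q <= \int[mu]_(q in `[0, pi]) hi q.
  by rewrite Iv; apply: ae_le_Rintegral => //; move: bnd; apply: aeS => q /andP[].
have IloE : \int[mu]_(q in `[0, pi]) lo q = (ln 6 - ln 2 / N%:R) * pi - inner_J d p.
  by rewrite RintegralB// Rintegral_cstR// subr0.
have IhiE : \int[mu]_(q in `[0, pi]) hi q =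
    (ln 6 - (ell p + ell (p - r) - ln 2) / N%:R) * pi - (1 - 2 / N%:R) * inner_J d p.
  rewrite RintegralB//; last 2 first.
  - by apply: integrableBR => //; exact: integrableZR.
  - by apply: integrableZR => //; exact: integrableDR.
  rewrite RintegralB//; last exact: integrableZR.
  rewrite RintegralZl// RintegralZl//; last exact: integrableDR.
  by rewrite (Ids r) mulr0 subr0 Rintegral_cstR// subr0.
pose w s := ln 6 - v s - ell p - (ell (s - p) + ell s).
have iw : mu.-integrable `[0, pi] (EFin \o w).
  apply: integrableBR => //; last exact: integrableDR.
  by apply: integrableBR => //; exact: integrableBR.
have Iw : \int[mu]_(s in `[0, pi]) w s = ln 6 * pi - \int[mu]_(s in `[0, pi]) v s - ell p * pi.
  rewrite RintegralB//; last 2 first.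
  - by apply: integrableBR => //; exact: integrableBR.
  - exact: integrableDR.
  rewrite RintegralB//; last exact: integrableBR.
  rewrite RintegralB// !Rintegral_cstR//.
  rewrite (_ : \int[mu]_(s in `[0, pi]) (ell (s - p) + ell s) = 0) ?subr0//.
  by rewrite -[RHS](Ids p); apply: eq_Rintegral => s _; rewrite addrC.
(* [inner_J] enters the lower estimate as [- 2 * inner_J d p / N], so an upper bound is what keeps
   this term above [- C / N]. *)
have K5 : inner_J d p <= pi * ln 5.
  rewrite mulrC -[pi]subr0 -Rintegral_cstR//; apply: le_Rintegral => // q _.
  exact: Jf_le.
exists (\int[mu]_(s in `[0, pi]) w s); split.
- rewrite -EFin_Rintegral//; apply: ae_eq_integral => //.
  + by apply: measurable_funTS; exact: (@measurable_section1 _ _ (fun s p => lne (Pn d s p)%:E) p (measurable_lnePn d)).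
  + by apply/measurable_EFinP/measurable_funTS; rewrite /w; meas.
  have h1 := @ae_sin_neq0 R N%:R 0 (lt0r_neq0 N0).
  have h2 := @ae_sin_neq0 R N%:R (- r) (lt0r_neq0 N0).
  have h3 := @ae_sin_neq0 R 1 0 (oner_neq0 _).
  have h4 := @ae_sin_neq0 R 1 (- p) (oner_neq0 _).
  have := aeI (aeI h1 h2) (aeI h3 h4); apply: aeS => s.
  rewrite !addr0 !mul1r => -[[s1 s2] [s3 s4]] _.
  have ks : kap p (N%:R * s) r != 0 by rewrite /kap !mulf_neq0.
  have [F0 _ _] := @mean_log R N p (N%:R * s) isT sr ks.
  (* With [q = N s], the sample point of index 0 is [s] itself, so positivity holds at the point
     under consideration. *)
  have := F0 ord0; rewrite mulr0 addr0 -[N%:R * s / _]mulrC mulKf ?gt_eqF//.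
  rewrite -Pn_Fabs -/(Fabs s) => Fs.
  have Ps : 0 < Pn d s p.
    rewrite lt_neqAle normc_ge0 andbT; apply/eqP => P0.
    by move: Fs; rewrite /Fabs -P0 mul0r ltxx.
  have lnE (P a b c : R) : 0 < P -> 0 < a -> 0 < b -> 0 < c ->
      ln P = ln 6 - (ln 6 - ln (P * (a * b * c))) - ln a - (ln b + ln c).
    by move=> P0 a0 b0 c0; rewrite !lnM ?posrE ?mulr_gt0//; ring.
  by rewrite lne_EFin//; congr EFin; apply: lnE; rewrite // ?mulr_gt0 ?normr_gt0.
- by rewrite Iw; move: Ilo; rewrite IloE; lra.
- rewrite Iw; move: Ihi; rewrite IhiE => Ihi.
  apply: le_trans (_ : _ <= inner_J d p - pi * ell p + (pi * (ell p + ell (p - r) - ln 2)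
    - 2 * inner_J d p) / N%:R) _; last by lra.
  by rewrite lerD2l ler_pM2r ?invr_gt0//; lra.
Qed.

Lemma measurable_integral_param (D : set R) (f : R -> R -> \bar R) : measurable D ->
  measurable_fun [set: R * R] (fun z => f z.1 z.2) ->
  measurable_fun [set: R] (fun x => \int[mu]_(y in D) f x y)%E.
Proof.
move=> mD mf; under eq_fun do rewrite integralE.
apply: emeasurable_funB.
- apply: (@measurable_ge0_integral R _ R D (fun x => (f x)^\+%E)) => //.
  rewrite (_ : (fun z => _) = ((fun z : R * R => f z.1 z.2)^\+)%E); last first.
    by apply/funext => z; rewrite !funeposE.
  exact: measurable_funepos.
- apply: (@measurable_ge0_integral R _ R D (fun x => (f x)^\-%E)) => //.
  rewrite (_ : (fun z => _) = ((fun z : R * R => f z.1 z.2)^\-)%E); last first.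
    by apply/funext => z; rewrite !funenegE.
  exact: measurable_funeneg.
Qed.

Lemma measurable_swap2 (f : R -> R -> \bar R) :
  measurable_fun [set: R * R] (fun z => f z.1 z.2) ->
  measurable_fun [set: R * R] (fun z => f z.2 z.1).
Proof. by move=> mf; exact: (measurableT_comp mf (@measurable_swap _ _ R R)). Qed.

Lemma integrable_inner_J d : mu.-integrable `[0, pi] (EFin \o inner_J d).
Proof.
have p0 := pi_ge0 R.
have iB : mu.-integrable `[0, pi]
    (EFin \o (fun p => pi * (`|ell (d.+2%:R * p + 0)| + ln 5))).
  apply: integrableZR => //; apply: integrableDR => //; last exact: integrable_cstR.
  exact/integrable_norm/integrable_ell.
apply: (ae_le_integrable _ _ iB) => //.
  apply/measurable_EFinP/measurable_funTS/measurableT_comp => //.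
  apply: (@measurable_integral_param _ (fun p q => (Jf p q (d.+2%:R * p))%:E)) => //.
  by apply/measurable_EFinP/measurable_Jf; meas.
have := @ae_sin_neq0 R d.+2%:R 0; rewrite pnatr_eq0 => /(_ isT).
apply: aeS => p; rewrite addr0 => sr _ /=; rewrite lee_fin addr0.
rewrite [leRHS]ger0_norm; last by rewrite mulr_ge0// addr_ge0// ln_ge0// ler1n.
set M := `|_| + _.
have iJ := @integrable_Jf p _ sr.
have JM q := @normr_Jf_le p q _ sr.
rewrite ler_norml; apply/andP; split.
  have -> : - (pi * M) = \int[mu]_(q in `[0, pi]) (- M).
    by rewrite Rintegral_cstR// subr0 mulNr mulrC.
  apply: le_Rintegral => //; first exact: integrable_cstR.
  by move=> q _; have := JM q; rewrite ler_norml -/M => /andP[].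
have -> : pi * M = \int[mu]_(q in `[0, pi]) M by rewrite Rintegral_cstR// subr0 mulrC.
apply: le_Rintegral => //; first exact: integrable_cstR.
by move=> q _; have := JM q; rewrite ler_norml -/M => /andP[].
Qed.

Definition outer_J d : R := \int[mu]_(p in `[0, pi]) inner_J d p.

(** The terms left by [inner_bounds] are [ell p] and, up to sign of its argument, [ell ((N - 1) p)].
    Since [N - 1 = d + 1] is positive, both have mean 0 over [p], and only bounded errors divided by
    [N] survive. *)
Lemma outer_bounds d : exists m : R,
  [/\ (\int[mu]_(p in `[0%R, pi]) \int[mu]_(s in `[0%R, pi]) lne (Pn d s p)%:E = m%:E)%E,
   m <= outer_J d + pi ^+ 2 * ln 2 / d.+2%:R &
   outer_J d - pi ^+ 2 * (2 * ln 5 + ln 2) / d.+2%:R <= m].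
Proof.
set N := d.+2; have N0 : 0 < N%:R :> R by rewrite ltr0n.
have p0 := pi_ge0 R.
pose In p := (\int[mu]_(s in `[0%R, pi]) lne (Pn d s p)%:E)%E.
have mIn : measurable_fun setT In.
  apply: (@measurable_integral_param _ (fun p s => lne (Pn d s p)%:E)) => //.
  exact: (@measurable_swap2 (fun s p => lne (Pn d s p)%:E) (measurable_lnePn d)).
pose I p := fine (In p).
have mI : measurable_fun setT I by exact: measurableT_comp.
have good : {ae mu, forall p : R, [/\ sin p != 0, sin (N%:R * p) != 0 & sin (p - N%:R * p) != 0]}.
  have h1 := @ae_sin_neq0 R 1 0 (oner_neq0 _).
  have h2 := @ae_sin_neq0 R N%:R 0 (lt0r_neq0 N0).
  have h3 : {ae mu, forall p : R, sin ((1 - N%:R) * p + 0) != 0}.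
    by apply: ae_sin_neq0; rewrite subr_eq0 eq_sym pnatr_eq1.
  have := aeI h1 (aeI h2 h3); apply: aeS => p; rewrite !addr0 mul1r.
  by rewrite mulrBl mul1r => -[? [? ?]].
pose Up p := inner_J d p - pi * ell p + pi * ln 2 / N%:R.
pose Lo p := inner_J d p - pi * ell p +
  (pi / N%:R * (ell p + ell (d.+1%:R * p + 0)) - pi * (2 * ln 5 + ln 2) / N%:R).
have bnd : {ae mu, forall p, [/\ In p = (I p)%:E, I p <= Up p & Lo p <= I p]}.
  move: good; apply: aeS => p [sp sr spr].
  have [J [JE J1 J2]] := @inner_bounds d p sp sr spr.
  have IJ : I p = J by rewrite /I /In JE.
  split; [by rewrite IJ|by rewrite IJ|rewrite IJ; apply: le_trans J2].
  rewrite /Lo addr0 (_ : ell (d.+1%:R * p) = ell (p - N%:R * p)).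
    by rewrite -/N; lra.
  rewrite /ell -[in RHS]normrN -[in RHS]sinN opprB /N; congr (ln (2 * `|sin _|)).
  by rewrite -[d.+2%:R]natr1 mulrDl mul1r addrK.
have iJ := integrable_inner_J d.
have ic k := @integrable_cstR R 0 pi k.
have iell0 : mu.-integrable `[0, pi] (EFin \o ell).
  rewrite (_ : ell = fun q => ell (q + 0)); first exact: integrable_ell_shift.
  by apply/funext => q; rewrite addr0.
have Iell0 : \int[mu]_(q in `[0, pi]) ell q = 0.
  by rewrite -[RHS](Rintegral_ell_shift 0); apply: eq_Rintegral => q _; rewrite addr0.
have iell1 := @integrable_ell R d.+1 0 isT.
have Iell1 := @Rintegral_ell R d.+1 0 isT.
have iUp : mu.-integrable `[0, pi] (EFin \o Up).
  apply: integrableDR => //; apply: integrableBR => //; exact: integrableZR.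
have iLo1 : mu.-integrable `[0, pi] (EFin \o
    (fun p => pi / N%:R * (ell p + ell (d.+1%:R * p + 0)) - pi * (2 * ln 5 + ln 2) / N%:R)).
  by apply: integrableBR => //; apply: integrableZR => //; exact: integrableDR.
have iLo : mu.-integrable `[0, pi] (EFin \o Lo).
  by apply: integrableDR => //; apply: integrableBR => //; exact: integrableZR.
have iI : mu.-integrable `[0, pi] (EFin \o I).
  have iUL : mu.-integrable `[0, pi] (EFin \o (fun p => `|Up p| + `|Lo p|)).
    by apply: integrableDR => //; exact: integrable_norm.
  apply: (ae_le_integrable _ _ iUL) => //; first exact/measurable_EFinP/measurable_funTS.
  move: bnd; apply: aeS => p [_ h1 h2] _; rewrite lee_fin [leRHS]ger0_norm ?addr_ge0//.
  have := ler_norm (Up p); have := ler_norm (- Lo p); rewrite normrN => g1 g2.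
  by rewrite ler_norml; apply/andP; split; have := normr_ge0 (Up p);
    have := normr_ge0 (Lo p); lra.
exists (\int[mu]_(p in `[0, pi]) I p); split.
- rewrite -EFin_Rintegral//; apply: ae_eq_integral => //.
  + exact: measurable_funTS.
  + exact/measurable_EFinP/measurable_funTS.
  by move: bnd; apply: aeS => p [].
- have -> : outer_J d + pi ^+ 2 * ln 2 / N%:R = \int[mu]_(p in `[0, pi]) Up p.
    rewrite RintegralD//; last by apply: integrableBR => //; exact: integrableZR.
    rewrite RintegralB//; last exact: integrableZR.
    by rewrite RintegralZl// Iell0 mulr0 subr0 Rintegral_cstR// subr0 -/(outer_J d); lra.
  by apply: ae_le_Rintegral => //; move: bnd; apply: aeS => p [].
- have -> : outer_J d - pi ^+ 2 * (2 * ln 5 + ln 2) / N%:R = \int[mu]_(p in `[0, pi]) Lo p.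
    rewrite RintegralD//; last by apply: integrableBR => //; exact: integrableZR.
    rewrite RintegralB//; last exact: integrableZR.
    rewrite RintegralZl// Iell0 mulr0 subr0 RintegralB//; last first.
      by apply: integrableZR => //; exact: integrableDR.
    rewrite RintegralZl//; last exact: integrableDR.
    rewrite [X in _ = _ + (_ * X - _)]RintegralD// Iell0 Iell1 addr0 mulr0 sub0r.
    by rewrite Rintegral_cstR// subr0 -/(outer_J d); lra.
  by apply: ae_le_Rintegral => //; move: bnd; apply: aeS => p [].
Qed.

End mahler_inner.

(** * Equidistribution and passage to the limit in [d] *)

Section riemann_sums.
Context {R : realType}.
Local Notation mu := (@lebesgue_measure R).

(** Heine's theorem. Around each [x] the local radius [eta] is halved, so that [x'] within [eta / 2]
    of [x] and [y] within [dl < eta / 2] of [x'] are both compared with [x]. *)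
Lemma unif_continuous_itv (a b : R) (f : R -> R) : {within `[a, b], continuous f} ->
  forall e : R, 0 < e -> exists2 dl : R, 0 < dl &
    forall x y : R, x \in `[a, b] -> y \in `[a, b] -> `|x - y| < dl -> `|f x - f y| < e.
Proof.
move=> cf e e0.
have loc (x : R) : x \in `[a, b] -> exists2 eta : R, 0 < eta &
    forall y : R, y \in `[a, b] -> `|x - y| < eta -> `|f x - f y| < e / 2.
  move=> xab; move/subspace_continuousP : cf => /(_ x xab).
  move=> /cvgrPdist_lt /(_ (e / 2)); rewrite divr_gt0// => /(_ isT).
  rewrite near_withinE => -[eta /= eta0 H]; exists eta => // y yab xy.
  exact: H.
have /compact_near_coveringP/(_ R (0 : R)^'+ (fun dl x => forall y, x \in `[a, b] ->
    y \in `[a, b] -> `|x - y| < dl -> `|f x - f y| < e)) := @segment_compact R a b.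
move=> /(_ _ _).
case.
  move=> x /= xab; have [eta eta0 H] := loc x xab.
  exists (ball x (eta / 2), [set dl | 0 < dl < eta / 2]).
    split => /=; first by apply: nbhsx_ballx; rewrite divr_gt0.
    near=> dl => /=; apply/andP; split; [by []|].
    near: dl; apply: nbhs_right_lt; by rewrite divr_gt0.
  move=> [x' dl] /= [xx' /andP[dl0 dle]] y x'ab yab x'y.
  have h1 : `|f x - f x'| < e / 2 by apply: H => //; apply: lt_le_trans xx' _; lra.
  have h2 : `|f x - f y| < e / 2.
    apply: H => //; have -> : x - y = (x - x') + (x' - y) by ring.
    apply: le_lt_trans (ler_normD _ _) _.
    by have : `|x - x'| < eta / 2 by []; lra.
  have -> : f x' - f y = - (f x - f x') + (f x - f y) by ring.
  by apply: le_lt_trans (ler_normD _ _) _; rewrite normrN; lra.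
move=> dl /= dl0 H; exists (dl / 2); first by rewrite divr_gt0.
move=> x y xab yab xy; apply: (H (dl / 2)) => //=.
- by rewrite sub0r normrN gtr0_norm ?divr_gt0//; lra.
- by rewrite divr_gt0.
Unshelve. all: by end_near. Qed.

Lemma mean_points (L x : R) (N k : nat) : 0 <= L -> x \in `[0, L] -> (k < N)%N ->
  (x + L * k%:R) / N%:R \in `[0, L].
Proof.
move=> L0; rewrite !in_itv/= => /andP[x0 xL] kN.
have N0 : 0 < N%:R :> R by rewrite ltr0n (leq_ltn_trans _ kN).
apply/andP; split; first by rewrite divr_ge0 ?addr_ge0 ?mulr_ge0// ltW.
rewrite ler_pdivrMr//; apply: (@le_trans _ _ (L + L * k%:R)); first by rewrite lerD2r.
rewrite -{1}[L]mulr1 -mulrDr ler_wpM2l// addrC natr1 ler_nat//.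
Qed.

(** Changing [s] to another [x] of [[0, L]] moves each sample point by at most [L / N], so
    [mean N L f] is constant up to [e] by uniform continuity. Its integral is that of [f], so that
    constant is the average of [f]. *)
Lemma riemann_mean (L s : R) (f : R -> R) : 0 < L -> s \in `[0, L] ->
  measurable_fun setT f -> (forall x, 0 <= f x) -> {within `[0, L], continuous f} ->
  mean n.+1 L f s @[n --> \oo] --> L^-1 * \int[mu]_(x in `[0, L]) f x.
Proof.
move=> L0 sL mf f0 cf; have L0' := ltW L0.
have intf : mu.-integrable `[0, L] (EFin \o f).
  by apply: continuous_compact_integrable => //; exact: segment_compact.
apply/cvgrPdist_le => /= e e0.
have [dl dl0 H] := unif_continuous_itv cf e0.
near=> n; set N := n.+1.
have N0 : 0 < N%:R :> R by rewrite ltr0n.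
have [im IE] := @Rintegral_mean R N L f isT L0' mf f0 intf.
have LN : L / N%:R < dl.
  rewrite ltr_pdivrMr// mulrC -ltr_pdivrMr//.
  apply: lt_trans (_ : n%:R < _); last by rewrite ltr_nat.
  by near: n; exact: nbhs_infty_gtr.
have close x : x \in `[0, L] -> `|mean N L f x - mean N L f s| <= e.
  move=> xL; rewrite /mean -mulrBr -sumrB normrM ger0_norm ?invr_ge0 ?(ltW N0)//.
  rewrite ler_pdivrMl//; apply: le_trans (ler_norm_sum _ _ _) _.
  have -> : N%:R * e = \sum_(k < N) e by rewrite sumr_const card_ord mulr_natl.
  apply: ler_sum => k _; apply/ltW/H; try exact: mean_points.
  rewrite -mulrBl opprD addrACA subrr addr0 normrM [`|_^-1|]ger0_norm ?invr_ge0 ?(ltW N0)//.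
  apply: le_lt_trans LN; rewrite ler_pM2r ?invr_gt0// ler_norml.
  move: xL sL; rewrite !in_itv/= => /andP[? ?] /andP[? ?]; apply/andP; split; lra.
rewrite IE.
have E c : c = L^-1 * \int[mu]_(x in `[0, L]) c.
  by rewrite Rintegral_cstR// subr0 mulrC mulfK// gt_eqF.
rewrite ler_norml; apply/andP; split.
  rewrite lerBrDl [X in X <= _]E ler_pM2l ?invr_gt0//; apply: le_Rintegral => //.
    exact: integrable_cstR.
  by move=> x /close; rewrite ler_norml => /andP[h _]; lra.
rewrite lerBlDr [X in _ <= X]E ler_pM2l ?invr_gt0//; apply: le_Rintegral => //.
  exact: integrable_cstR.
by move=> x /close; rewrite ler_norml => /andP[_ h]; lra.
Unshelve. all: by end_near. Qed.

(* Cutting [[0, L]] into [n + 1] pieces turns the left-hand side into Riemann sums of [g ^~ y]. *)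
Lemma equidistribution (L : R) (g : R -> R -> R) (G : R -> R) : 0 < L ->
  measurable_fun [set: R * R] (fun z => g z.1 z.2) ->
  (forall x y, 0 <= g x y) -> (forall x y, g x (y + L) = g x y) ->
  mu.-integrable `[0, L] (EFin \o G) ->
  {ae mu, forall y, y \in `[0, L] -> {within `[0, L], continuous (g ^~ y)} /\
     forall x, x \in `[0, L] -> g x y <= G y} ->
  (\int[mu]_(x in `[0%R, L]) (g x (n.+1%:R * x)%R)%:E)%E @[n --> \oo] -->
  (\int[mu]_(y in `[0%R, L]) (L^-1 * \int[mu]_(x in `[0%R, L]) g x y)%:E)%E.
Proof.
move=> L0 mg g0 pg iG aeg; have L0' := ltW L0.
have pgN (n : nat) x y : g x (y + L * n%:R) = g x y.
  elim: n => [|n IHn]; first by rewrite mulr0 addr0.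
  by rewrite -natr1 mulrDr mulr1 addrA pg.
have mgy y : measurable_fun setT (g ^~ y) by exact: measurable_section1.
have mcomp (u v : R -> R) : measurable_fun setT u -> measurable_fun setT v ->
    measurable_fun setT (fun x => g (u x) (v x)).
  move=> mu' mv'; exact: (measurableT_comp mg (measurable_fun_pair mu' mv')).
have maff a b : measurable_fun setT (fun x : R => a * x + b).
  by apply: measurable_funD => //; exact: measurable_funM.
pose f_ n (y : R) : \bar R := (mean n.+1 L (g ^~ y) y)%:E.
have -> : (fun n => \int[mu]_(x in `[0%R, L]) (g x (n.+1%:R * x)%R)%:E)%E =
    (fun n => \int[mu]_(y in `[0%R, L]) f_ n y)%E.
  apply/funext => n; rewrite (@ge0_integral_mean R n.+1 L)//; last first.
    apply: mcomp => //; exact: measurable_funM.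
  apply: eq_integral => y _; congr EFin; rewrite /mean; congr (_ * _).
  apply: eq_bigr => k _; rewrite [n.+1%:R * (_ / _)]mulrC divfK ?pnatr_eq0//.
have mf_ n : measurable_fun `[0, L] (f_ n).
  apply/measurable_EFinP/measurable_funTS/measurable_funM => //.
  apply: measurable_sum => k; apply: mcomp => //; apply: measurable_funM => //.
  exact: measurable_funD.
have [//||||] := @dominated_convergence _ _ R mu `[0, L]%classic _ f_
  (fun y => (L^-1 * \int[mu]_(x in `[0%R, L]) g x y)%:E) (EFin \o G) mf_ _ _ iG.
- apply/measurable_EFinP/measurable_funTS/measurable_funM => //.
  apply: measurableT_comp => //.
  apply: (@measurable_integral_param R _ (fun y x => (g x y)%:E)) => //.
  apply: (@measurable_swap2 R (fun x y => (g x y)%:E)); exact/measurable_EFinP.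
- move: aeg; apply: aeS => y h yL; have [cg _] := h yL.
  apply: cvg_EFin; first by near=> n.
  by apply: riemann_mean.
- move: aeg; apply: aeS => y h n yL; have [_ gG] := h yL.
  rewrite lee_fin ger0_norm; last by exact: mean_ge0.
  rewrite /mean ler_pdivrMl ?ltr0n//.
  have -> : n.+1%:R * G y = \sum_(k < n.+1) G y by rewrite sumr_const card_ord mulr_natl.
  by apply: ler_sum => k _; apply: gG; exact: mean_points.
- by move=> _ _.
Unshelve. all: by end_near. Qed.

(* [ln 5] bounds [Jf] from above, so that Tonelli applies to [hJ]. *)
Definition hJ (p q r : R) : R := ln 5 - Jf p q r.

Lemma hJ_ge0 p q r : 0 <= hJ p q r. Proof. by rewrite subr_ge0 Jf_le. Qed.

Lemma measurable_hJ d (T : measurableType d) (f g h : T -> R) :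
  measurable_fun setT f -> measurable_fun setT g -> measurable_fun setT h ->
  measurable_fun setT (fun x => hJ (f x) (g x) (h x)).
Proof. by move=> mf mg mh; apply: measurable_funB => //; exact: measurable_Jf. Qed.

Lemma hJDpi (p q r : R) : hJ p q (r + pi) = hJ p q r.
Proof.
have sE x : sin (x - (r + pi)) = - sin (x - r).
  by rewrite (_ : x - r = x - (r + pi) + pi) ?sinDpi ?opprK//; ring.
by rewrite /hJ /Jf /kap sinDpi sqrrN !sE !mulrN !mulNr opprK.
Qed.

Lemma continuous_Jf (q r : R) : sin r != 0 -> continuous (fun p => Jf p q r).
Proof.
move=> sr p; rewrite /Jf.
have k0 : 0 < 4 * sin r ^+ 2 + 16 * Num.max (kap p q r) 0.
  rewrite ltr_pwDl ?mulr_ge0 ?le_max ?lexx ?orbT//.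
  by rewrite mulr_gt0// exprn_even_gt0.
apply: cvgM; last exact: cvg_cst.
apply: (@continuous_comp _ _ _ (fun x => 4 * sin r ^+ 2 + 16 * Num.max (kap x q r) 0) (@ln R));
  last exact: continuous_ln.
apply: cvgD; first exact: cvg_cst.
apply: cvgM; first exact: cvg_cst.
apply: (continuous_max (f := fun x => kap x q r) (g := fun=> 0)); last exact: cvg_cst.
rewrite /kap; apply: cvgM; last exact: cvg_cst.
apply: cvgM; first by apply: cvgM; [exact: continuous_sin|exact: cvg_cst].
apply: (@continuous_comp _ _ _ (fun x => x - r) (@sin R)); last exact: continuous_sin.
by apply: cvgB; [exact: cvg_id|exact: cvg_cst].
Qed.

(** The limit of the integral of [hJ p q (N p)] over [p] and [q]. The variable [q] is outermost
    because equidistribution is applied at fixed [q], with [r] in the place of [N p]. *)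
Definition Theta : \bar R := (\int[mu]_(q in `[0%R, pi]) \int[mu]_(r in `[0%R, pi])
  (pi^-1 * \int[mu]_(p in `[0%R, pi]) hJ p q r)%:E)%E.

Lemma hJ_le (p q r : R) : sin r != 0 -> hJ p q r <= ln 5 + `|ell r|.
Proof.
move=> sr; rewrite /hJ lerD2l; apply: (@le_trans _ _ (- ell r)).
  by rewrite lerN2 ell_le_Jf.
by rewrite -normrN ler_norm.
Qed.

(** Two limits are nested: at fixed [q], [equidistribution] decouples [N p] from [p]; then dominated
    convergence in [q]. Working with [hJ] instead of [Jf] lets Tonelli exchange [p] and [q] at
    finite [d]. *)
Lemma outer_J_cvg : Theta \is a fin_num /\
  outer_J d @[d --> \oo] --> pi ^+ 2 * ln 5 - fine Theta.
Proof.
have p0 := pi_ge0 R; have p0' := pi_gt0 R.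
have iG : mu.-integrable `[0, pi] (EFin \o (fun r => ln 5 + `|ell r|)).
  apply: integrableDR => //; first exact: integrable_cstR.
  apply: integrable_norm; rewrite (_ : ell = fun q => ell (q + 0)).
    exact: integrable_ell_shift.
  by apply/funext => q; rewrite addr0.
have G0 (r : R) : 0 <= ln 5 + `|ell r| by rewrite addr_ge0// ln_ge0// ler1n.
pose A d (q : R) := (\int[mu]_(p in `[0%R, pi]) (hJ p q (d.+2%:R * p)%R)%:E)%E.
pose Phi (q : R) := (\int[mu]_(r in `[0%R, pi])
  (pi^-1 * \int[mu]_(p in `[0%R, pi]) hJ p q r)%:E)%E.
have AP q : A d q @[d --> \oo] --> Phi q.
  pose u n := (\int[mu]_(p in `[0%R, pi]) (hJ p q (n.+1%:R * p)%R)%:E)%E.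
  rewrite (_ : (fun d => A d q) = (fun d => u d.+1))// (cvg_shiftS u).
  apply: (@equidistribution pi (fun p r => hJ p q r) (fun r => ln 5 + `|ell r|)) => //.
  - exact: measurable_hJ.
  - by move=> p r; exact: hJ_ge0.
  - by move=> p r; exact: hJDpi.
  - have := @ae_sin_neq0 R 1 0 (oner_neq0 _); apply: aeS => r; rewrite mul1r addr0 => sr _.
    split; last by move=> p _; exact: hJ_le.
    apply: continuous_subspaceT => p; apply: cvgB; first exact: cvg_cst.
    exact: continuous_Jf.
have mA d : measurable_fun setT (A d).
  apply: (@measurable_integral_param R _ (fun q p => (hJ p q (d.+2%:R * p)%R)%:E)) => //.
  by apply/measurable_EFinP/measurable_hJ => //; meas.
have mPhi : measurable_fun setT Phi by apply: (emeasurable_fun_cvg A) => // q _; exact: AP.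
(* The dominating constant is independent of [d]: by periodicity, the integral of [|ell (N p)|] is
   that of [|ell|]. *)
pose C1 := (\int[mu]_(r in `[0, pi]) (ln 5 + `|ell r|)).
have AC d q : (A d q <= C1%:E)%E.
  rewrite -EFin_Rintegral// -(@ge0_integral_periodic_affine R d.+2 0)//; last 2 first.
  - by apply: measurable_funD => //; apply: measurableT_comp => //; exact: measurable_ell.
  - by move=> r; rewrite ellDpi.
  apply: ae_ge0_le_integral => //.
  - by move=> p _; rewrite lee_fin hJ_ge0.
  - by apply/measurable_EFinP/measurable_funTS/measurable_hJ => //; meas.
  - by move=> p _; rewrite lee_fin.
  - by apply/measurable_EFinP/measurable_funTS; meas.
  have := @ae_sin_neq0 R d.+2%:R 0; rewrite pnatr_eq0 => /(_ isT).
  by apply: aeS => p; rewrite addr0 => sr _; rewrite lee_fin hJ_le.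
have A0 d q : (0 <= A d q)%E by apply: integral_ge0 => p _; rewrite lee_fin hJ_ge0.
have [|||||iPhi _ cvA] := @dominated_convergence _ _ R mu `[0, pi]%classic _ A Phi
    (fun=> C1%:E) _ _ _ (integrable_cstR 0 pi C1).
- by [].
- by move=> d; exact: (measurable_funTS (mA d)).
- exact: (measurable_funTS mPhi).
- by apply: aeW => q _; exact: AP.
- by apply: aeW => q d _; rewrite gee0_abs.
have fT : Theta \is a fin_num by exact: integrable_fin_num iPhi.
split => //.
have AE d : (\int[mu]_(q in `[0%R, pi]) A d q = (pi ^+ 2 * ln 5 - outer_J d)%:E)%E.
  have mh : measurable_fun [set: R * R] (fun z => (hJ z.2 z.1 (d.+2%:R * z.2))%:E).
    by apply/measurable_EFinP/measurable_hJ => //; meas.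
  rewrite (@ge0_fubini_set R _ _ (fun q p => (hJ p q (d.+2%:R * p)%R)%:E))//; last first.
    by move=> q p _ _; rewrite lee_fin hJ_ge0.
  have iJ := @integrable_inner_J R d.
  have -> : pi ^+ 2 * ln 5 - outer_J d = \int[mu]_(p in `[0, pi]) (pi * ln 5 - inner_J d p).
    rewrite RintegralB//; last exact: integrable_cstR.
    by rewrite Rintegral_cstR// subr0 -/(outer_J d); ring.
  rewrite -EFin_Rintegral//; last by apply: integrableBR => //; exact: integrable_cstR.
  apply: ae_eq_integral => //.
  - apply: measurable_funTS.
    apply: (@measurable_integral_param R _ (fun p q => (hJ p q (d.+2%:R * p)%R)%:E)) => //.
    by apply/measurable_EFinP/measurable_hJ => //; meas.
  - apply/measurable_EFinP/measurable_funB => //.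
    by case/integrableP: iJ => /measurable_EFinP.
  have := @ae_sin_neq0 R d.+2%:R 0; rewrite pnatr_eq0 => /(_ isT).
  apply: aeS => p; rewrite addr0 => sr _.
  have iJp := @integrable_Jf R p _ sr.
  rewrite EFin_Rintegral//; last by apply: integrableBR => //; exact: integrable_cstR.
  congr EFin; rewrite RintegralB//; last exact: integrable_cstR.
  by rewrite Rintegral_cstR// subr0 mulrC.
have /fine_cvgP[_ cv] : (pi ^+ 2 * ln 5 - outer_J d)%:E @[d --> \oo] --> (fine Theta)%:E.
  by rewrite fineK//; under eq_fun do rewrite -AE; exact: cvA.
have -> : @outer_J R = (fun d => pi ^+ 2 * ln 5 - (pi ^+ 2 * ln 5 - outer_J d)).
  by apply/funext => d; ring.
by apply: cvgB => //; exact: cvg_cst.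
Qed.

End riemann_sums.

(** * The double integral of the excess over the square [[0, r]^2] *)

Section triangle_integral.
Context {R : realType}.
Local Notation mu := (@lebesgue_measure R).

Lemma FTC_derive (f F : R -> R) (a b : R) : a < b ->
  {in `[a, b], continuous f} -> {in `[a, b], forall x : R, is_derive x 1 F (f x)} ->
  mu.-integrable `[a, b] (EFin \o f) /\ \int[mu]_(x in `[a, b]) f x = F b - F a.
Proof.
move=> ab cf dF.
have cf' : {within `[a, b], continuous f}.
  by apply: continuous_in_subspaceT => x; rewrite inE => xab; exact: cf.
have cF x : x \in `[a, b] -> {for x, continuous F}.
  move=> xab; apply: differentiable_continuous; apply/derivable1_diffP.
  by have [] := dF x xab.
have sub x : x \in `]a, b[ -> x \in `[a, b] by exact: subset_itv_oo_cc.
split; first by apply: continuous_compact_integrable => //; exact: segment_compact.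
rewrite /Rintegral (@continuous_FTC2 _ f F)//.
- split.
  + by move=> x /sub xab; have [] := dF x xab.
  + by apply: cvg_at_right_filter; apply: cF; rewrite in_itv/= lexx ltW.
  + by apply: cvg_at_left_filter; apply: cF; rewrite in_itv/= lexx ltW.
- by move=> x /sub xab; rewrite derive1E; have [_ ] := dF x xab.
Qed.

Definition phi (r p : R) : R := sin p * sin (r - p).
(** This is [|A|^2 / |B|^2], since [kap p q r] factors as [phi r p * phi r q]. *)
Definition den (r p q : R) : R := 1 + 4 / sin r ^+ 2 * (phi r p * phi r q).

Lemma phi_ge0 (r p : R) : r < pi -> p \in `[0, r] -> 0 <= phi r p.
Proof.
move=> rpi; rewrite in_itv/= => /andP[p0 pr].
by rewrite mulr_ge0// sin_ge0_pi//; apply/andP; split; lra.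
Qed.

Lemma phi_gt0 (r p : R) : r < pi -> p \in `]0, r[ -> 0 < phi r p.
Proof.
move=> rpi; rewrite in_itv/= => /andP[p0 pr].
by rewrite mulr_gt0// sin_gt0_pi//; apply/andP; split; lra.
Qed.

Lemma den_ge1 (r p q : R) : r < pi -> p \in `[0, r] -> q \in `[0, r] -> 1 <= den r p q.
Proof.
by move=> rpi p0 q0; rewrite lerDl mulr_ge0 ?divr_ge0 ?sqr_ge0// mulr_ge0// phi_ge0.
Qed.

Lemma continuous_phi r : continuous (phi r).
Proof.
move=> p; apply: cvgM; first exact: continuous_sin.
apply: (@continuous_comp _ _ _ (fun x => r - x) (@sin R)); last exact: continuous_sin.
by apply: cvgB; [exact: cvg_cst|exact: cvg_id].
Qed.

Lemma continuous_den r p : continuous (den r p).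
Proof.
move=> q; apply: cvgD; first exact: cvg_cst.
apply: cvgM; first exact: cvg_cst.
by apply: cvgM; [exact: cvg_cst|exact: continuous_phi].
Qed.

Lemma denC r p q : den r p q = den r q p.
Proof. by rewrite /den (mulrC (phi r p)). Qed.

(** Coordinates centred at the midpoint [A = r / 2] make [den] a positive combination of [cos^2 w]
    and [sin^2 w], whose inverse has an arctangent primitive in [tan w]. *)
Lemma den_half (A B w : R) : sin A != 0 -> cos A != 0 ->
  den (A + A) (A - B) (w + A) =
  (cos B ^+ 2 * sin A ^+ 2 * cos w ^+ 2 + sin B ^+ 2 * cos A ^+ 2 * sin w ^+ 2)
    / (sin A ^+ 2 * cos A ^+ 2).
Proof.
move=> sA cA; rewrite /den /phi.
have -> : A + A - (A - B) = A + B by ring.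
have -> : A + A - (w + A) = A - w by ring.
rewrite !sinB !sinD.
have hA := cos2sin2 A; have hB := cos2sin2 B; have hw := cos2sin2 w.
have num : cos B ^+ 2 * sin A ^+ 2 * cos w ^+ 2 + sin B ^+ 2 * cos A ^+ 2 * sin w ^+ 2 =
   sin A ^+ 2 * cos A ^+ 2 + (sin A * cos B - cos A * sin B) * (sin A * cos B + cos A * sin B) *
   ((sin w * cos A + cos w * sin A) * (sin A * cos w - cos A * sin w)) by ring: hA hB hw.
rewrite num; field.
by rewrite sA cA (mulrC (cos A)) -mulr2n mulrn_eq0 /= mulf_neq0.
Qed.

Lemma integral_inv_den (A B : R) : 0 < A -> A + A < pi -> B != 0 -> - A < B < A ->
  \int[mu]_(q in `[0, A + A]) (den (A + A) (A - B) q)^-1 =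
  (B + B) * sin (A + A) / sin (B + B).
Proof.
move=> A0 Api B0 /andP[AB BA].
have pA : 0 < A < pi by apply/andP; split; lra.
have sA : 0 < sin A by exact: sin_gt0_pi.
have cA : 0 < cos A by apply: cos_gt0_pihalf; apply/andP; split; lra.
have cB : 0 < cos B by apply: cos_gt0_pihalf; apply/andP; split; lra.
have sB : sin B != 0.
  have [Bp|Bn] := ltP 0 B; first by rewrite gt_eqF// sin_gt0_pi//; apply/andP; split; lra.
  rewrite -oppr_eq0 -sinN gt_eqF// sin_gt0_pi//; move: B0; rewrite neq_lt => /orP[|]; last by lra.
  by move=> ?; apply/andP; split; lra.
have ABin : A - B \in `[0, A + A] by rewrite in_itv/=; apply/andP; split; lra.
(* [k = tan B / tan A], chosen so that [k * tan A = tan B]: at the two ends [q - A] is [A] or [- A],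
   and the arctangent returns [B] or [- B]. The bound [A < pi / 2] keeps [cos (q - A)] positive in
   between. *)
pose k := (sin B * cos A) / (cos B * sin A).
pose c0 := sin (A + A) / sin (B + B).
pose G q := c0 * atan (k * tan (q - A)).
have cw q : q \in `[0, A + A] -> 0 < cos (q - A).
  rewrite in_itv/= => /andP[q0 qA]; apply: cos_gt0_pihalf; apply/andP; split; lra.
have [|||_ ->] := @FTC_derive (fun q => (den (A + A) (A - B) q)^-1) G 0 (A + A).
- by lra.
- move=> q qA; apply: cvgV; last exact: continuous_den.
  by rewrite gt_eqF// (lt_le_trans ltr01)// den_ge1.
- move=> q qA; have c1 := cw q qA.
  have dtan : is_derive q 1 (fun q => k * tan (q - A)) (k * (cos (q - A)) ^- 2).
    have h1 : is_derive (q - A) 1 tan ((cos (q - A)) ^- 2) by apply: is_derive_tan; rewrite gt_eqF.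
    have h2 : is_derive q 1 (fun q : R => q - A) 1 by apply: is_derive_eq; rewrite subr0.
    have := @is_derive1_comp _ tan (fun q => q - A) q _ _ h1 h2.
    rewrite mulr1 => h3.
    exact: is_deriveZ.
  have datan := @is_derive1_comp _ atan (fun q => k * tan (q - A)) q _ _
     (is_derive1_atan (k * tan (q - A))) dtan.
  have dG := is_deriveZ c0 datan.
  suff E : c0 * ((1 + (k * tan (q - A)) ^+ 2)^-1 * (k / cos (q - A) ^+ 2)) =
    (den (A + A) (A - B) q)^-1 by rewrite -E; exact: dG.
  rewrite -[q in RHS](subrK A) den_half ?gt_eqF//.
  move: c1; move: (q - A) => w c1.
  set D := cos B ^+ 2 * _ * _ + _.
  have D0 : 0 < D.
    apply: ltr_pwDl; first by rewrite !mulr_gt0 ?exprn_gt0.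
    by rewrite -!exprMn sqr_ge0.
  have -> : 1 + (k * tan w) ^+ 2 = D / (cos B * sin A * cos w) ^+ 2.
    by rewrite /k /tan /D; field; rewrite !gt_eqF.
  have ss : sin (B + B) = 2 * sin B * cos B by rewrite sinD; ring.
  rewrite /c0 /k ss (_ : sin (A + A) = 2 * sin A * cos A); last by rewrite sinD; ring.
  move: D0; move: D => D D0.
  have [nA nC nB nw nD] := And5 (lt0r_neq0 sA) (lt0r_neq0 cA) (lt0r_neq0 cB) (lt0r_neq0 c1) (lt0r_neq0 D0).
  by field; do ?[apply/andP; split].
rewrite /G addrK add0r.
have kt : k * tan A = tan B by rewrite /k /tan; field; rewrite !gt_eqF.
rewrite tanN mulrN atanN kt tanK; last by rewrite in_itv/=; apply/andP; split; lra.
by rewrite /c0; ring.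
Qed.

Definition idcot (t : R) : R := t * cos t / sin t.

(* The derivative of [ln (den r p q)] in [p]. *)
Definition Dq (r p q : R) : R := 4 / sin r ^+ 2 * sin (r - p - p) * phi r q / den r p q.

(** The numerator of [Dq] is a multiple of [den - 1], so [Dq] is a constant times [1 - 1 / den].
    [integral_inv_den] applies with [A = r / 2] and [B = r / 2 - t], and the addition formulas for
    [sin r] and [sin (r - 2t)] turn the quotients into cotangents. *)
Lemma integral_Dq (r t : R) : 0 < r < pi -> t \in `]0, r[ ->
  mu.-integrable `[0, r] (EFin \o Dq r t) /\
  \int[mu]_(q in `[0, r]) Dq r t q = 2 * (idcot t - idcot (r - t)).
Proof.
move=> /andP[r0 rpi] tr; have tr' : t \in `[0, r] by exact: subset_itv_oo_cc tr.
have ph := phi_gt0 rpi tr.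
have := tr; rewrite in_itv/= => /andP[t0 tr2].
have sr : 0 < sin r by apply: sin_gt0_pi; apply/andP; split.
have st : 0 < sin t by apply: sin_gt0_pi; apply/andP; split; lra.
have srt : 0 < sin (r - t) by apply: sin_gt0_pi; apply/andP; split; lra.
have d1 q : q \in `[0, r] -> 0 < den r t q.
  by move=> qr; rewrite (lt_le_trans ltr01)// den_ge1.
have iinv : mu.-integrable `[0, r] (EFin \o (fun q => (den r t q)^-1)).
  apply: continuous_compact_integrable; first exact: segment_compact.
  apply: continuous_in_subspaceT => q; rewrite inE => qr.
  by apply: cvgV; [rewrite gt_eqF// d1|exact: continuous_den].
have DqE q : q \in `[0, r] -> Dq r t q = sin (r - t - t) / phi r t * (1 - (den r t q)^-1).
  move=> /d1; rewrite /Dq /den; set a := 4 / _ => a0.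
  by field; rewrite gt_eqF//= gt_eqF.
have iB : mu.-integrable `[0, r]
    (EFin \o (fun q => sin (r - t - t) / phi r t * (1 - (den r t q)^-1))).
  by apply: integrableZR => //; apply: integrableBR => //; exact: integrable_cstR.
split.
  by apply: eq_integrable iB => // q qr; rewrite /= DqE//; move: qr; rewrite inE.
transitivity (\int[mu]_(q in `[0, r]) (sin (r - t - t) / phi r t * (1 - (den r t q)^-1))).
  by apply: eq_Rintegral => q; rewrite inE => /DqE.
rewrite RintegralZl//; last by apply: integrableBR => //; exact: integrable_cstR.
rewrite RintegralB//; last exact: integrable_cstR.
rewrite Rintegral_cstR ?ltW// subr0 mul1r.
have rE : r / 2 + r / 2 = r by field.
(* At the midpoint [t = r / 2] the parameter [B] is [0], which [integral_inv_den] excludes; there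
   both sides vanish. *)
have [u0|u0] := eqVneq (r - t - t) 0.
  have -> : r - t = t by move/eqP: u0; rewrite subr_eq0 => /eqP.
  by rewrite !subrr sin0 !mul0r mulr0.
have uE : r / 2 - t + (r / 2 - t) = r - t - t by rewrite -{3}rE; ring.
have := @integral_inv_den (r / 2) (r / 2 - t).
rewrite rE uE (_ : r / 2 - (r / 2 - t) = t); last by ring.
move=> ->; [| lra | by [] | | by apply/andP; split; lra]; last first.
  by apply: contra_neq u0 => u0; rewrite -uE u0 addr0.
have su : sin (r - t - t) = sin (r - t) * cos t - cos (r - t) * sin t by rewrite sinB.
have sr2 : sin r = sin (r - t) * cos t + cos (r - t) * sin t by rewrite -sinD subrK.
have su0 : sin (r - t - t) != 0.
  have [up|un] := ltP 0 (r - t - t).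
    by rewrite gt_eqF// sin_gt0_pi//; apply/andP; split; lra.
  rewrite -oppr_eq0 -sinN gt_eqF// sin_gt0_pi//.
  by move: u0; rewrite neq_lt => /orP[?|]; [apply/andP; split; lra|lra].
rewrite mulrBr mulrA [sin (r - t - t) / phi r t * ((r - t - t) * sin r)]mulrAC.
rewrite /idcot /phi.
transitivity (r * sin (r - t - t) / (sin t * sin (r - t)) -
  (r - t - t) * sin r / (sin t * sin (r - t))).
  by field; rewrite su0 !gt_eqF.
rewrite su sr2.
by field; rewrite !gt_eqF.
Qed.

Lemma is_derive_phi (r p : R) : is_derive p 1 (phi r) (sin (r - p - p)).
Proof.
have h1 : is_derive p 1 (fun p : R => r - p) (-1).
  by have := is_deriveB (is_derive_cst r p (1 : R)) (is_derive_id p (1 : R)); rewrite sub0r.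
have h2 := @is_derive1_comp _ sin (fun p => r - p) p _ _ (is_derive_sin (r - p)) h1.
have h3 := is_deriveM (is_derive_sin p) h2.
suff <- : sin p *: (cos (r - p) * -1) + sin (r - p) *: cos p = sin (r - p - p).
  exact: h3.
by rewrite [RHS]sinB /GRing.scale/=; ring.
Qed.

Lemma is_derive_den (r p q : R) :
  is_derive p 1 (fun p => den r p q) (4 / sin r ^+ 2 * sin (r - p - p) * phi r q).
Proof.
have h1 := is_deriveZ (4 / sin r ^+ 2 * phi r q) (is_derive_phi r p).
have h2 := is_deriveD (is_derive_cst (1 : R) p 1) h1.
have -> : (fun p => den r p q) = (fun p => 1 + (4 / sin r ^+ 2 * phi r q) * phi r p).
  by apply/funext => x; rewrite /den (mulrC (phi r x)) mulrA.
suff <- : 0 + (4 / sin r ^+ 2 * phi r q) *: sin (r - p - p) =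
  4 / sin r ^+ 2 * sin (r - p - p) * phi r q by exact: h2.
by rewrite add0r /GRing.scale/= mulrAC.
Qed.

(** Integration by parts: the boundary terms vanish because [phi r] is zero at [0] and [r], so that
    [den = 1] there. Among the primitives of [1], the choice [p - r / 2] makes the new integrand
    nonnegative, as [r / 2 - p] and [sin (r - 2p)] have the same sign; Tonelli then exchanges [p]
    and [q]. *)
Lemma integral_ln_den (r q : R) : 0 < r < pi -> q \in `[0, r] ->
  [/\ mu.-integrable `[0, r] (EFin \o (fun p => ln (den r p q))),
   mu.-integrable `[0, r] (EFin \o (fun p => (r / 2 - p) * Dq r p q)) &
   \int[mu]_(p in `[0, r]) ln (den r p q) = \int[mu]_(p in `[0, r]) ((r / 2 - p) * Dq r p q)].
Proof.
move=> /andP[r0 rpi] qr.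
have d1 p : p \in `[0, r] -> 0 < den r p q.
  by move=> pr; rewrite (lt_le_trans ltr01)// den_ge1.
have cden : continuous (fun p => den r p q).
  by under eq_fun do rewrite denC; exact: continuous_den.
have cln : {in `[0, r], continuous (fun p => ln (den r p q))}.
  move=> p pr; apply: (@continuous_comp _ _ _ (fun p => den r p q) (@ln R)); first exact: cden.
  exact/continuous_ln/d1.
have cD : {in `[0, r], continuous (fun p => (r / 2 - p) * Dq r p q)}.
  move=> p pr; apply: cvgM; first by apply: cvgB; [exact: cvg_cst|exact: cvg_id].
  apply: cvgM; last by apply: cvgV; [rewrite gt_eqF// d1|exact: cden].
  apply: cvgM; last exact: cvg_cst.
  apply: cvgM; first exact: cvg_cst.
  apply: (@continuous_comp _ _ _ (fun x => r - x - x) (@sin R)); last exact: continuous_sin.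
  by apply: cvgB; [apply: cvgB; [exact: cvg_cst|exact: cvg_id]|exact: cvg_id].
have ic f : {in `[0, r], continuous f} -> mu.-integrable `[0, r] (EFin \o f).
  move=> cf; apply: continuous_compact_integrable; first exact: segment_compact.
  by apply: continuous_in_subspaceT => p; rewrite inE => pr; exact: cf.
have i1 := ic _ cln; have i2 := ic _ cD.
split => //.
pose F p := (p - r / 2) * ln (den r p q).
have [||_] := @FTC_derive (fun p => ln (den r p q) - (r / 2 - p) * Dq r p q) F 0 r r0.
- by move=> p pr; apply: cvgB; [exact: cln|exact: cD].
- move=> p pr.
  have h1 := @is_derive1_comp _ (@ln R) (fun p => den r p q) p _ _
    (is_derive1_ln (d1 p pr)) (is_derive_den r p q).
  have h2 : is_derive p 1 (fun p : R => p - r / 2) 1 by apply: is_derive_eq; rewrite subr0.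
  have h3 := is_deriveM h2 h1.
  apply: is_derive_eq h3 _.
  by rewrite /GRing.scale/= /Dq; ring.
have e0 : den r 0 q = 1 by rewrite /den /phi sin0 !mul0r mulr0 addr0.
have e1 : den r r q = 1 by rewrite /den /phi subrr sin0 mulr0 mul0r mulr0 addr0.
rewrite (RintegralB _ i1 i2)// /F e1 e0 ln1 !mulr0 subrr => /eqP.
by rewrite subr_eq0 => /eqP.
Qed.

Lemma measurable_idcot : measurable_fun setT idcot.
Proof. by rewrite /idcot; meas. Qed.

Lemma integral_ln_den2 (r : R) : 0 < r < pi ->
  (\int[mu]_(q in `[0%R, r]) \int[mu]_(p in `[0%R, r]) (ln (den r p q))%:E =
   \int[mu]_(t in `[0%R, r]) ((r - t - t) * (idcot t - idcot (r - t)))%:E)%E.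
Proof.
move=> rp; have /andP[r0 rpi] := rp.
have mDq : measurable_fun [set: R * R] (fun z => Dq r z.2 z.1).
  by rewrite /Dq /den /phi; meas.
transitivity (\int[mu]_(q in `[0%R, r]) \int[mu]_(p in `[0%R, r]) ((r / 2 - p) * Dq r p q)%:E)%E.
  apply: eq_integral => q; rewrite inE => qr.
  have [i1 i2 E] := integral_ln_den rp qr.
  by rewrite !EFin_Rintegral// E.
rewrite (@ge0_fubini_set R _ _ (fun q p => ((r / 2 - p) * Dq r p q)%:E))//; last 2 first.
- by apply/measurable_EFinP/measurable_funM => //; meas.
- move=> q p qr pr; rewrite lee_fin /Dq.
  have -> (a x y z w : R) : a * (x * y * z / w) = x * z / w * (a * y) by ring.
  have a0 : 0 <= 4 / sin r ^+ 2 by rewrite divr_ge0 ?sqr_ge0.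
  have f0 : 0 <= phi r q by exact: phi_ge0.
  have d0 : 0 <= den r p q by rewrite (le_trans ler01)// den_ge1.
  rewrite mulr_ge0//; first by rewrite divr_ge0// mulr_ge0.
  move: pr; rewrite /= in_itv/= => /andP[p0 pr].
  have [up|un] := leP 0 (r - p - p).
    by rewrite mulr_ge0//; [lra|apply: sin_ge0_pi; apply/andP; split; lra].
  rewrite -mulrNN -sinN mulr_ge0//; [lra|apply: sin_ge0_pi; apply/andP; split; lra].
apply: ae_eq_integral => //.
- apply: measurable_funTS.
  apply: (@measurable_integral_param R _ (fun p q => ((r / 2 - p) * Dq r p q)%:E)) => //.
  apply/measurable_EFinP/measurable_funM => //; first by meas.
  by rewrite /Dq /den /phi; meas.
- by apply/measurable_EFinP/measurable_funTS; rewrite /idcot; meas.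
have := aeI (@ae_sin_neq0 R 1 0 (oner_neq0 _)) (@ae_sin_neq0 R 1 (- r) (oner_neq0 _)).
apply: aeS => t; rewrite mul1r addr0 => -[st srt] /=; rewrite in_itv/= => /andP[t0 tr].
have tr' : t \in `]0, r[.
  rewrite in_itv/= !lt_neqAle t0 tr !andbT; apply/andP; split.
    by apply: contra_neq st => <-; rewrite sin0.
  by apply: contra_neq srt => ->; rewrite subrr sin0.
have [iD ID] := integral_Dq rp tr'.
rewrite EFin_Rintegral//; last exact: integrableZR.
by congr EFin; rewrite RintegralZl// ID; field.
Qed.

End triangle_integral.

(** * The integral of [p cot p (pi - p)(pi - 3p)] as a multiple of [zeta 3] *)

Section zeta3.
Context {R : realType}.
Local Notation mu := (@lebesgue_measure R).

(* The continuous extension of [p (pi - p) / sin p] to [[0, pi]]. *)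
Definition parab_sin (p : R) : R := if (p == 0) || (p == pi) then pi else p * (pi - p) / sin p.

Lemma parab_sin_sym (p : R) : parab_sin (pi - p) = parab_sin p.
Proof.
rewrite /parab_sin subr_eq0 -[X in _ || X]subr_eq0 addrAC subrr add0r oppr_eq0 orbC (eq_sym pi).
case: ifP => // _; rewrite opprB addrCA subrr addr0 (mulrC (pi - p)).
by rewrite sinB sinpi cospi mul0r sub0r mulN1r opprK.
Qed.

Lemma parab_sin_in (p : R) : p \in `]0, pi[ -> parab_sin p = p * (pi - p) / sin p.
Proof. by rewrite in_itv/= => /andP[p0 ppi]; rewrite /parab_sin gt_eqF// lt_eqF. Qed.

Lemma cvg_sin_div : sin h / h @[h --> (0 : R)^'+] --> (1 : R).
Proof.
apply: cvg_dnbhs_at_right.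
have /cvg_ex[l hl] := @derivable_sin R 0.
have E : (fun h : R => sin h / h) =
    (fun h => h^-1 *: ((@sin R \o shift 0) (h *: 1) - sin 0)).
  by apply/funext => h; rewrite /= addr0 sin0 subr0 /GRing.scale/= mulr1 mulrC.
have l1 : l = 1.
  by have [_] := @is_derive_sin R 0; rewrite cos0 => <-; apply/esym/cvg_lim.
by rewrite E -[X in _ --> X]l1.
Qed.

Lemma continuous_parab_sin : {within `[0, pi], continuous parab_sin}.
Proof.
have p0 := pi_gt0 R.
have cv0 : parab_sin p @[p --> (0 : R)^'+] --> parab_sin 0.
  have -> : parab_sin 0 = (pi - 0) * 1^-1 by rewrite /parab_sin eqxx subr0 invr1 mulr1.
  apply: (@cvg_trans _ ((pi - h) * (sin h / h)^-1 @[h --> (0 : R)^'+])).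
    apply: near_eq_cvg; near=> h.
    rewrite parab_sin_in ?in_itv/=; last by apply/andP; split; near: h; [exact: nbhs_right_gt|exact: nbhs_right_lt].
    by rewrite invfM invrK [LHS]mulrA [LHS]mulrC mulrA.
  apply: cvgM; first by apply: cvgB; [exact: cvg_cst|exact: cvg_at_right_filter].
  by apply: cvgV; [exact: oner_neq0|exact: cvg_sin_div].
apply/continuous_within_itvP => //; split => //.
- move=> p pin; have pin' := pin; move: pin'; rewrite in_itv/= => /andP[pp ppi].
  rewrite /continuous_at parab_sin_in//.
  have cvx : x * (pi - x) / sin x @[x --> p] --> p * (pi - p) / sin p.
    apply: cvgM; last by apply: cvgV; [rewrite gt_eqF// sin_gt0_pi// pp|exact: continuous_sin].
    by apply: cvgM; [exact: cvg_id|apply: cvgB; [exact: cvg_cst|exact: cvg_id]].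
  apply: cvg_trans cvx; apply: near_eq_cvg; near=> h.
  rewrite parab_sin_in// in_itv/=; apply/andP; split; near: h; first exact: lt_nbhsr.
  exact: lt_nbhsl.
(* Continuity at [pi] is transported from [0] by the symmetry [p -> pi - p]. *)
- have -> : parab_sin = parab_sin \o (fun p => pi - p) by apply/funext => p; rewrite /= parab_sin_sym.
  rewrite /= subrr; apply: (cvg_comp _ _ _ cv0).
  move=> P [e /= e0 He]; exists e => // p /= pe plt; apply: He => /=; last by rewrite subr_gt0.
  by rewrite sub0r opprB distrC.
Unshelve. all: by end_near. Qed.

Lemma parab_sin_ge0 (p : R) : p \in `[0, pi] -> 0 <= parab_sin p.
Proof.
rewrite in_itv/= => /andP[p0 ppi]; rewrite /parab_sin; case: ifP => _; first exact: pi_ge0.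
by rewrite divr_ge0 ?mulr_ge0 ?subr_ge0// sin_ge0_pi// p0.
Qed.

Lemma parab_sin_bounded : exists B : R, 0 <= B /\ forall p, p \in `[0, pi] -> parab_sin p <= B.
Proof.
have [c cin cB] := EVT_max (pi_ge0 R) continuous_parab_sin.
by exists (parab_sin c); split=> [|p pin]; [exact: parab_sin_ge0|exact: cB].
Qed.

Lemma measurable_parab_sin : measurable_fun setT parab_sin.
Proof.
apply: measurable_fun_if => //.
- apply: measurable_or; exact: measurable_fun_eqr.
- apply: measurable_funTS; apply: measurable_funM; last first.
    by apply: measurableT_comp; [exact: measurable_invr|exact: measurable_sin].
  by apply: measurable_funM => //; exact: measurable_funB.
Qed.

(** Telescoping: [cos ((2M+1)p) - cos ((2M+3)p) = 2 sin ((2M+2)p) sin p]. *)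
Lemma dirichlet_kernel (p : R) (M : nat) : sin p != 0 ->
  cos p / sin p = 2 * (\sum_(j < M) sin (2 * j.+1%:R * p)) + cos (2 * M%:R * p + p) / sin p.
Proof.
move=> sp; elim: M => [|M IHM]; first by rewrite big_ord0 !mulr0 mul0r !add0r.
rewrite big_ord_recr/= mulrDr -addrA IHM; congr (_ + _).
apply: (mulIf sp); rewrite [RHS]mulrDl !divfK//.
have -> : 2 * M.+1%:R * p + p = (2 * M%:R * p + p) + (p + p) by rewrite -[M.+1%:R]natr1; ring.
have -> : 2 * M.+1%:R * p = (2 * M%:R * p + p) + p by rewrite -[M.+1%:R]natr1; ring.
move: (2 * M%:R * p + p) => a.
rewrite !cosD !sinD; have := cos2sin2 p => h; ring: h.
Qed.

(** Three integrations by parts. The cubic vanishes at [0] and [pi], and so does [sin (m p)], so the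
    second derivative [g2] alone contributes: [(g2 pi - g2 0) / m^3 = 18 pi / m^3], with
    [m = 2 (n + 1)]. This is the source of the exponent 3. *)
Lemma integral_cubic_sin (n : nat) :
  mu.-integrable `[0, pi] (EFin \o (fun p => p * (pi - p) * (pi - 3 * p) * sin (2 * n.+1%:R * p))) /\
  \int[mu]_(p in `[0, pi]) (p * (pi - p) * (pi - 3 * p) * sin (2 * n.+1%:R * p)) =
  9 * pi / 4 / n.+1%:R ^+ 3.
Proof.
set m := 2 * n.+1%:R; have m0 : m != 0 by rewrite mulf_neq0// pnatr_eq0.
have sm : sin (m * pi) = 0.
  rewrite /m; elim: n {m m0} => [|n IHn]; first by rewrite mulr1 mulr_natl sin2pi.
  by rewrite (_ : _ * pi = 2 * n.+1%:R * pi + pi *+ 2) ?sinD2pi// -[n.+2%:R]natr1; ring.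
have cm : cos (m * pi) = 1.
  rewrite /m; elim: n {m m0 sm} => [|n IHn]; first by rewrite mulr1 mulr_natl cos2pi.
  by rewrite (_ : _ * pi = 2 * n.+1%:R * pi + pi *+ 2) ?cosD2pi// -[n.+2%:R]natr1; ring.
pose g (p : R) : R := p * (pi - p) * (pi - 3 * p).
pose g1 (p : R) : R := pi ^+ 2 - 8 * pi * p + 9 * p ^+ 2.
pose g2 (p : R) : R := - (8 * pi) + 18 * p.
pose F (p : R) : R := (- m^-1) * (g p * cos (m * p)) + m ^- 2 * (g1 p * sin (m * p))
  + m ^- 3 * (g2 p * cos (m * p)) - 18 * m ^- 4 * sin (m * p).
have lin (p : R) : is_derive p 1 (fun p : R => m * p) m.
  by have := is_deriveZ m (is_derive_id p (1 : R)); rewrite /GRing.scale/= mulr1.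
have [||i ->] := @FTC_derive R (fun p => p * (pi - p) * (pi - 3 * p) * sin (m * p)) F 0 pi (pi_gt0 R).
- move=> p _; apply: cvgM; last first.
    apply: (@continuous_comp _ _ _ (fun p => m * p) (@sin R)); last exact: continuous_sin.
    by apply: cvgM; [exact: cvg_cst|exact: cvg_id].
  apply: cvgM; first by apply: cvgM; [exact: cvg_id|apply: cvgB; [exact: cvg_cst|exact: cvg_id]].
  by apply: cvgB; [exact: cvg_cst|apply: cvgM; [exact: cvg_cst|exact: cvg_id]].
- move=> p _.
  have ds : is_derive p 1 (fun p : R => sin (m * p)) (cos (m * p) * m).
    exact: (@is_derive1_comp _ sin (fun p => m * p) p _ _ (is_derive_sin (m * p)) (lin p)).
  have dc : is_derive p 1 (fun p : R => cos (m * p)) (- sin (m * p) * m).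
    exact: (@is_derive1_comp _ cos (fun p => m * p) p _ _ (is_derive_cos (m * p)) (lin p)).
  have dg : is_derive p 1 g (g1 p).
    rewrite /g; apply: is_derive_eq; rewrite /g1 /GRing.scale/=; ring.
  have dg1 : is_derive p 1 g1 (g2 p).
    by rewrite /g1; apply: is_derive_eq; rewrite /g2 /GRing.scale/=; ring.
  have dg2 : is_derive p 1 g2 18.
    by rewrite /g2; apply: is_derive_eq; rewrite /GRing.scale/=; ring.
  have dF := is_deriveB (is_deriveD (is_deriveD (is_deriveZ (- m^-1) (is_deriveM dg dc))
    (is_deriveZ (m ^- 2) (is_deriveM dg1 ds))) (is_deriveZ (m ^- 3) (is_deriveM dg2 dc)))
    (is_deriveZ (18 * m ^- 4) ds).
  apply: (is_derive_eq dF).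
  rewrite /GRing.scale/= /g; move: (sin (m * p)) (cos (m * p)) => sn cn.
  by rewrite /g1 /g2; field.
split => //.
rewrite /F /g /g1 /g2 !mulr0 sin0 cos0 sm cm /m.
have n0 : (n.+1%:R : R) != 0 by rewrite pnatr_eq0.
by field.
Qed.

(** Cut off outside [[0, pi]] to be bounded on the whole line: [equidistribution] asks for
    nonnegativity at all points, obtained below by adding a constant. *)
Definition parab_sin_lin (p : R) : R := if p \in `[0, pi] then parab_sin p * (pi - 3 * p) else 0.

Lemma measurable_parab_sin_lin : measurable_fun setT parab_sin_lin.
Proof.
have m1 : measurable_fun setT (fun p => parab_sin p * (pi - 3 * p)).
  apply: measurable_funM; first exact: measurable_parab_sin.
  by apply: measurable_funB => //; exact: measurable_funM.
rewrite (_ : parab_sin_lin = (fun p => parab_sin p * (pi - 3 * p)) \_ `[0, pi]); last first.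
  by apply/funext => p; rewrite /parab_sin_lin patchE mem_setE.
by apply/(measurable_restrictT _ _).1 => //; exact: measurable_funTS.
Qed.

Lemma parab_sin_lin_bounded : exists C : R, forall p, `|parab_sin_lin p| <= C.
Proof.
have [B [B0 SB]] := parab_sin_bounded; have p0 := pi_ge0 R.
exists (B * (2 * pi)) => p; rewrite /parab_sin_lin; case: ifPn => [pin|_]; last first.
  by rewrite normr0 !mulr_ge0.
have pin' := pin; move: pin'; rewrite in_itv/= => /andP[? ?].
rewrite normrM; apply: ler_pM => //.
  by rewrite ger0_norm; [exact: SB|exact: parab_sin_ge0].
by rewrite ler_norml; apply/andP; split; lra.
Qed.

Lemma continuous_parab_sin_lin : {within `[0, pi], continuous parab_sin_lin}.
Proof.
have h : {within `[0, pi], continuous (fun p => parab_sin p * (pi - 3 * p))}.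
  move=> p; apply: cvgM; first exact: continuous_parab_sin.
  apply: cvgB; first exact: cvg_cst.
  apply: cvgM; first exact: cvg_cst.
  exact: (@continuous_subspaceT _ _ _ (fun x : R => x) (fun x => cvg_id) p).
apply: subspace_eq_continuous h => p /=; rewrite inE => pin.
have pin' : p \in `[0, pi] by [].
by rewrite /from_subspace /parab_sin_lin pin'.
Qed.

Lemma integrable_parab_sin_linM (f : R -> R) : continuous f -> (forall x, `|f x| <= 1) ->
  mu.-integrable `[0, pi] (EFin \o (fun p => parab_sin_lin p * f p)).
Proof.
move=> cf f1; have [C kC] := parab_sin_lin_bounded; apply: (@integrable_bounded _ _ _ C).
  by apply: measurable_funM; [exact: measurable_parab_sin_lin|exact: continuous_measurable_fun].
move=> p _; rewrite normrM -[leRHS]mulr1 ler_pM//.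
Qed.

Lemma continuous_affine (a b : R) : continuous (fun x : R => a * x + b).
Proof.
by move=> x; apply: cvgD; [apply: cvgM; [exact: cvg_cst|exact: cvg_id]|exact: cvg_cst].
Qed.

Lemma continuous_cos_affine (a b : R) : continuous (fun x : R => cos (a * x + b)).
Proof.
move=> x; apply: (@continuous_comp _ _ _ (fun x => a * x + b) (@cos R)).
  exact: continuous_affine.
exact: continuous_cos.
Qed.

Lemma continuous_sin_affine (a b : R) : continuous (fun x : R => sin (a * x + b)).
Proof.
move=> x; apply: (@continuous_comp _ _ _ (fun x => a * x + b) (@sin R)).
  exact: continuous_affine.
exact: continuous_sin.
Qed.

Lemma continuous_cosZ (a : R) : continuous (fun x : R => cos (a * x)).
Proof. by have := @continuous_cos_affine a 0; under eq_fun do rewrite addr0. Qed.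

Lemma continuous_sinZ (a : R) : continuous (fun x : R => sin (a * x)).
Proof. by have := @continuous_sin_affine a 0; under eq_fun do rewrite addr0. Qed.

Lemma Rintegral_cos2 : \int[mu]_(y in `[0, pi]) cos (2 * y) = 0 :> R.
Proof.
have [||_ ->] := @FTC_derive R (fun y => cos (2 * y)) (fun y => 2^-1 * sin (2 * y)) 0 pi (pi_gt0 R).
- by move=> p _; exact: continuous_cosZ.
- move=> p _; have lin : is_derive p 1 (fun p : R => 2 * p) 2.
    by have := is_deriveZ (2 : R) (is_derive_id p (1 : R)); rewrite /GRing.scale/= mulr1.
  have ds := is_deriveZ (2^-1 : R)
    (@is_derive1_comp _ sin (fun p => 2 * p) p _ _ (is_derive_sin (2 * p)) lin).
  by apply: (is_derive_eq ds); rewrite /GRing.scale/=; field.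
by rewrite mulr0 sin0 mulr_natl sin2pi mulr0 subrr.
Qed.

Lemma Rintegral_sin2 : \int[mu]_(y in `[0, pi]) sin (2 * y) = 0 :> R.
Proof.
have [||_ ->] := @FTC_derive R (fun y => sin (2 * y)) (fun y => - 2^-1 * cos (2 * y)) 0 pi (pi_gt0 R).
- by move=> p _; exact: continuous_sinZ.
- move=> p _; have lin : is_derive p 1 (fun p : R => 2 * p) 2.
    by have := is_deriveZ (2 : R) (is_derive_id p (1 : R)); rewrite /GRing.scale/= mulr1.
  have ds := is_deriveZ (- 2^-1 : R)
    (@is_derive1_comp _ cos (fun p => 2 * p) p _ _ (is_derive_cos (2 * p)) lin).
  by apply: (is_derive_eq ds); rewrite /GRing.scale/=; field.
by rewrite mulr0 cos0 mulr_natl cos2pi subrr.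
Qed.

(** [equidistribution] applied to [parab_sin_lin x * cos (2y + x) + C] at [y = (n + 1) x]. In the
    limit [y] is independent of [x], and [cos (2y + x)] has mean 0 in [y]. The constant [C] provides
    the sign and is removed at the end. *)
Lemma parab_sin_lin_riemann_lebesgue :
  \int[mu]_(p in `[0, pi]) (parab_sin_lin p * cos (2 * n.+1%:R * p + p)) @[n --> \oo] --> (0 : R).
Proof.
have [C kC] := parab_sin_lin_bounded; have p0 := pi_gt0 R; have p0' := pi_ge0 R.
have C0 : 0 <= C by exact: le_trans (normr_ge0 _) (kC 0).
pose g (x y : R) := parab_sin_lin x * cos (2 * y + x) + C.
have gb x y : `|parab_sin_lin x * cos (2 * y + x)| <= C.
  by rewrite normrM -[leRHS]mulr1 ler_pM// cos_max.
have mg : measurable_fun [set: R * R] (fun z => g z.1 z.2).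
  apply: measurable_funD => //; apply: measurable_funM.
    by apply: measurableT_comp => //; exact: measurable_parab_sin_lin.
  apply: measurableT_comp; first exact: measurable_cos.
  by apply: measurable_funD => //; exact: measurable_funM.
have g0 x y : 0 <= g x y by have := gb x y; rewrite ler_norml /g => /andP[h _]; lra.
have pg x y : g x (y + pi) = g x y.
  rewrite /g (_ : 2 * (y + pi) + x = 2 * y + x + pi *+ 2) ?cosD2pi//; ring.
have ag : {ae mu, forall y : R, y \in `[0, pi] -> {within `[0, pi], continuous (g ^~ y)} /\
     forall x : R, x \in `[0, pi] -> g x y <= C + C}.
  apply: aeW => y _; split; last first.
    by move=> x _; have := gb x y; rewrite ler_norml /g => /andP[_ h]; lra.
  move=> x; apply: cvgD; last exact: cvg_cst.
  apply: cvgM; first exact: continuous_parab_sin_lin.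
  have c1 : continuous (fun x : R => cos (2 * y + x)).
    have := @continuous_cos_affine 1 (2 * y).
    by under eq_fun do rewrite mul1r addrC.
  exact: (@continuous_subspaceT _ _ _ _ c1 x).
have := @equidistribution R pi g (fun=> C + C) p0 mg g0 pg (integrable_cstR 0 pi _) ag.
have ik f : continuous f -> (forall x, `|f x| <= 1) ->
    mu.-integrable `[0, pi] (EFin \o (fun p => parab_sin_lin p * f p)) by exact: integrable_parab_sin_linM.
have cc1 : continuous (@cos R) by exact: continuous_cos.
have cs1 : continuous (@sin R) by exact: continuous_sin.
have ia := ik _ cc1 (@cos_max R); have ib := ik _ cs1 (@sin_max R).
pose a := \int[mu]_(x in `[0, pi]) (parab_sin_lin x * cos x).
pose b := \int[mu]_(x in `[0, pi]) (parab_sin_lin x * sin x).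
have inner y : \int[mu]_(x in `[0, pi]) g x y = cos (2 * y) * a - sin (2 * y) * b + C * pi.
  transitivity (\int[mu]_(x in `[0, pi])
      (cos (2 * y) * (parab_sin_lin x * cos x) - sin (2 * y) * (parab_sin_lin x * sin x) + C)).
    by apply: eq_Rintegral => x _; rewrite /g cosD; ring.
  rewrite RintegralD//; last 2 first.
  - by apply: integrableBR => //; exact: integrableZR.
  - exact: integrable_cstR.
  by rewrite RintegralB ?RintegralZl ?Rintegral_cstR ?subr0//; exact: integrableZR.
have c2 : continuous (fun y : R => cos (2 * y)).
  exact: continuous_cosZ.
have s2 : continuous (fun y : R => sin (2 * y)) by exact: continuous_sinZ.
have ic2 : mu.-integrable `[0, pi] (EFin \o (fun y => cos (2 * y))).
  apply: (@integrable_bounded _ _ _ 1); first exact: continuous_measurable_fun.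
  by move=> x _; exact: cos_max.
have is2 : mu.-integrable `[0, pi] (EFin \o (fun y => sin (2 * y))).
  apply: (@integrable_bounded _ _ _ 1); first exact: continuous_measurable_fun.
  by move=> x _; exact: sin_max.
have -> : (\int[mu]_(y in `[0%R, pi]) (pi^-1 * \int[mu]_(x in `[0%R, pi]) g x y)%:E =
    (C * pi)%:E)%E.
  transitivity (\int[mu]_(y in `[0%R, pi])
      ((pi^-1 * a) * cos (2 * y) - (pi^-1 * b) * sin (2 * y) + C)%:E)%E.
    apply: eq_integral => y _; rewrite inner; congr EFin.
    have : (pi : R) != 0 by rewrite gt_eqF.
    by move: (pi : R) => q q0; field.
  have i1 : mu.-integrable `[0, pi]
      (EFin \o (fun y => (pi^-1 * a) * cos (2 * y) - (pi^-1 * b) * sin (2 * y))).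
    by apply: integrableBR => //; exact: integrableZR.
  rewrite EFin_Rintegral//; last by apply: integrableDR => //; exact: integrable_cstR.
  rewrite RintegralD//; last exact: integrable_cstR.
  rewrite RintegralB ?RintegralZl ?Rintegral_cstR//; try exact: integrableZR.
  by rewrite Rintegral_cos2 Rintegral_sin2 !mulr0 subrr add0r subr0.
have icn n : mu.-integrable `[0, pi] (EFin \o (fun p => parab_sin_lin p * cos (2 * n.+1%:R * p + p))).
  apply: ik; last by move=> x; exact: cos_max.
  have := @continuous_cos_affine (2 * n.+1%:R + 1) 0.
  by under eq_fun do rewrite addr0 mulrDl mul1r.
have IE n : (\int[mu]_(x in `[0%R, pi]) (g x (n.+1%:R * x)%R)%:E =
    (\int[mu]_(p in `[0, pi]) (parab_sin_lin p * cos (2 * n.+1%:R * p + p)) + C * pi)%:E)%E.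
  rewrite /g; under eq_integral do rewrite mulrA.
  rewrite EFin_Rintegral//; last by apply: integrableDR => //; exact: integrable_cstR.
  by rewrite RintegralD ?Rintegral_cstR ?subr0//; exact: integrable_cstR.
under eq_fun do rewrite IE.
move=> /fine_cvgP[_ cv].
pose I n := \int[mu]_(p in `[0, pi]) (parab_sin_lin p * cos (2 * n.+1%:R * p + p)).
have cv1 : I n + C * pi @[n --> \oo] --> C * pi by exact: cv.
have -> : (fun n => \int[mu]_(p in `[0, pi]) (parab_sin_lin p * cos (2 * n.+1%:R * p + p))) =
    (fun n => I n + C * pi - C * pi) by apply/funext => n; rewrite addrK.
by have cv2 := cvgB cv1 (cvg_cst (C * pi)); rewrite subrr in cv2; exact: cv2.
Qed.

(** Multiply the Dirichlet kernel expansion of [cot p] by the cubic: [V] is a partial sum of the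
    zeta series, up to a constant, plus an oscillating remainder. The cubic cancels the pole of
    [1 / sin p] at both ends, so the remainder has a bounded coefficient. *)
Lemma Rintegral_zeta3 :
  \int[mu]_(p in `[0, pi]) (idcot p * ((pi - p) * (pi - 3 * p))) = 9 * pi / 2 * zeta (3 : R).
Proof.
set V := LHS; have p0 := pi_gt0 R; have p1 : (pi : R) != 0 by rewrite gt_eqF.
have step n : V = \sum_(j < n.+1) (9 * pi / 2 * riemannR 3 j) +
    \int[mu]_(p in `[0, pi]) (parab_sin_lin p * cos (2 * n.+1%:R * p + p)).
  have icn : mu.-integrable `[0, pi] (EFin \o (fun p => parab_sin_lin p * cos (2 * n.+1%:R * p + p))).
    apply: integrable_parab_sin_linM; last by move=> x; exact: cos_max.
    have := @continuous_cos_affine (2 * n.+1%:R + 1) 0.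
    by under eq_fun do rewrite addr0 mulrDl mul1r.
  have isum m : mu.-integrable `[0, pi] (EFin \o (fun p => \sum_(j < m)
        2 * (p * (pi - p) * (pi - 3 * p) * sin (2 * j.+1%:R * p)))) /\
      \int[mu]_(p in `[0, pi]) (\sum_(j < m)
        2 * (p * (pi - p) * (pi - 3 * p) * sin (2 * j.+1%:R * p))) =
      \sum_(j < m) (9 * pi / 2 * riemannR 3 j).
    elim: m => [|m [IH1 IH2]].
      split.
        rewrite (_ : (fun p => _) = fun=> 0); first exact: integrable_cstR.
        by apply/funext => p; rewrite big_ord0.
      rewrite [RHS]big_ord0.
      transitivity (\int[mu]_(p in `[0, pi]) (0 : R)).
        by apply: eq_Rintegral => p _; rewrite big_ord0.
      by rewrite Rintegral_cstR ?mul0r// ltW.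
    have [jc jcE] := integral_cubic_sin m.
    have jc2 := integrableZR 2 (measurable_itv _) jc.
    split.
      rewrite (_ : (fun p => _) = (fun p => (\sum_(j < m)
        2 * (p * (pi - p) * (pi - 3 * p) * sin (2 * j.+1%:R * p))) +
        2 * (p * (pi - p) * (pi - 3 * p) * sin (2 * m.+1%:R * p)))); first exact: integrableDR.
      by apply/funext => p; rewrite big_ord_recr.
    transitivity (\int[mu]_(p in `[0, pi]) ((\sum_(j < m)
        2 * (p * (pi - p) * (pi - 3 * p) * sin (2 * j.+1%:R * p))) +
        2 * (p * (pi - p) * (pi - 3 * p) * sin (2 * m.+1%:R * p)))).
      by apply: eq_Rintegral => p _; rewrite big_ord_recr.
    rewrite RintegralD// IH2 RintegralZl// jcE big_ord_recr/=; congr (_ + _).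
    rewrite /riemannR powR_mulrn//; have m0 : (m.+1%:R : R) != 0 by rewrite pnatr_eq0.
    by field.
  have [is1 <-] := isum n.+1.
  rewrite -RintegralD//; rewrite /V /Rintegral; congr fine; apply: ae_eq_integral => //.
  - apply/measurable_EFinP/measurable_funTS/measurable_funM; first exact: measurable_idcot.
    by apply: measurable_funM; apply: measurable_funB => //; exact: measurable_funM.
  - by have /integrableP[] := integrableDR (measurable_itv _) is1 icn.
  have := @ae_sin_neq0 R 1 0 (oner_neq0 _); apply: aeS => p.
  rewrite mul1r addr0 => sp /=; rewrite in_itv/= => /andP[pp ppi].
  have pin : p \in `]0, pi[.
    rewrite in_itv/= !lt_neqAle pp ppi !andbT; apply/andP; split.
      by apply: contra_neq sp => <-; rewrite sin0.
    by apply: contra_neq sp => ->; rewrite sinpi.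
  congr EFin; rewrite /parab_sin_lin (subset_itv_oo_cc pin) parab_sin_in// -!mulr_sumr.
  rewrite -[X in _ * X = _]mulr1 /idcot.
  have := dirichlet_kernel n.+1 sp; set Sg := \sum_(j < n.+1) _ => dk.
  transitivity (p * (pi - p) * (pi - 3 * p) * (cos p / sin p)); first by ring.
  rewrite dk; ring.
(* Convergence of the zeta series comes out of the identity [step], since the remainder tends to
   0. *)
have cv : series (riemannR (3 : R)) n @[n --> \oo] --> V / (9 * pi / 2).
  rewrite -cvg_shiftS.
  have E n : series (riemannR (3 : R)) n.+1 = (V -
      \int[mu]_(p in `[0, pi]) (parab_sin_lin p * cos (2 * n.+1%:R * p + p))) / (9 * pi / 2).
    rewrite (step n) addrK -mulr_sumr mulrC mulKf; first by rewrite /series/= big_mkord.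
    by rewrite !mulf_neq0// ?invr_eq0 ?pnatr_eq0.
  under eq_fun do rewrite E.
  apply: cvgM; last exact: cvg_cst.
  rewrite -[X in _ --> X]subr0; apply: cvgB; first exact: cvg_cst.
  exact: parab_sin_lin_riemann_lebesgue.
rewrite /zeta (cvg_lim _ cv)// mulrC divfK//.
by rewrite !mulf_neq0// ?invr_eq0 ?pnatr_eq0.
Qed.

End zeta3.

(** * Assembling the excess and the value of the limit *)

Section limit_value.
Context {R : realType}.
Local Notation mu := (@lebesgue_measure R).

Lemma integral_reflect0 (c : R) (f : R -> \bar R) : measurable_fun setT f ->
  (\int[mu]_(x in `[0%R, c]) f (c - x)%R = \int[mu]_(x in `[0%R, c]) f x)%E.
Proof.
move=> mf.
have h g : measurable_fun setT g -> (forall x, 0 <= g x)%E ->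
    (\int[mu]_(x in `[0%R, c]) g (c - x)%R = \int[mu]_(x in `[0%R, c]) g x)%E.
  by move=> mg g0; have := @ge0_integral_reflect R c 0 c g mg g0; rewrite subrr subr0 => ->.
rewrite integralE [RHS]integralE; congr (_ - _)%E.
  rewrite -(h (f^\+)%E (measurable_funepos mf))//.
  by apply: eq_integral => x _; rewrite !funeposE.
rewrite -(h (f^\-)%E (measurable_funeneg mf))//.
by apply: eq_integral => x _; rewrite !funenegE.
Qed.

Lemma ae_itv_oo : {ae mu, forall r : R, `[0, pi]%classic r -> r \in `]0, pi[}.
Proof.
have := @ae_sin_neq0 R 1 0 (oner_neq0 _); apply: aeS => p.
rewrite mul1r addr0 => sp /=; rewrite !in_itv/= => /andP[pp ppi].
rewrite !lt_neqAle pp ppi !andbT; apply/andP; split.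
  by apply: contra_neq sp => <-; rewrite sin0.
by apply: contra_neq sp => ->; rewrite sinpi.
Qed.

Lemma ae_itv_eq (f g : R -> \bar R) : measurable_fun setT f -> measurable_fun setT g ->
  {in `]0, pi[, f =1 g} ->
  (\int[mu]_(x in `[0%R, pi]) f x = \int[mu]_(x in `[0%R, pi]) g x)%E.
Proof.
move=> mf mg fg; apply: ae_eq_integral => //; try exact: measurable_funTS.
by apply: aeS ae_itv_oo => x h /h; exact: fg.
Qed.

(** The pole of [t cot t] at [pi] is compensated by [pi - t], since the product is
    [parab_sin t * cos t] in the interior. This provides the bounds for integrability over [[0, r]]
    and for Fubini. *)
Lemma idcot_bounded :
  exists B : R, 0 <= B /\ forall t, t \in `[0, pi] -> `|idcot t| * (pi - t) <= B.
Proof.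
have [B [B0 SB]] := @parab_sin_bounded R; exists B; split => // t tin.
have tin' := tin; move: tin'; rewrite in_itv/= => /andP[t0 tpi].
have [->|tn0] := eqVneq t 0; first by rewrite /idcot !mul0r normr0 mul0r.
have [->|tnp] := eqVneq t pi; first by rewrite subrr mulr0.
have toi : t \in `]0, pi[ by rewrite in_itv/= !lt_neqAle t0 tpi tnp eq_sym tn0.
have st : 0 < sin t by apply: sin_gt0_pi; move: toi; rewrite in_itv.
apply: (le_trans _ (SB t tin)); rewrite parab_sin_in// /idcot.
rewrite !normrM (ger0_norm t0) normfV (gtr0_norm st).
have -> : t * `|cos t| / sin t * (pi - t) = t * (pi - t) / sin t * `|cos t| by ring.
rewrite ler_piMr ?cos_max// divr_ge0 ?(ltW st)// mulr_ge0// subr_ge0//.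
Qed.

Definition idcot_lin (r t : R) : R := (r - t - t) * idcot t.

Lemma idcot_lin_reflect (r t : R) : idcot_lin r (r - t) = - ((r - t - t) * idcot (r - t)).
Proof. by rewrite /idcot_lin; ring. Qed.

Lemma integrable_idcot_lin (r : R) : 0 < r < pi ->
  mu.-integrable `[0, r] (EFin \o idcot_lin r) /\
  mu.-integrable `[0, r] (EFin \o (fun t => idcot_lin r (r - t))).
Proof.
move=> /andP[r0 rpi]; have [B [B0 HB]] := idcot_bounded.
have bd t : t \in `[0, r] -> `|idcot_lin r t| <= r * (B / (pi - r)).
  rewrite in_itv/= => /andP[t0 tr]; rewrite normrM ler_pM//.
    by rewrite ler_norml; apply/andP; split; lra.
  rewrite ler_pdivlMr ?subr_gt0//; apply: le_trans (HB t _); last first.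
    by rewrite in_itv/= t0 (le_trans tr (ltW rpi)).
  by rewrite ler_wpM2l// lerD2l lerN2.
split; apply: (@integrable_bounded _ _ _ (r * (B / (pi - r)))).
- by rewrite /idcot_lin /idcot; meas.
- by move=> t /bd.
- by rewrite /idcot_lin /idcot; meas.
- move=> t; rewrite in_itv/= => /andP[t0 tr]; apply: bd.
  by rewrite in_itv/=; apply/andP; split; lra.
Qed.

(** The reflection [t -> r - t] changes the sign of [r - 2t], so the term with [idcot (r - t)]
    contributes as much as the one with [idcot t]. *)
Lemma integral_ln_den_idcot_lin (r : R) : 0 < r < pi ->
  (\int[mu]_(q in `[0%R, r]) \int[mu]_(p in `[0%R, r]) (ln (den r p q))%:E =
   \int[mu]_(t in `[0%R, r]) (2 * idcot_lin r t)%:E)%E.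
Proof.
move=> rp; have [i1 i2] := integrable_idcot_lin rp; rewrite integral_ln_den2//.
transitivity (\int[mu]_(t in `[0%R, r]) (idcot_lin r t + idcot_lin r (r - t)%R)%:E)%E.
  by apply: eq_integral => t _; rewrite idcot_lin_reflect /idcot_lin; congr EFin; ring.
have mh : measurable_fun setT (EFin \o idcot_lin r) by apply/measurable_EFinP; rewrite /idcot_lin /idcot; meas.
have := integral_reflect0 r mh; rewrite !EFin_Rintegral//; last 2 first.
- exact: integrableZR.
- exact: integrableDR.
by move=> -[E]; congr EFin; rewrite RintegralD// RintegralZl// E; ring.
Qed.

Lemma integral_if_ge (t : R) (h : R -> R) : 0 <= t ->
  (\int[mu]_(r in `[0%R, pi]) (if (t <= r)%R then h r else 0%R)%:E =
   \int[mu]_(r in `[t, pi]) (h r)%:E)%E.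
Proof.
move=> t0; rewrite integral_mkcond [RHS]integral_mkcond; apply: eq_integral => r _.
rewrite !patchE !mem_setE !in_itv/=; have [tr|] := leP t r; last by case: ifP.
by rewrite (le_trans t0 tr).
Qed.

Lemma integral_if_le (r : R) (h : R -> R) : r <= pi ->
  (\int[mu]_(t in `[0%R, pi]) (if (t <= r)%R then h t else 0%R)%:E =
   \int[mu]_(t in `[0%R, r]) (h t)%:E)%E.
Proof.
move=> rpi; rewrite integral_mkcond [RHS]integral_mkcond; apply: eq_integral => t _.
rewrite !patchE !mem_setE !in_itv/=; have [tr|_] := leP t r; last by rewrite andbF; case: ifP.
by rewrite (le_trans tr rpi).
Qed.

(** A primitive of [2 (r - 2t)] in [r] is [r^2 - 4 t r]; its increment from [t] to [pi] is
    [pi^2 - 4 pi t + 3 t^2], which factors as shown. *)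
Lemma integral_idcot_lin_r (t : R) : t \in `[0, pi] ->
  (\int[mu]_(r in `[t, pi]) (2 * idcot_lin r t)%:E = (idcot t * ((pi - t) * (pi - 3 * t)))%:E)%E.
Proof.
rewrite in_itv/= => /andP[t0]; rewrite le_eqVlt => /predU1P[->|tpi].
  by rewrite set_itv1 integral_set1 subrr mul0r mulr0.
have [||i E] := @FTC_derive R (fun r => 2 * idcot_lin r t) (fun r => idcot t * (r ^+ 2 - 4 * t * r)) t pi tpi.
- move=> r _; apply: cvgM; first exact: cvg_cst.
  apply: cvgM; last exact: cvg_cst.
  by apply: cvgB; [apply: cvgB; [exact: cvg_id|exact: cvg_cst]|exact: cvg_cst].
- by move=> r _; apply: is_derive_eq; rewrite /idcot_lin /GRing.scale/=; ring.
by rewrite EFin_Rintegral// E; congr EFin; ring.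
Qed.

(* The integral of [2 (r - 2t) t cot t] over [[0, r]], written on a fixed domain for Fubini. *)
Definition triangle_idcot (r : R) : \bar R :=
  (\int[mu]_(t in `[0%R, pi]) (if (t <= r)%R then 2 * idcot_lin r t else 0)%R%:E)%E.

Lemma measurable_if_le (f : R -> R -> R) : measurable_fun [set: R * R] (fun z => f z.1 z.2) ->
  measurable_fun [set: R * R] (fun z => if z.1 <= z.2 then f z.1 z.2 else 0).
Proof.
by move=> mf; apply: measurable_fun_ifT => //; exact: measurable_fun_ler.
Qed.

Lemma measurable_triangle_idcot : measurable_fun setT triangle_idcot.
Proof.
apply: (@measurable_integral_param R _ (fun r t => (if (t <= r)%R then 2 * idcot_lin r t else 0)%R%:E)) => //.
apply: (@measurable_swap2 R (fun t r => (if (t <= r)%R then 2 * idcot_lin r t else 0)%R%:E)).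
apply/measurable_EFinP; apply: (@measurable_if_le (fun t r => 2 * idcot_lin r t)).
by rewrite /idcot_lin /idcot; meas.
Qed.

(** The integrand changes sign at [t = r / 2], so exchanging [r] and [t] takes an absolute bound:
    [|r - 2t| <= pi] on the triangle, and the inner integral is then at most
    [2 pi |idcot t| (pi - t)], controlled by [idcot_bounded]. *)
Lemma integral_triangle_idcot :
  (\int[mu]_(r in `[0%R, pi]) triangle_idcot r = (9 * pi / 2 * zeta (3 : R))%:E)%E.
Proof.
have [B [B0 HB]] := idcot_bounded; have p0 := pi_ge0 R; have p0' := pi_gt0 R.
pose f (t r : R) : \bar R := (if (t <= r)%R then 2 * idcot_lin r t else 0)%R%:E.
have mf : measurable_fun [set: R * R] (fun z => f z.1 z.2).
  apply/measurable_EFinP; apply: (@measurable_if_le (fun t r => 2 * idcot_lin r t)).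
  by rewrite /idcot_lin /idcot; meas.
rewrite /triangle_idcot -(@fubini_set R _ _ f)//; last first.
  apply: (@le_lt_trans _ _ (\int[mu]_(t in `[0%R, pi]) (2 * pi * B)%:E)%E); last first.
    by rewrite EFin_Rintegral ?ltry//; exact: integrable_cstR.
  apply: ge0_le_integral => //.
  - by move=> t _; apply: integral_ge0.
  - apply: measurable_funTS; apply: (@measurable_integral_param R _ (fun t r => `|f t r|%E)) => //.
    by apply: measurableT_comp mf.
  move=> t; rewrite /= in_itv/= => /andP[t0 tpi].
  apply: (@le_trans _ _ (\int[mu]_(r in `[0%R, pi]) (if (t <= r)%R then 2 * pi * `|idcot t| else 0)%R%:E)%E).
    apply: ge0_le_integral => //.
    - apply/measurable_funTS/measurable_EFinP.
      apply: (measurableT_comp (@normr_measurable R setT)).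
      apply: measurable_fun_ifT => //; first exact: measurable_fun_ler.
      by rewrite /idcot_lin /idcot; meas.
    - apply/measurable_funTS/measurable_EFinP; apply: measurable_fun_ifT => //.
      exact: measurable_fun_ler.
    move=> r; rewrite /= in_itv/= => /andP[r0 rpi]; rewrite /f; case: ifPn => tr; last by rewrite normr0.
    rewrite lee_fin normrM normr_nat normrM mulrA; apply: ler_wpM2r => //; apply: ler_wpM2l => //.
    by rewrite ler_norml; apply/andP; split; lra.
  rewrite integral_if_ge// EFin_Rintegral ?Rintegral_cstR//; last exact: integrable_cstR.
  rewrite lee_fin -mulrA ler_wpM2l ?mulr_ge0// HB//.
  by rewrite in_itv/= t0.
transitivity (\int[mu]_(t in `[0%R, pi]) (idcot t * ((pi - t) * (pi - 3 * t)))%:E)%E.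
  apply: eq_integral => t; rewrite inE => tin; rewrite -integral_idcot_lin_r//.
  by rewrite /f integral_if_ge//; move: tin; rewrite /= in_itv/= => /andP[].
rewrite -Rintegral_zeta3 EFin_Rintegral//.
apply: (@integrable_bounded _ _ _ (B * (2 * pi))); first by rewrite /idcot; meas.
move=> t tin; have tin' := tin; move: tin'; rewrite in_itv/= => /andP[t0 tpi].
rewrite mulrA normrM ler_pM//.
  by rewrite normrM (ger0_norm (_ : 0 <= pi - t)) ?subr_ge0// HB.
by rewrite ler_norml; apply/andP; split; lra.
Qed.

Definition log_excess (r p q : R) : R := 2 * (Jf p q r - ell r).

Lemma measurable_log_excess r : measurable_fun [set: R * R] (fun z => log_excess r z.2 z.1).
Proof.
apply: measurable_funM => //; apply: measurable_funB => //.
exact: measurable_Jf.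
Qed.

Lemma log_excess_ge0 r p q : sin r != 0 -> 0 <= log_excess r p q.
Proof. by move=> sr; rewrite mulr_ge0// subr_ge0 ell_le_Jf. Qed.

Lemma log_excessE (r p q : R) : sin r != 0 ->
  log_excess r p q = ln (1 + 4 / sin r ^+ 2 * Num.max (kap p q r) 0).
Proof.
move=> sr; have s2 : 0 < sin r ^+ 2 by rewrite exprn_even_gt0.
have k0 : 0 <= Num.max (kap p q r) 0 by rewrite le_max lexx orbT.
have e2 : 2 * ell r = ln (4 * sin r ^+ 2).
  have -> : 4 * sin r ^+ 2 = (2 * `|sin r|) ^+ 2.
    by rewrite exprMn real_normK ?num_real//; ring.
  by rewrite lnXn ?mulr_gt0 ?normr_gt0// mulr_natl.
rewrite /log_excess mulrBr e2 /Jf mulrC divfK//.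
have -> : 4 * sin r ^+ 2 + 16 * Num.max (kap p q r) 0 =
    4 * sin r ^+ 2 * (1 + 4 / sin r ^+ 2 * Num.max (kap p q r) 0) by field.
have d0 : 0 < 1 + 4 / sin r ^+ 2 * Num.max (kap p q r) 0.
  by rewrite ltr_pwDl// mulr_ge0// divr_ge0// ltW.
have s4 : 0 < 4 * sin r ^+ 2 by rewrite mulr_gt0.
by rewrite lnM ?posrE// addrC addKr.
Qed.

Lemma log_excess_den (r p q : R) : 0 < r < pi -> p \in `[0, r] -> q \in `[0, r] ->
  log_excess r p q = ln (den r p q).
Proof.
move=> rp pr qr; have /andP[r0 rpi] := rp.
have kE : kap p q r = phi r p * phi r q.
  rewrite /kap /phi -(opprB r p) -(opprB r q) !sinN; ring.
rewrite log_excessE ?gt_eqF ?sin_gt0_pi// kE.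
by rewrite (max_idPl _)// mulr_ge0// phi_ge0.
Qed.

Lemma log_excess_cross (r p q : R) : 0 < r < pi -> p \in `[0, r] -> q \in `[r, pi] ->
  log_excess r p q = 0.
Proof.
move=> rp; have /andP[r0 rpi] := rp; rewrite !in_itv/= => /andP[p0 pr] /andP[rq qpi].
rewrite log_excessE ?gt_eqF ?sin_gt0_pi// (max_idPr _) ?mulr0 ?addr0 ?ln1//.
rewrite /kap -(opprB r p) sinN mulrN mulNr oppr_le0 !mulr_ge0//; apply: sin_ge0_pi; apply/andP; split; lra.
Qed.

Lemma log_excessC (r p q : R) : log_excess r p q = log_excess r q p.
Proof.
have kC : kap p q r = kap q p r by rewrite /kap; ring.
by rewrite /log_excess /Jf kC.
Qed.

(** This symmetry carries the square [[r, pi]^2] for [r] onto [[0, pi - r]^2] for [pi - r], so the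
    second square reduces to the first. *)
Lemma log_excess_reflect (r p q : R) : log_excess r (pi - p) (pi - q) = log_excess (pi - r) p q.
Proof.
have sB (x : R) : sin (pi - x) = sin x by rewrite sinB sinpi cospi; ring.
have sC (x : R) : sin (pi - x - r) = - sin (x - (pi - r)).
  by rewrite -sinN; congr sin; ring.
have kr : kap (pi - p) (pi - q) r = kap p q (pi - r) by rewrite /kap !sB !sC; ring.
by rewrite /log_excess /Jf kr /ell !sB.
Qed.

Lemma integral_log_excess0 (r : R) : 0 < r < pi ->
  (\int[mu]_(q in `[0%R, r]) \int[mu]_(p in `[0%R, r]) (log_excess r p q)%:E = triangle_idcot r)%E.
Proof.
move=> rp; have /andP[r0 rpi] := rp; rewrite /triangle_idcot.
rewrite (integral_if_le _ (ltW rpi)) -(integral_ln_den_idcot_lin rp).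
apply: eq_integral => q; rewrite inE => qr; apply: eq_integral => p; rewrite inE => pr.
by rewrite log_excess_den.
Qed.

Lemma triangle_idcot_ge0 r : 0 < r < pi -> (0 <= triangle_idcot r)%E.
Proof.
move=> rp; have /andP[r0 rpi] := rp; rewrite -(integral_log_excess0 rp).
apply: integral_ge0 => q _; apply: integral_ge0 => p _.
by rewrite lee_fin log_excess_ge0// gt_eqF// sin_gt0_pi.
Qed.

Lemma integral_log_excess (r : R) : 0 < r < pi ->
  (\int[mu]_(q in `[0%R, pi]) \int[mu]_(p in `[0%R, pi]) (log_excess r p q)%:E =
   triangle_idcot r + triangle_idcot (pi - r)%R)%E.
Proof.
move=> rp; have /andP[r0 rpi] := rp.
have sr : sin r != 0 by rewrite gt_eqF// sin_gt0_pi.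
have mv q : measurable_fun setT (fun p => (log_excess r p q)%:E).
  apply/measurable_EFinP; apply: measurable_funM => //; apply: measurable_funB => //.
  exact: measurable_Jf.
have v0 p q : (0 <= (log_excess r p q)%:E)%E by rewrite lee_fin log_excess_ge0.
have mv2 (D : set R) : measurable D -> measurable_fun setT (fun q => \int[mu]_(p in D) (log_excess r p q)%:E)%E.
  move=> mD; apply: (@measurable_integral_param R D (fun q p => (log_excess r p q)%:E)) => //.
  by apply/measurable_EFinP; exact: (measurable_log_excess r).
have i0 (D : set R) q : (0 <= \int[mu]_(p in D) (log_excess r p q)%:E)%E by exact: integral_ge0.
have cat f := @ge0_integral_itv_cat R 0 r pi f (ltW r0) (ltW rpi).
rewrite cat//; last exact: mv2.
congr (_ + _)%E.
  rewrite -(integral_log_excess0 rp); apply: eq_integral => q; rewrite inE => qr.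
  rewrite cat// [X in (_ + X)%E]integral0_eq ?adde0// => p pr.
  by rewrite log_excessC log_excess_cross.
have refl f : measurable_fun setT f -> (forall x, 0 <= f x)%E ->
    (\int[mu]_(x in `[r, pi]) f x = \int[mu]_(x in `[0%R, (pi - r)%R]) f (pi - x)%R)%E.
  move=> mf f0; have := @ge0_integral_reflect R pi 0 (pi - r) f mf f0.
  by rewrite subr0 (_ : pi - (pi - r) = r)//; ring.
have rp' : 0 < pi - r < pi by apply/andP; split; lra.
rewrite -(integral_log_excess0 rp').
transitivity (\int[mu]_(q in `[r, pi]) \int[mu]_(p in `[r, pi]) (log_excess r p q)%:E)%E.
  apply: eq_integral => q; rewrite inE => qr.
  by rewrite cat// [X in (X + _)%E]integral0_eq ?add0e// => p pr; rewrite log_excess_cross.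
rewrite (refl _ (mv2 _ (measurable_itv _)) (i0 _)).
apply: eq_integral => q _; rewrite (refl _ (mv (pi - q)) (v0 ^~ (pi - q))).
by apply: eq_integral => p _; rewrite log_excess_reflect.
Qed.

(** The factor 2 matches that of [log_excess], so that adding the two integrands eliminates [Jf].
    The pair is ordered as [(r, q)]. *)
Definition hJ_int (z : R * R) : \bar R := (\int[mu]_(p in `[0%R, pi]) (2 * hJ p z.2 z.1)%:E)%E.

Lemma measurable_hJ_int : measurable_fun setT hJ_int.
Proof.
apply: (@measurable_ge0_integral R _ (R * R)%type _ (fun z p => (2 * hJ p z.2 z.1)%:E)) => //.
  apply/measurable_EFinP/measurable_funM => //; apply: measurable_hJ => //.
    exact: (measurableT_comp measurable_snd measurable_fst).
  exact: (measurableT_comp measurable_fst measurable_fst).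
by move=> z p _; rewrite lee_fin mulr_ge0// hJ_ge0.
Qed.

Lemma hJ_int_ge0 z : (0 <= hJ_int z)%E.
Proof. by apply: integral_ge0 => p _; rewrite lee_fin mulr_ge0// hJ_ge0. Qed.

Definition hJ_int2 (r : R) : \bar R := (\int[mu]_(q in `[0%R, pi]) hJ_int (r, q))%E.

Lemma measurable_hJ_int2 : measurable_fun setT hJ_int2.
Proof.
apply: (@measurable_ge0_integral R _ R _ (fun r q => hJ_int (r, q))) => //.
  rewrite (_ : (fun z => _) = hJ_int); first exact: measurable_hJ_int.
  by apply/funext => -[].
by move=> x y _; exact: hJ_int_ge0.
Qed.

(** Pointwise [2 hJ + log_excess = 2 (ln 5 - ell r)], which depends on [r] alone. Stated as a sum of
    nonnegative terms, it avoids any subtraction of extended reals. *)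
Lemma hJ_int2_log_excess (r : R) : 0 < r < pi ->
  (hJ_int2 r + (triangle_idcot r + triangle_idcot (pi - r)%R) =
   (pi ^+ 2 * (2 * (ln 5 - ell r)))%:E)%E.
Proof.
move=> rp; have /andP[r0 rpi] := rp; have p0 := pi_ge0 R.
have sr : sin r != 0 by rewrite gt_eqF// sin_gt0_pi.
have h0 p q : (0 <= (2 * hJ p q r)%:E)%E by rewrite lee_fin mulr_ge0// hJ_ge0.
have v0 p q : (0 <= (log_excess r p q)%:E)%E by rewrite lee_fin log_excess_ge0.
have mh q : measurable_fun setT (fun p => (2 * hJ p q r)%:E).
  by apply/measurable_EFinP/measurable_funM => //; apply: measurable_hJ.
have mv q : measurable_fun setT (fun p => (log_excess r p q)%:E).
  apply/measurable_EFinP; apply: measurable_funM => //; apply: measurable_funB => //.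
  exact: measurable_Jf.
rewrite -integral_log_excess// /hJ_int2 -ge0_integralD//; last 4 first.
- by move=> q _; exact: hJ_int_ge0.
- apply: measurable_funTS; apply: (measurableT_comp measurable_hJ_int).
  exact: measurable_fun_pair.
- by move=> q _; apply: integral_ge0 => p _; exact: v0.
- apply: measurable_funTS; apply: (@measurable_integral_param R _ (fun q p => (log_excess r p q)%:E)) => //.
  by apply/measurable_EFinP; exact: (measurable_log_excess r).
transitivity (\int[mu]_(q in `[0%R, pi]) (pi * (2 * (ln 5 - ell r)))%:E)%E.
  apply: eq_integral => q _; rewrite /hJ_int/= -ge0_integralD//; last 2 first.
  - exact: (measurable_funTS (mh q)).
  - exact: (measurable_funTS (mv q)).
  transitivity (\int[mu]_(p in `[0%R, pi]) (2 * (ln 5 - ell r))%:E)%E.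
    by apply: eq_integral => p _; rewrite /= -EFinD /log_excess /hJ; congr EFin; ring.
  rewrite EFin_Rintegral ?Rintegral_cstR//; last exact: integrable_cstR.
  by rewrite subr0 mulrC.
rewrite EFin_Rintegral ?Rintegral_cstR//; last exact: integrable_cstR.
by rewrite subr0 expr2; congr EFin; ring.
Qed.

Lemma integral_hJ_int2 :
  (\int[mu]_(r in `[0%R, pi]) hJ_int2 r = (2 * pi ^+ 3 * ln 5 - 9 * pi * zeta (3 : R))%:E)%E.
Proof.
have p0 := pi_ge0 R.
(* [triangle_idcot] is known to be nonnegative for [0 < r < pi]; the cut-off makes this hold
   everywhere and changes the integral over [[0, pi]] by a null set at most. *)
pose T0 := triangle_idcot \_ `]0, pi[%classic.
have mT0 : measurable_fun setT T0.
  by apply/(measurable_restrictT _ _).1 => //; exact: (measurable_funTS measurable_triangle_idcot).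
have T00 r : (0 <= T0 r)%E.
  rewrite /T0 patchE; case: ifPn => // ; rewrite inE/= in_itv/=; exact: triangle_idcot_ge0.
have T0E r : r \in `]0, pi[ -> T0 r = triangle_idcot r by move=> rin; rewrite /T0 patchE mem_setE rin.
have iT0 : (\int[mu]_(r in `[0%R, pi]) T0 r = (9 * pi / 2 * zeta (3 : R))%:E)%E.
  rewrite -integral_triangle_idcot; apply: ae_itv_eq => //; exact: measurable_triangle_idcot.
have G0 r : (0 <= hJ_int2 r)%E by apply: integral_ge0 => q _; exact: hJ_int_ge0.
have mr : measurable_fun setT (fun r : R => pi - r) by exact: measurable_funB.
have mT0r : measurable_fun setT (fun r : R => T0 (pi - r)) by exact: measurableT_comp mr.
have iell : mu.-integrable `[0, pi] (EFin \o @ell R).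
  rewrite (_ : @ell R = fun q => ell (q + 0)); first exact: integrable_ell_shift.
  by apply/funext => q; rewrite addr0.
have E : (\int[mu]_(r in `[0%R, pi]) (hJ_int2 r + (T0 r + T0 (pi - r)%R)) = (2 * pi ^+ 3 * ln 5)%:E)%E.
  transitivity (\int[mu]_(r in `[0%R, pi]) (2 * pi ^+ 2 * ln 5 - 2 * pi ^+ 2 * ell r)%:E)%E.
    apply: ae_itv_eq.
    - by apply: emeasurable_funD; [exact: measurable_hJ_int2|exact: emeasurable_funD].
    - apply/measurable_EFinP/measurable_funB => //; apply: measurable_funM => //.
      exact: measurable_ell.
    move=> r rin; rewrite !T0E//; last first.
      by move: rin; rewrite !in_itv/= => /andP[? ?]; apply/andP; split; lra.
    by rewrite hJ_int2_log_excess; [congr EFin; ring|move: rin; rewrite in_itv].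
  have ic : mu.-integrable `[0, pi] (EFin \o (fun=> 2 * pi ^+ 2 * ln 5 : R)) by exact: integrable_cstR.
  have ie2 : mu.-integrable `[0, pi] (EFin \o (fun r => 2 * pi ^+ 2 * ell r : R)) by exact: integrableZR.
  rewrite EFin_Rintegral//; last exact: integrableBR.
  have i1 : \int[mu]_(x in `[0, pi]) (2 * pi ^+ 2 * ln 5) = 2 * pi ^+ 2 * ln 5 * (pi - 0) :> R.
    exact: Rintegral_cstR.
  have i2 : \int[mu]_(x in `[0, pi]) (2 * pi ^+ 2 * ell x) = 0 :> R.
    rewrite RintegralZl// (_ : \int[mu]_(x in `[0, pi]) ell x = 0) ?mulr0//.
    transitivity (\int[mu]_(x in `[0, pi]) ell (x + 0)); last exact: Rintegral_ell_shift.
    by apply: eq_Rintegral => x _; rewrite addr0.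
  by rewrite (RintegralB _ ic ie2)// i1 i2; congr EFin; ring.
move: E; rewrite ge0_integralD//; last 3 first.
- exact: (measurable_funTS measurable_hJ_int2).
- by move=> r _; rewrite adde_ge0.
- exact: (measurable_funTS (emeasurable_funD mT0 mT0r)).
have -> : (\int[mu]_(r in `[0%R, pi]) (T0 r + T0 (pi - r)%R) =
    (9 * pi / 2 * zeta (3 : R) + 9 * pi / 2 * zeta (3 : R))%:E)%E.
  rewrite ge0_integralD//; last 2 first.
  - exact: (measurable_funTS mT0).
  - exact: (measurable_funTS mT0r).
  by rewrite (integral_reflect0 _ mT0) iT0.
(* A finite sum with a finite second term rules out the infinite cases, and the equation is solved
   in [R]. *)
case: (integral _ _ _) => [g||]//; rewrite -!EFinD => -[E]; congr EFin.
by move: E => /(canRL (addrK _)) ->; field.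
Qed.

Lemma Theta_value :
  Theta = ((pi ^+ 2 * ln 5) - 9 / 2 * zeta (3 : R))%:E.
Proof.
have p0 := pi_ge0 R; have p0' := pi_gt0 R; have p1 : (pi : R) != 0 by rewrite gt_eqF.
have c0 : 0 <= (2 * pi)^-1 :> R by rewrite invr_ge0 mulr_ge0.
have mK q : measurable_fun setT (fun r => hJ_int (r, q)).
  by apply: (measurableT_comp measurable_hJ_int); exact: measurable_fun_pair.
(* In [(2 * pi)^-1], the [pi] is that of [Theta] and the 2 undoes the factor in [hJ_int]. *)
transitivity (\int[mu]_(q in `[0%R, pi]) \int[mu]_(r in `[0%R, pi]) ((2 * pi)^-1%:E * hJ_int (r, q)))%E.
  apply: eq_integral => q _; apply: ae_itv_eq.
  - apply/measurable_EFinP/measurable_funM => //; apply: measurableT_comp => //.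
    apply: (@measurable_integral_param R _ (fun r p => (hJ p q r)%:E)) => //.
    by apply/measurable_EFinP; apply: measurable_hJ.
  - by apply: emeasurable_funM => //; exact: mK.
  move=> r; rewrite in_itv/= => /andP[r0 rpi].
  have sr : sin r != 0 by rewrite gt_eqF// sin_gt0_pi// r0.
  have ih : mu.-integrable `[0, pi] (EFin \o (fun p => hJ p q r)).
    apply: (@integrable_bounded _ _ _ (ln 5 + `|ell r|)); first exact: measurable_hJ.
    by move=> p _; rewrite ger0_norm ?hJ_ge0// hJ_le.
  rewrite /hJ_int EFin_Rintegral; last 2 first.
  - by [].
  - exact: integrableZR.
  rewrite RintegralZl// -EFinM; congr EFin.
  have fE (a I : R) : a != 0 -> a^-1 * I = (2 * a)^-1 * (2 * I) by move=> a0; field.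
  exact: fE.
transitivity ((2 * pi)^-1%:E * \int[mu]_(q in `[0%R, pi]) \int[mu]_(r in `[0%R, pi]) hJ_int (r, q))%E.
  rewrite -ge0_integralZl//; last 2 first.
  - apply: measurable_funTS; apply: (@measurable_integral_param R _ (fun q r => hJ_int (r, q))) => //.
    exact: (measurableT_comp measurable_hJ_int (@measurable_swap _ _ R R)).
  - by move=> q _; apply: integral_ge0 => r _; exact: hJ_int_ge0.
  apply: eq_integral => q _; rewrite ge0_integralZl//; first exact: (measurable_funTS (mK q)).
  by move=> r _; exact: hJ_int_ge0.
rewrite (@ge0_fubini_set R _ _ (fun q r => hJ_int (r, q)))//; last 2 first.
- exact: (measurableT_comp measurable_hJ_int (@measurable_swap _ _ R R)).
- by move=> q r _ _; exact: hJ_int_ge0.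
rewrite integral_hJ_int2 -EFinM; congr EFin.
have fE (a l z : R) : a != 0 ->
    (2 * a)^-1 * (2 * a ^+ 3 * l - 9 * a * z) = a ^+ 2 * l - 9 / 2 * z by move=> a0; field.
exact: fE.
Qed.

Lemma outer_J_cvg_zeta : outer_J d @[d --> \oo] --> 9 / 2 * zeta (3 : R).
Proof.
have [_] := @outer_J_cvg R; rewrite Theta_value/=.
by rewrite (_ : _ - (_ - _) = 9 / 2 * zeta (3 : R))//; ring.
Qed.

End limit_value.

(** * From half-angles back to the full torus *)

Section half_angle.
Context {R : realType}.
Local Notation mu := (@lebesgue_measure R).

(** A positive real factor distributes over the difference in all infinite cases as well, so scaling
    applies to integrals given as positive minus negative part. *)
Lemma gt0_muleBr (c : R) (a b : \bar R) : 0 < c -> (c%:E * (a - b) = c%:E * a - c%:E * b)%E.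
Proof.
move=> c0; move: a b => [a||] [b||];
  rewrite ?(gt0_muley, gt0_muleNy) ?lte_fin//= ?(gt0_muley, gt0_muleNy) ?lte_fin//.
by congr EFin; rewrite mulrBr.
Qed.

Lemma integral_gt0Zl (c : R) (D : set R) (f : R -> \bar R) : 0 < c -> measurable D ->
  measurable_fun setT f ->
  (\int[mu]_(x in D) (c%:E * f x) = c%:E * \int[mu]_(x in D) f x)%E.
Proof.
move=> c0 mD mf; rewrite integralE [in RHS]integralE gt0_muleBr//.
rewrite ge0_funeposM ?ge0_funenegM ?(ltW c0)//.
rewrite !ge0_integralZl// ?lee_fin ?(ltW c0)//.
  exact: (measurable_funTS (measurable_funeneg mf)).
exact: (measurable_funTS (measurable_funepos mf)).
Qed.

Lemma integral_half_angle (f : R -> \bar R) : measurable_fun setT f ->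
  (\int[mu]_(x in `[0%R, (2 * pi)%R]) f (x / 2)%R = 2%:E * \int[mu]_(x in `[0%R, pi]) f x)%E.
Proof.
move=> mf.
have h g : measurable_fun setT g -> (forall x, 0 <= g x)%E ->
    (\int[mu]_(x in `[0%R, (2 * pi)%R]) g (x / 2)%R = 2%:E * \int[mu]_(x in `[0%R, pi]) g x)%E.
  move=> mg g0; have m2 : measurable_fun setT (fun x : R => g (x / 2)).
    by apply: measurableT_comp mg _; exact: measurable_funM.
  have := @ge0_integral_affine_itv R 2 0 0 pi (fun x => g (x / 2)) (ltr0Sn R 1) m2.
  rewrite mulr0 !addr0 => ->//; congr (_ * _)%E; apply: eq_integral => x _.
  by rewrite addr0 mulrC mulKf.
rewrite integralE [in RHS]integralE gt0_muleBr//; congr (_ - _)%E.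
  rewrite -(h (f^\+)%E (measurable_funepos mf))//.
  by apply: eq_integral => x _; rewrite !funeposE.
rewrite -(h (f^\-)%E (measurable_funeneg mf))//.
by apply: eq_integral => x _; rewrite !funenegE.
Qed.

(** Each of the two half-angle substitutions contributes a factor 2, which turns [(2 pi)^-2] into
    [pi^-2]. *)
Lemma mahler_measure_Pn d : mahler_measure (P_ R d) =
  ((pi ^+ 2)^-1%:E * \int[mu]_(p in `[0%R, pi]) \int[mu]_(s in `[0%R, pi]) lne (Pn d s p)%:E)%E.
Proof.
have mL := @measurable_lnePn R d.
have mLs : measurable_fun [set: R * R] (fun z => lne (Pn d z.2 z.1)%:E).
  exact: (@measurable_swap2 R (fun s p => lne (Pn d s p)%:E) mL).
have mI : measurable_fun setT (fun p => \int[mu]_(s in `[0%R, pi]) lne (Pn d s p)%:E)%E.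
  exact: (@measurable_integral_param R _ (fun p s => lne (Pn d s p)%:E)).
have E : (\int[mu]_(t2 in `[0%R, (2 * pi)%R]) \int[mu]_(t1 in `[0%R, (2 * pi)%R])
      lne (ComplexField.Normc.normc (P_ R d).[expi t1, expi t2]%R)%:E =
    (2%:E * (2%:E * \int[mu]_(p in `[0%R, pi]) \int[mu]_(s in `[0%R, pi]) lne (Pn d s p)%:E)))%E.
  transitivity (\int[mu]_(t2 in `[0%R, (2 * pi)%R])
      (2%:E * \int[mu]_(s in `[0%R, pi]) lne (Pn d s (t2 / 2)%R)%:E))%E.
    apply: eq_integral => t2 _.
    rewrite -(@integral_half_angle (fun s => lne (Pn d s (t2 / 2)%R)%:E)); last first.
      exact: (@measurable_section1 R _ _ (fun s p => lne (Pn d s p)%:E)).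
    apply: eq_integral => t1 _; rewrite /Pn.
    by do 2 (rewrite [2 * (_ / 2)]mulrC divfK//).
  rewrite (@integral_half_angle (fun p => 2%:E * \int[mu]_(s in `[0%R, pi]) lne (Pn d s p)%:E)%E).
    by rewrite integral_gt0Zl.
  exact: emeasurable_funM.
rewrite /mahler_measure E !muleA -!EFinM; congr (_%:E * _)%E.
have fE (a : R) : a != 0 -> ((2 * a) ^+ 2)^-1 * 2 * 2 = (a ^+ 2)^-1 by move=> a0; field.
by rewrite fE// gt_eqF// pi_gt0.
Qed.

End half_angle.

Theorem theorem6p2 (R : realType) :
  mahler_measure (P_ R d) @[d --> \oo] -->
    (9 / (2 * pi ^+ 2) * zeta (3 : R))%:E.
Proof.
have p0 := pi_gt0 R.
have [m mP] := boolp.choice (@outer_bounds R).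
have -> : (fun d => mahler_measure (P_ R d)) = EFin \o (fun d => (pi ^+ 2)^-1 * m d).
  by apply/funext => d; rewrite mahler_measure_Pn /=; have [-> _ _] := mP d.
have -> : 9 / (2 * pi ^+ 2) * zeta (3 : R) = (pi ^+ 2)^-1 * (9 / 2 * zeta (3 : R)).
  have fE (a z : R) : a != 0 -> 9 / (2 * a ^+ 2) * z = (a ^+ 2)^-1 * (9 / 2 * z) by move=> a0; field.
  by rewrite fE// gt_eqF.
apply: cvg_EFin; first exact: nearW.
apply: cvgM; first exact: cvg_cst.
have h (c : R) : c / d.+2%:R @[d --> \oo] --> (0 : R).
  rewrite -[X in _ --> X](mulr0 c); apply: cvgM; first exact: cvg_cst.
  by have := @cvg_harmonic R; rewrite -cvg_shiftS.
have J := @outer_J_cvg_zeta R.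
apply: (@squeeze_cvgr _ _ _ _ (fun d => outer_J d - pi ^+ 2 * (2 * ln 5 + ln 2) / d.+2%:R)
  (fun d => outer_J d + pi ^+ 2 * ln 2 / d.+2%:R)).
- by apply: nearW => d; have [_ up lo] := mP d; rewrite up lo.
- by rewrite -[X in _ --> X]subr0; apply: cvgB J _; exact: h.
- by rewrite -[X in _ --> X]addr0; apply: cvgD J _; exact: h.
Qed.
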